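(* Let $X_1,\ldots,X_n$ be independent random vectors with the standard normal distribution on $\mathbb{R}^d$, and set $\mathcal P_{n,d}=\mathrm{conv}[X_1,\ldots,X_n]$ and $\mathcal P_{n,d}^{\pm}=\mathrm{conv}[\pm X_1,\ldots,\pm X_n]$. Then for all integers $1\le d<n$, $$\mathbb E\,\mathrm{Vol}_d(\mathcal P_{n,d})=\frac{\kappa_d\,n!}{d!\,(n-d-1)!}\int_{-\infty}^{\infty}\Phi^{n-d-1}(t)\,\varphi^{d+1}(t)\,\mathrm dt,$$ and for all integers $1\le d<n$, $$\mathbb E\,\mathrm{Vol}_d(\mathcal P_{n,d}^{\pm})=\frac{\kappa_d\,n!}{d!\,(n-d-1)!}\int_{0}^{\infty}(2\Phi(t)-1)^{n-d-1}\,(2\varphi(t))^{d+1}\,\mathrm dt.$$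
   Context: $\mathrm{conv}$ denotes the convex hull and $\mathrm{Vol}_d$ is $d$-dimensional Lebesgue measure. $\kappa_d=\pi^{d/2}/\Gamma(\frac d2+1)$ is the volume of the $d$-dimensional unit ball. $\varphi(t)=\frac{1}{\sqrt{2\pi}}e^{-t^2/2}$ and $\Phi(t)=\int_{-\infty}^t\varphi(s)\,\mathrm ds$ are the standard normal density and distribution function. *)

(* Defs.v *)
From HB Require Import structures.
From mathcomp Require Import all_boot all_order all_algebra.
From mathcomp Require Import all_classical all_reals all_analysis.

Set Implicit Arguments.
Unset Strict Implicit.
Unset Printing Implicit Defensive.

Import Order.TTheory GRing.Theory Num.Theory.
Import numFieldNormedType.Exports.

Local Open Scope classical_set_scope.
Local Open Scope ring_scope.

Definition measure_rV_display : measure_display. Proof. exact. Qed.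

(* R^d is 'rV[R]_d with the sigma-algebra generated by the coordinates, i.e.
   the product (= Borel) sigma-algebra, as the library does for tuples. *)
Section measurable_rV.
Context {R : realType} (d : nat).

Let coor : 'I_d -> 'rV[R]_d -> measurableTypeR R := fun i x => x 0 i.

Let rV_set0 : g_sigma_preimage coor set0.
Proof. exact: sigma_algebra0. Qed.

Let rV_setC A : g_sigma_preimage coor A -> g_sigma_preimage coor (~` A).
Proof. exact: sigma_algebraC. Qed.

Let rV_bigcup (F : _^nat) : (forall i, g_sigma_preimage coor (F i)) ->
  g_sigma_preimage coor (\bigcup_i (F i)).
Proof. exact: sigma_algebra_bigcup. Qed.

HB.instance Definition _ := @isMeasurable.Build measure_rV_display
  'rV[R]_d (g_sigma_preimage coor) rV_set0 rV_setC rV_bigcup.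

Lemma measurable_coor (i : 'I_d) : measurable_fun [set: 'rV[R]_d] (coor i).
Proof.
move=> _ Y mY; rewrite setTI; apply: sub_sigma_algebra => /=.
rewrite -bigcup_seq/=; exists i => /=; first by rewrite mem_index_enum.
by exists Y => //; rewrite setTI.
Qed.

Lemma measurable_fun_rVP dT (T : measurableType dT) (f : T -> 'rV[R]_d) :
  measurable_fun [set: T] f <->
  forall i, measurable_fun [set: T] (coor i \o f).
Proof.
split=> [mf i|mf]; first exact: measurableT_comp (measurable_coor i) mf.
move=> _ A mA; rewrite setTI.
suff: g_sigma_preimage coor `<=` [set B | measurable (f @^-1` B)] by apply.
apply: smallest_sub.
  split=> /=; first by rewrite preimage_set0.
  - move=> B mB; rewrite setTD preimage_setC; exact: measurableC.
  - by move=> F mF; rewrite preimage_bigcup; exact: bigcup_measurable.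
rewrite -bigcup_seq/= => B [i _ [C mC <-]] /=.
by rewrite setTI -comp_preimage -[X in measurable X]setTI; exact: mf.
Qed.

End measurable_rV.

Section lebesgue_step.
Context {R : realType} (d : nat).

Definition cons_rV (p : measurableTypeR R * 'rV[R]_d) : 'rV[R]_d.+1 :=
  \row_j (if unlift ord0 j is Some k then p.2 0 k else p.1).

Lemma cons_rV0 p : cons_rV p 0 ord0 = p.1.
Proof. by rewrite mxE unlift_none. Qed.

Lemma cons_rVS p i : cons_rV p 0 (lift ord0 i) = p.2 0 i.
Proof. by rewrite mxE liftK. Qed.

Lemma measurable_cons_rV : measurable_fun [set: _] cons_rV.
Proof.
apply/measurable_fun_rVP => i; have [j ->|->] := unliftP ord0 i.
  rewrite (_ : _ \o _ = (fun x : 'rV[R]_d => x 0 j) \o snd).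
    exact: measurableT_comp (measurable_coor j) measurable_snd.
  by apply/funext => p /=; exact: cons_rVS.
rewrite (_ : _ \o _ = fst); first exact: measurable_fst.
by apply/funext => p /=; exact: cons_rV0.
Qed.

Variable m : {sigma_finite_measure set 'rV[R]_d -> \bar R}.

(* Image of the product of one-dimensional Lebesgue measure and [m] under
   (a, x) |-> (a, x_0, .., x_(d-1)). *)
Definition lebesgue_cons : set 'rV[R]_d.+1 -> \bar R :=
  pushforward (lebesgue_measure \x m)%E cons_rV.

Let lebesgue_cons0 : lebesgue_cons set0 = 0%E.
Proof. by rewrite /lebesgue_cons /pushforward preimage_set0 measure0. Qed.

Let lebesgue_cons_ge0 A : (0 <= lebesgue_cons A)%E.
Proof. by apply: integral_ge0 => x _ /=; exact: measure_ge0. Qed.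

Let lebesgue_cons_sigma_additive : semi_sigma_additive lebesgue_cons.
Proof.
move=> F mF tF mUF; rewrite /lebesgue_cons /pushforward preimage_bigcup.
apply: measure_semi_sigma_additive.
- by move=> n; rewrite -[X in measurable X]setTI; exact: measurable_cons_rV.
- apply/trivIsetP => /= i j _ _ ij; rewrite -preimage_setI.
  by move/trivIsetP : tF => /(_ _ _ _ _ ij) ->//; rewrite preimage_set0.
- by rewrite -preimage_bigcup -[X in measurable X]setTI;
    exact: measurable_cons_rV.
Qed.

HB.instance Definition _ := isMeasure.Build _ _ _ lebesgue_cons
  lebesgue_cons0 lebesgue_cons_ge0 lebesgue_cons_sigma_additive.

Let uncons (x : 'rV[R]_d.+1) : measurableTypeR R * 'rV[R]_d :=
  (x 0 ord0, \row_j x 0 (lift ord0 j)).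

Let measurable_uncons : measurable_fun [set: _] uncons.
Proof.
apply: measurable_fun_pair; first exact: measurable_coor.
apply/measurable_fun_rVP => i; rewrite (_ : _ \o _ =
  (fun x : 'rV[R]_d.+1 => x 0 (lift ord0 i))); first exact: measurable_coor.
by apply/funext => x /=; rewrite mxE.
Qed.

Let cons_rVK : cancel cons_rV uncons.
Proof.
case=> a x; rewrite /uncons cons_rV0; congr pair.
by apply/rowP => j; rewrite mxE cons_rVS.
Qed.

Let lebesgue_cons_sigma_finite : sigma_finite setT lebesgue_cons.
Proof.
have /sigma_finiteP[F [TF ndF Foo]] :=
  sigma_finiteT (@lebesgue_measure R : {sigma_finite_measure set _ -> \bar R}).
have /sigma_finiteP[G [TG ndG Goo]] := sigma_finiteT m.
exists (fun n => uncons @^-1` (F n `*` G n)).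
  rewrite -preimage_bigcup (_ : \bigcup_n (F n `*` G n) = setT).
    by rewrite preimage_setT.
  rewrite -subTset => -[x y] _.
  have [n _ Fnx] : (\bigcup_n F n) x by rewrite -TF.
  have [k _ Gky] : (\bigcup_n G n) y by rewrite -TG.
  exists (maxn n k) => //; split.
    by move: x Fnx; exact/subsetPset/ndF/leq_maxl.
  by move: y Gky; exact/subsetPset/ndG/leq_maxr.
move=> n; have [mF Fnoo] := Foo n; have [mG Gnoo] := Goo n; split.
  rewrite -[X in measurable X]setTI; apply: measurable_uncons => //.
  exact: measurableX.
rewrite /lebesgue_cons /pushforward -comp_preimage.
rewrite (_ : uncons \o cons_rV = id); last exact/funext/cons_rVK.
rewrite preimage_id product_measure1E//.
by rewrite lte_mul_pinfty// ge0_fin_numE.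
Qed.

HB.instance Definition _ := Measure_isSigmaFinite.Build _ _ _ lebesgue_cons
  lebesgue_cons_sigma_finite.

End lebesgue_step.

(* Lebesgue measure on R^d, as the d-fold product of Lebesgue measure on R. *)
Fixpoint lebesgue_rV (R : realType) (d : nat) :
    {sigma_finite_measure set 'rV[R]_d -> \bar R} :=
  match d with
  | 0 => \d_(0 : 'rV[R]_0)
  | d'.+1 => lebesgue_cons (lebesgue_rV R d')
  end.

Definition rV_box (R : realType) (d : nat) (A : 'I_d -> set R) : set 'rV[R]_d :=
  [set x | forall i, A i (x 0 i)].

Lemma measurable_rV_box (R : realType) (d : nat)
    (A : 'I_d -> set (measurableTypeR R)) :
  (forall i, measurable (A i)) -> measurable (rV_box A).
Proof.
move=> mA; rewrite (_ : rV_box A =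
    \bigcap_(i in [set: 'I_d]) ((fun x : 'rV[R]_d => x 0 i) @^-1` A i)).
  apply: fin_bigcap_measurable => [|i _]; first exact: finite_finset.
  by rewrite -[X in measurable X]setTI; exact: measurable_coor.
by apply/seteqP; split => x /= Ax i; [move=> _|]; exact: Ax.
Qed.

Lemma lebesgue_rV_box (R : realType) (d : nat)
    (A : 'I_d -> set (measurableTypeR R)) :
  (forall i, measurable (A i)) ->
  lebesgue_rV R d (rV_box A) = (\prod_(i < d) lebesgue_measure (A i))%E.
Proof.
elim: d A => [|d IH] A mA.
  by rewrite big_ord0 /= diracE mem_set// => -[].
rewrite big_ord_recl /= /lebesgue_cons /pushforward.
rewrite (_ : _ @^-1` _ = A ord0 `*` rV_box (fun i => A (lift ord0 i))).
  rewrite product_measure1E ?IH//.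
  exact: (@measurable_rV_box _ _ (fun i => A (lift ord0 i))).
apply/seteqP; split => -[a x] /=.
  move=> Aax; split=> [|i]; first by have := Aax ord0; rewrite cons_rV0.
  by have := Aax (lift ord0 i); rewrite cons_rVS.
move=> [Aa Ax] i; have [j ->|->] := unliftP ord0 i; last by rewrite cons_rV0.
by rewrite cons_rVS; exact: Ax.
Qed.

Definition convex_hull (R : realType) (M : lmodType R) (A : set M) : set M :=
  smallest (@convex_set R M) A.

(* (2 pi)^(-d/2) exp(- |x|^2 / 2), with |x| the Euclidean norm (the library norm
   on matrices is the sup norm). *)
Definition std_normal_vector_pdf (R : realType) (d : nat) (x : 'rV[R]_d) : R :=
  (Num.sqrt (2 * pi)) ^- d * expR (- (\sum_(j < d) x 0 j ^+ 2) / 2).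

Definition std_normal_vector (R : realType) (d : nat) (dT : measure_display)
    (T : measurableType dT) (P : probability T R) (X : {RV P >-> 'rV[R]_d}) :=
  forall A : set 'rV[R]_d, measurable A ->
    distribution P X A =
      (\int[lebesgue_rV R d]_(x in A) (std_normal_vector_pdf x)%:E)%E.

Definition independent_RVs (R : realType) (dT dT' : measure_display)
    (T : measurableType dT) (T' : measurableType dT') (P : probability T R)
    (n : nat) (X : 'I_n -> {RV P >-> T'}) :=
  forall (J : {set 'I_n}) (B : 'I_n -> set T'),
    (forall i, i \in J -> measurable (B i)) ->
    P (\bigcap_(i in [set` J]) (X i @^-1` B i)) =
      (\prod_(i in J) P (X i @^-1` B i))%E.

Definition Gamma (R : realType) (s : R) : R :=
  \int[lebesgue_measure]_(t in `]0, +oo[) (t `^ (s - 1) * expR (- t)).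

Definition kappa (R : realType) (d : nat) : R :=
  pi `^ (d%:R / 2) / Gamma (d%:R / 2 + 1).

Definition phi (R : realType) (t : R) : R := normal_pdf 0 1 t.

Lemma phiE (R : realType) (t : R) :
  phi t = (Num.sqrt (2 * pi))^-1 * expR (- (t ^+ 2) / 2).
Proof.
rewrite /phi normal_pdfE ?oner_eq0// /normal_peak /normal_fun subr0 expr1n mul1r.
by rewrite mulr_natl.
Qed.

Definition Phi (R : realType) (t : R) : R :=
  \int[lebesgue_measure]_(s in `]-oo, t]) phi s.

Section polytopes.
Context {R : realType} (d n : nat) {T : Type}.
Variable X : 'I_n -> T -> 'rV[R]_d.

Definition hull_points (w : T) : set 'rV[R]_d :=
  convex_hull [set X i w | i in [set: 'I_n]].

Definition hull_sym_points (w : T) : set 'rV[R]_d :=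
  convex_hull ([set X i w | i in [set: 'I_n]] `|`
               [set - X i w | i in [set: 'I_n]]).

End polytopes.

(* Main.v *)
(* Lift the points x_k to R^(d+1) by independent standard normal heights z_k.  By
   linear programming duality almost every point of the convex hull lies under
   exactly one facet of the upper boundary of the lifted hull, so the volume is the
   sum over (d+1)-subsets of the volume of their simplex times the indicator that
   all other lifted points lie below the hyperplane z = a + <x, b> through the
   lifted subset.  In expectation, exchangeability reduces this to the first d+1
   points.  Given the hyperplane, each remaining point lies below it with
   probability Phi(a / s), where s = sqrt(1 + |b|^2), because z - <x, b> is centred
   normal with variance s^2.  Passing from the d+1 heights to (a, b) is a linear
   change of variables with Jacobian |det|, where det is the determinant of the
   homogenised points; completing the square in each of the d+1 points then
   separates the variables, leaving E det^2 = (d+1)!, the integral of s^-(d+2),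
   which is kappa_d, and the integral over t = a / s.  The symmetric hull uses the
   heights +-z_k of +-x_k; a pair lies below the hyperplane iff |z - <x, b>| <= a,
   which has probability 2 Phi(a / s) - 1. *)
Require Import Defs.
From HB Require Import structures.
From mathcomp Require Import all_boot all_order all_fingroup all_algebra.
From mathcomp Require Import all_classical all_reals all_analysis.
From mathcomp Require Import alt primitive_action measurable_realfun ring lra.
Set Implicit Arguments.
Unset Strict Implicit.
Unset Printing Implicit Defensive.
Import Order.TTheory GRing.Theory Num.Theory.
Import numFieldNormedType.Exports.
Local Open Scope classical_set_scope.
Local Open Scope ring_scope.

(** * Linear changes of variables *)

(** Neither the measurability of the hull volume in the sample nor the absence of ties between
    lifted points comes for free. Both are avoided by squeezing the volume between two finite sums
    over ordered bases: the lower one counts a basis only if all other lifted points lie strictly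
    below its hyperplane, the upper one also accepts points on it. Both sums are measurable, and
    their expectations agree because the normal law does not charge the endpoints of a half-line or
    an interval. Since bases are ordered, every simplex occurs (d+1)! times, a factor that is
    divided out at the end. The two hulls are treated at once through a finite set of signs, a
    singleton or {1, -1}; the free sign at each vertex of a facet is the source of 2^(d+1) in the
    symmetric formula. A facet through both x_k and -x_k would force all heights to be linear in the
    points, which has probability zero as d < n. The constant kappa_d appears without polar
    coordinates: multiplying the integral of s^-(d+2) by Gamma(d/2 + 1) turns it into Gaussian
    integrals. *)

Section lebesgue_line.
Context {R : realType}.
Local Notation mu := (@lebesgue_measure R).
Local Open Scope ereal_scope.

(** Lebesgue measure is determined by its values on half-open intervals, and on these the image
    under the translation is computed directly. The scaling rule below has the same proof. *)
Lemma ge0_integral_lebesgue_shift (v : R) (F : R -> \bar R) :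
  measurable_fun [set: R] F -> (forall x, 0 <= F x) ->
  \int[mu]_x F (x + v)%R = \int[mu]_x F x.
Proof.
move=> mF F0.
pose f : measurableTypeR R -> measurableTypeR R := fun x => (x + v)%R.
have mf : measurable_fun setT f by exact: measurable_funD.
rewrite (_ : (fun x => F (x + v)%R) = F \o f)//.
have -> : \int[mu]_x (F \o f) x = \int[pushforward mu f]_x F x.
  by rewrite (ge0_integral_pushforward mf).
apply: eq_measure_integral => A mA _.
apply/esym.
apply: (@lebesgue_measure_unique R (pushforward mu f)) => // _ [[a b]] _ <-.
have pre : f @^-1` `]a, b]%classic = `](a - v)%R, (b - v)%R]%classic.
  apply/seteqP; split => x /=; rewrite !in_itv/= /f; lra.
transitivity (mu (f @^-1` `]a, b]%classic)); last by [].
rewrite pre !lebesgue_measure_itv/= !lte_fin ltrD2r.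
by case: ifPn => // _; rewrite -!EFinB; congr EFin; ring.
Qed.

Lemma ge0_integral_lebesgue_scale (a : R) (F : R -> \bar R) : a != 0%R ->
  measurable_fun [set: R] F -> (forall x, 0 <= F x) ->
  \int[mu]_x F x = (`|a|%R)%:E * \int[mu]_x F (x * a)%R.
Proof.
move=> a0 mF F0.
pose f : measurableTypeR R -> measurableTypeR R := fun x => (x * a)%R.
have mf : measurable_fun setT f by exact: measurable_funM.
rewrite (_ : (fun x => F (x * a)%R) = F \o f)//.
have -> : \int[mu]_x (F \o f) x = \int[pushforward mu f]_x F x.
  by rewrite (ge0_integral_pushforward mf).
have na0 : (0 <= `|a|)%R by [].
have -> : (`|a|%R)%:E = (NngNum na0)%:num%:E by [].
rewrite -ge0_integral_mscale//.
apply: eq_measure_integral => A mA _.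
apply: (@lebesgue_measure_unique R (mscale (NngNum na0) (pushforward mu f))) =>
  // _ [[x y]] _ <-.
transitivity ((`|a|%R)%:E * mu (f @^-1` `]x, y]%classic)); last by [].
have [a_gt0|a_lt0|a00] := ltgtP a 0%R; last by rewrite a00 eqxx in a0.
(* In this branch [a] is negative, contrary to the name of its hypothesis, so the preimage of []x,
   y]] is closed on the left. *)
- rewrite (_ : f @^-1` _ = `[(y / a)%R, (x / a)%R[%classic); last first.
    by apply/seteqP; split => z /=; rewrite !in_itv/= /f ltr_ndivlMr//
      ler_ndivrMr// andbC.
  rewrite !lebesgue_measure_itv/= !lte_fin ltr_nM2r ?invr_lt0//.
  case: ifPn => // xy; rewrite ?mule0// ltr0_norm// -!EFinB -EFinM; congr EFin.
  by rewrite -mulrBl mulrCA mulNr divff// mulrN1 opprB.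
- rewrite (_ : f @^-1` _ = `](x / a)%R, (y / a)%R]%classic); last first.
    by apply/seteqP; split => z /=; rewrite !in_itv/= /f ltr_pdivrMr// ler_pdivlMr.
  rewrite !lebesgue_measure_itv/= !lte_fin ltr_pM2r ?invr_gt0//.
  case: ifPn => // xy; rewrite ?mule0// gtr0_norm// -!EFinB -EFinM; congr EFin.
  by rewrite -mulrBl mulrCA divff// mulr1.
Qed.

End lebesgue_line.

Section measurable_rV_lemmas.
Context {R : realType}.

Lemma measurable_coord d (i : 'I_d) :
  measurable_fun [set: 'rV[R]_d] (fun x => x 0 i).
Proof. exact: measurable_coor. Qed.

Lemma measurable_rVP dT (T : measurableType dT) d (f : T -> 'rV[R]_d) :
  (forall i, measurable_fun setT (fun t => f t 0 i)) -> measurable_fun setT f.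
Proof. by move=> mf; apply/measurable_fun_rVP. Qed.

Lemma measurable_rV_coord dT (T : measurableType dT) d (f : T -> 'rV[R]_d) i :
  measurable_fun setT f -> measurable_fun setT (fun t => f t 0 i).
Proof. by move=> mf; exact: (measurableT_comp (measurable_coord i) mf). Qed.

Lemma measurable_cons_rV2 dT (T : measurableType dT) d (f : T -> R)
    (g : T -> 'rV[R]_d) : measurable_fun setT f -> measurable_fun setT g ->
  measurable_fun setT (fun t => cons_rV (f t, g t)).
Proof.
move=> mf mg.
exact: (measurableT_comp (@measurable_cons_rV R d) (measurable_fun_pair mf mg)).
Qed.

Lemma measurable_rVD dT (T : measurableType dT) d (f g : T -> 'rV[R]_d) :
  measurable_fun setT f -> measurable_fun setT g ->
  measurable_fun setT (fun t => f t + g t).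
Proof.
move=> mf mg; apply: measurable_rVP => i; under eq_fun do rewrite mxE.
by apply: measurable_funD; exact: measurable_rV_coord.
Qed.

Lemma measurable_rVZ dT (T : measurableType dT) d (f : T -> R)
    (g : T -> 'rV[R]_d) : measurable_fun setT f -> measurable_fun setT g ->
  measurable_fun setT (fun t => f t *: g t).
Proof.
move=> mf mg; apply: measurable_rVP => i; under eq_fun do rewrite mxE.
by apply: measurable_funM => //; exact: measurable_rV_coord.
Qed.

Lemma measurable_rV_mulmx dT (T : measurableType dT) m n (f : T -> 'rV[R]_m)
    (A : T -> 'M[R]_(m, n)) :
  measurable_fun setT f ->
  (forall i j, measurable_fun setT (fun t => A t i j)) ->
  measurable_fun setT (fun t => f t *m A t).
Proof.
move=> mf mA; apply: measurable_rVP => j; under eq_fun do rewrite mxE.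
apply: measurable_sum => i; apply: measurable_funM => //.
exact: measurable_rV_coord.
Qed.

Lemma cons_rVE d (a : R) (x : 'rV[R]_d) :
  cons_rV (a, x) = row_mx (a%:M : 'rV_1) x :> 'rV_(1 + d).
Proof.
apply/rowP => i; case: (split_ordP i) => j ->.
  rewrite row_mxEl !mxE ord1 eqxx mulr1n.
  by case: unliftP => //= k /(congr1 val).
rewrite row_mxEr mxE; case: unliftP => [k /(congr1 val)/=|/(congr1 val)//].
by rewrite /bump/= !add1n => -[jk]; congr (x 0 _); exact/val_inj.
Qed.

End measurable_rV_lemmas.

Section lebesgue_rV_integral.
Context {R : realType}.
Local Notation mu := (@lebesgue_measure R).
Local Notation leb d := (lebesgue_rV R d).
Local Open Scope ereal_scope.

Lemma ge0_integral_lebesgue_rV0 (F : 'rV[R]_0 -> \bar R) :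
  measurable_fun setT F -> \int[leb 0]_x F x = F 0%R.
Proof. by move=> mF; rewrite integral_dirac// diracT mul1e. Qed.

Lemma ge0_integral_lebesgue_rVS d (F : 'rV[R]_d.+1 -> \bar R) :
  measurable_fun setT F -> (forall x, 0 <= F x) ->
  \int[leb d.+1]_x F x = \int[mu]_a \int[leb d]_x F (cons_rV (a, x)).
Proof.
move=> mF F0.
transitivity (\int[pushforward (mu \x leb d) (@cons_rV R d)]_x F x) => //.
rewrite (ge0_integral_pushforward (@measurable_cons_rV R d))//.
rewrite preimage_setT fubini_tonelli1//; last by move=> x; exact: F0.
exact: (measurableT_comp mF (@measurable_cons_rV R d)).
Qed.

Lemma ge0_integral_lebesgue_rVS2 d (F : 'rV[R]_d.+1 -> \bar R) :
  measurable_fun setT F -> (forall x, 0 <= F x) ->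
  \int[leb d.+1]_x F x = \int[leb d]_x \int[mu]_a F (cons_rV (a, x)).
Proof.
move=> mF F0; rewrite ge0_integral_lebesgue_rVS//.
apply: (fubini_tonelli (fun p => F (cons_rV p))) => //.
exact: (measurableT_comp mF (@measurable_cons_rV R d)).
Qed.

Lemma ge0_integral_lebesgue_rV_shift d (v : 'rV[R]_d) (F : 'rV[R]_d -> \bar R) :
  measurable_fun setT F -> (forall x, 0 <= F x) ->
  \int[leb d]_x F (x + v)%R = \int[leb d]_x F x.
Proof.
elim: d v F => [|d IH] v F mF F0.
  by apply: eq_integral => x _; rewrite (_ : (x + v)%R = x)//; apply/rowP => -[].
have mFv : measurable_fun setT (fun x : 'rV[R]_d.+1 => F (x + v)%R).
  by apply: (measurableT_comp mF); apply: measurable_rVD => //.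
rewrite (ge0_integral_lebesgue_rVS mFv (fun x => F0 (x + v)%R)).
rewrite (ge0_integral_lebesgue_rVS mF F0).
have consD a x : (cons_rV (a, x) + v = cons_rV ((a + v 0 ord0),
    (x + \row_j v 0 (lift ord0 j))))%R.
  apply/rowP => i; rewrite !mxE; case: unliftP => [j|] -> //=.
  by rewrite !mxE.
have mc x : measurable_fun setT (fun y : 'rV[R]_d => F (cons_rV (x, y))).
  apply: (measurableT_comp mF); exact: measurable_cons_rV2.
transitivity (\int[mu]_x \int[leb d]_y F (cons_rV (x + v 0 ord0, y))%R).
  apply: eq_integral => x _.
  rewrite -(IH (\row_j v 0 (lift ord0 j))%R
    (fun y => F (cons_rV (x + v 0 ord0, y))%R))//.
  by apply: eq_integral => y _; rewrite consD.
pose G x := \int[leb d]_y F (cons_rV (x, y)).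
rewrite -[RHS](@ge0_integral_lebesgue_shift R (v 0 ord0)%R G)//.
- apply: (@measurable_fun_fubini_tonelli_F _ _ _ _ _ (leb d) (fun p => F
  (cons_rV p))) => //.
  exact: (measurableT_comp mF (@measurable_cons_rV R d)).
- by move=> x; exact: integral_ge0.
Qed.

(** The change of variables formula as a property of the matrix. It is stable under products, so it
    only has to be checked on the triangular factors of a Gaussian elimination. *)
Definition lebesgue_scaled_by d (A : 'M[R]_d) := forall F : 'rV[R]_d -> \bar R,
  measurable_fun setT F -> (forall x, 0 <= F x) ->
  \int[leb d]_x F x = `|\det A|%R%:E * \int[leb d]_x F (x *m A)%R.

Lemma measurable_mulmxr m n (A : 'M[R]_(m, n)) :
  measurable_fun setT (fun x : 'rV[R]_m => (x *m A)%R).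
Proof. by apply: measurable_rV_mulmx => //; exact: measurable_id. Qed.

Lemma lebesgue_scaled_byM d (A B : 'M[R]_d) :
  lebesgue_scaled_by A -> lebesgue_scaled_by B ->
  lebesgue_scaled_by (A *m B)%R.
Proof.
move=> GA GB F mF F0; rewrite GB// (GA (fun x => F (x *m B)%R))//; last first.
  exact: (measurableT_comp mF (measurable_mulmxr _)).
rewrite muleA -EFinM -normrM mulrC -det_mulmx; congr (_ * _).
by apply: eq_integral => x _; rewrite mulmxA.
Qed.

Lemma lebesgue_scaled_by1 d : lebesgue_scaled_by (1%:M : 'M[R]_d)%R.
Proof.
move=> F mF F0; rewrite det1 normr1 mul1e.
by apply: eq_integral => x _; rewrite mulmx1.
Qed.

(** For a fixed first coordinate the row [r] merely translates the remaining ones, so the inner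
    integral is handled by translation invariance and [S], the outer one by scaling with [a]. *)
Lemma lebesgue_scaled_by_upper d (a : R) (r : 'rV[R]_d) (S : 'M[R]_d) :
  a != 0%R -> lebesgue_scaled_by S ->
  lebesgue_scaled_by (block_mx (a%:M : 'M[R]_1) r 0 S : 'M[R]_(1 + d))%R.
Proof.
move=> a0 GS F mF F0; rewrite det_ublock det_scalar1 normrM EFinM -muleA.
have mc x : measurable_fun setT (fun y : 'rV[R]_d => F (cons_rV (x, y))).
  apply: (measurableT_comp mF); exact: measurable_cons_rV2.
pose G x := \int[leb d]_y F (cons_rV (x, y)).
have mG : measurable_fun setT G.
  apply: (@measurable_fun_fubini_tonelli_F _ _ _ _ _ (leb d) (fun p => F
    (cons_rV p))) => //.
  exact: (measurableT_comp mF (@measurable_cons_rV R d)).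
rewrite [LHS](ge0_integral_lebesgue_rVS (d := d))//.
rewrite (ge0_integral_lebesgue_scale a0 mG); last first.
  by move=> x; exact: integral_ge0.
congr (_ * _).
have mFA : measurable_fun setT (fun x : 'rV[R]_(1 + d) => F (x *m block_mx
  (a%:M : 'M[R]_1) r 0 S : 'rV_(1 + d))%R).
  exact: (measurableT_comp mF (measurable_mulmxr _)).
rewrite (ge0_integral_lebesgue_rVS (d := d) mFA)// -ge0_integralZl//; last first.
- by move=> x _; exact: integral_ge0.
- apply: (@measurable_fun_fubini_tonelli_F _ _ _ _ _ (leb d) (fun p => F
  (cons_rV p *m block_mx (a%:M : 'M[R]_1) r 0 S : 'rV_(1+d))%R)) => //.
  exact: (measurableT_comp mFA (@measurable_cons_rV R d)).
apply: eq_integral => x _.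
rewrite /G -(ge0_integral_lebesgue_rV_shift (x *: r)%R)// GS//; last first.
  apply: (measurableT_comp (mc _)); exact: measurable_rVD.
congr (_ * _); apply: eq_integral => y _; congr F.
rewrite !cons_rVE mul_row_block mulmx0 addr0 !mul_scalar_mx scale_scalar_mx.
by rewrite addrC.
Qed.

(** Here the first coordinate is integrated inside: for fixed remaining coordinates [x] it is
    translated by [x *m c]. *)
Lemma lebesgue_scaled_by_lower d (c : 'cV[R]_d) :
  lebesgue_scaled_by (block_mx (1%:M : 'M[R]_1) 0 c 1%:M : 'M[R]_(1 + d))%R.
Proof.
move=> F mF F0; rewrite det_lblock !det1 mulr1 normr1 mul1e.
rewrite [LHS](ge0_integral_lebesgue_rVS2 (d := d) mF F0).
rewrite [RHS](ge0_integral_lebesgue_rVS2 (d := d) _ (fun x => F0 _)); last first.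
  exact: (measurableT_comp mF (measurable_mulmxr _)).
apply: eq_integral => x _.
rewrite -(ge0_integral_lebesgue_shift ((x *m c)%R 0 0)%R)//; last first.
  by apply: (measurableT_comp mF); exact: measurable_cons_rV2.
apply: eq_integral => y _; congr F.
rewrite !cons_rVE mul_row_block mulmx0 add0r !mulmx1 raddfD/=; congr row_mx.
by congr (_ + _)%R; rewrite [RHS]mx11_scalar.
Qed.

(** Block elimination with a nonzero corner entry as pivot, and induction on the dimension for the
    Schur complement. *)
Lemma ge0_integral_lebesgue_rV_linear d (A : 'M[R]_d) : A \in unitmx ->
  lebesgue_scaled_by A.
Proof.
elim: d A => [|d IH] A uA.
  by rewrite (_ : A = 1%:M); [exact: lebesgue_scaled_by1|apply/matrixP => -[]].
have pivot (B : 'M[R]_(1 + d)) : B \in unitmx -> B 0%R 0%R != 0%R ->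
    lebesgue_scaled_by B.
  move=> uB B00; set a := B 0%R 0%R in B00 *.
  have ula : ulsubmx B = a%:M%R by rewrite [LHS]mx11_scalar !mxE !lshift0.
  (* [S] is the Schur complement of the pivot; it is invertible because [B] is. *)
  pose c := (a^-1 *: dlsubmx B)%R; pose S := (drsubmx B - c *m ursubmx B)%R.
  have EB : B = (block_mx 1%:M 0 c 1%:M *m block_mx a%:M (ursubmx B) 0 S)%R.
    rewrite mulmx_block !mul1mx !mul0mx !addr0 /S addrC subrK.
    by rewrite mul_mx_scalar /c scalerA mulfV// scale1r -ula submxK.
  rewrite EB; apply: lebesgue_scaled_byM; first exact: lebesgue_scaled_by_lower.
  apply: lebesgue_scaled_by_upper => //; apply: IH.
  move: uB; rewrite EB unitmx_mul => /andP[_].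
  by rewrite !unitmxE det_ublock det_scalar1 unitrM => /andP[].
have [A00|/(pivot _ uA)//] := eqVneq (A 0%R 0%R) 0%R.
have [i Ai0] : exists i : 'I_d, (A : 'M[R]_(1 + d)) (rshift 1 i) 0%R != 0%R.
  apply/existsP; apply: contraTT uA => /existsPn A0.
  rewrite unitmxE unitfE negbK; apply/eqP.
  rewrite (@expand_det_col _ (1 + d) A 0%R) big1// => j _.
  case: (split_ordP j) => k ->.
    by rewrite !ord1 lshift0 A00 mul0r.
  by have := A0 k; rewrite negbK => /eqP ->; rewrite mul0r.
(* Left multiplication by [T 1] adds row [i] of the lower block to the top row, which makes the
   corner nonzero; [T (-1)] undoes this. *)
pose T (s : R) : 'M[R]_(1 + d) := (block_mx 1%:M (s *: delta_mx 0 i) 0 1%:M)%R.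
have TN1 : (T (-1) *m T 1 = 1%:M)%R.
  rewrite mulmx_block !mul1mx !mul0mx !mulmx0 !mulmx1 !addr0 scale1r scaleN1r.
  by rewrite subrr add0r -scalar_mx_block.
rewrite -[A]mul1mx -TN1 -mulmxA; apply: lebesgue_scaled_byM.
  apply: lebesgue_scaled_by_upper; first exact: oner_neq0.
  exact: lebesgue_scaled_by1.
apply: pivot.
  by rewrite unitmx_mul uA andbT unitmxE det_ublock !det1 mulr1 unitr1.
have -> : (0 : 'I_(1 + d))%R = lshift d 0%R by rewrite lshift0.
have Tl : T 1%R (lshift d 0%R) (lshift d ord0) = 1%R.
  by rewrite /T block_mxEul mxE.
have Tr k : T 1%R (lshift d 0%R) (rshift 1 k) = (k == i)%:R%R.
  by rewrite /T block_mxEur !mxE mul1r.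
rewrite mxE (@big_split_ord _ _ _ 1 d) /= big_ord1 (bigD1 i)//= big1.
  by rewrite Tl Tr eqxx !mul1r addr0 !lshift0 A00 add0r.
by move=> j ji; rewrite Tr (negbTE ji) mul0r.
Qed.

End lebesgue_rV_integral.

(** * Powers of a probability measure *)

Section measurable_integral.
Context {d1 d2} {T1 : measurableType d1} {T2 : measurableType d2} {R : realType}.
Local Open Scope ereal_scope.

Lemma measurable_integral2 (m : {sigma_finite_measure set T2 -> \bar R})
    (f : T1 -> T2 -> \bar R) :
  measurable_fun setT (fun p => f p.1 p.2) -> (forall x y, 0 <= f x y) ->
  measurable_fun setT (fun x => \int[m]_y f x y).
Proof.
move=> mf f0.
exact: (measurable_fun_fubini_tonelli_F (m2 := m) (fun p => f p.1 p.2)).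
Qed.

Lemma ge0_integral_swap (m1 : {sigma_finite_measure set T1 -> \bar R})
    (m2 : {sigma_finite_measure set T2 -> \bar R}) (f : T1 -> T2 -> \bar R) :
  measurable_fun setT (fun p => f p.1 p.2) -> (forall x y, 0 <= f x y) ->
  \int[m1]_x \int[m2]_y f x y = \int[m2]_y \int[m1]_x f x y.
Proof.
by move=> mf f0; exact: (fubini_tonelli (fun p => f p.1 p.2)).
Qed.

Lemma emeasurable_prod (I : Type) (s : seq I) (h : I -> T1 -> \bar R) :
  (forall i, measurable_fun setT (h i)) ->
  measurable_fun setT (fun x => \prod_(i <- s) h i x).
Proof.
move=> mh; elim: s => [|i s IH].
  by under eq_fun do rewrite big_nil; exact: measurable_cst.
by under eq_fun do rewrite big_cons; exact: emeasurable_funM.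
Qed.

End measurable_integral.

Section measurable_tuple_lemmas.
Context {d dT} {E : measurableType d} {T : measurableType dT}.

Lemma measurable_tupleP n (f : T -> n.-tuple E) :
  (forall i, measurable_fun setT (fun t => tnth (f t) i)) ->
  measurable_fun setT f.
Proof. by move=> mf; apply/measurable_fun_tnthP. Qed.

Lemma measurable_tnth_comp n (f : T -> n.-tuple E) i :
  measurable_fun setT f -> measurable_fun setT (fun t => tnth (f t) i).
Proof. by move=> mf; exact: (measurableT_comp (measurable_tnth i) mf). Qed.

Lemma measurable_cat_tuple m n (f : T -> m.-tuple E) (g : T -> n.-tuple E) :
  measurable_fun setT f -> measurable_fun setT g ->
  measurable_fun setT (fun t => [tuple of f t ++ g t]).
Proof.
move=> mf mg; apply: measurable_tupleP => i.
case: (split_ordP i) => j ->.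
  by under eq_fun do rewrite tnth_lshift; exact: measurable_tnth_comp.
by under eq_fun do rewrite tnth_rshift; exact: measurable_tnth_comp.
Qed.

Lemma measurable_mktuple n (f : 'I_n -> T -> E) :
  (forall i, measurable_fun setT (f i)) ->
  measurable_fun setT (fun t => [tuple f i t | i < n]).
Proof.
move=> mf; apply: measurable_tupleP => i.
under eq_fun do rewrite tnth_mktuple.
exact: mf.
Qed.

End measurable_tuple_lemmas.

Section tuple_power.
Context {d} {E : measurableType d} {R : realType}.

Definition cons_pair n (p : E * n.-tuple E) : n.+1.-tuple E :=
  [tuple of p.1 :: p.2].

Lemma measurable_cons_pair n : measurable_fun setT (@cons_pair n).
Proof. exact: measurable_cons. Qed.

HB.instance Definition _ n :=
  isMeasurableFun.Build _ _ _ _ (@cons_pair n) (@measurable_cons_pair n).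

(** Built from binary products, so that Tonelli's theorem peels off the head of the tuple and proofs
    go by induction on [n]. *)
Fixpoint tuple_power (mu : probability E R) (n : nat) :
    probability (n.-tuple E) R :=
  match n with
  | 0 => \d_([tuple] : 0.-tuple E)
  | n'.+1 => distribution (mu \x tuple_power mu n')%E (@cons_pair n')
  end.

Local Open Scope ereal_scope.
Variable mu : probability E R.
Local Notation pow := (tuple_power mu).

Lemma ge0_integral_tuple_power0 (F : 0.-tuple E -> \bar R) :
  measurable_fun setT F -> \int[pow 0]_t F t = F [tuple].
Proof. by move=> mF; rewrite integral_dirac// diracT mul1e. Qed.

Lemma ge0_integral_tuple_powerS n (F : n.+1.-tuple E -> \bar R) :
  measurable_fun setT F -> (forall t, 0 <= F t) ->
  \int[pow n.+1]_t F t = \int[mu]_x \int[pow n]_t F [tuple of x :: t].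
Proof.
move=> mF F0; rewrite /= ge0_integral_pushforward//.
rewrite preimage_setT fubini_tonelli1//.
- exact: (measurableT_comp mF (@measurable_cons_pair n)).
- by move=> x; exact: F0.
Qed.

Lemma tuple_power_box n (B : 'I_n -> set E) : (forall i, measurable (B i)) ->
  pow n [set t | forall i, B i (tnth t i)] = \prod_(i < n) mu (B i).
Proof.
elim: n B => [|n IH] B mB.
  by rewrite big_ord0 /= diracE mem_set// => -[].
rewrite big_ord_recl.
have mbox : measurable [set t : n.-tuple E | forall i, B (lift ord0 i) (tnth t i)].
  rewrite (_ : [set t | _] = \bigcap_(i in [set: 'I_n])
      (fun t : n.-tuple E => tnth t i) @^-1` B (lift ord0 i)); last first.
    by apply/seteqP; split => t /= H i; [move=> _|]; exact: H.
  apply: fin_bigcap_measurable => [|i _]; first exact: finite_finset.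
  by rewrite -[X in measurable X]setTI; exact: measurable_tnth.
rewrite -IH//= /distribution /pushforward -product_measure1E//.
congr (_ _); apply/seteqP; split => -[x t] /=.
  move=> H; split; first by have := H ord0; rewrite tnth0.
  by move=> i; have := H (lift ord0 i); rewrite tnthS.
move=> [Bx Bt] i; have [j ->|->] := unliftP ord0 i; last by rewrite tnth0.
by rewrite tnthS.
Qed.

(** Boxes are stable under intersection and generate the product sigma-algebra, hence determine a
    finite measure. *)
Lemma tuple_power_unique n (m : {measure set n.-tuple E -> \bar R}) :
  (forall B : 'I_n -> set E, (forall i, measurable (B i)) ->
    m [set t | forall i, B i (tnth t i)] = \prod_(i < n) mu (B i)) ->
  forall A, measurable A -> m A = pow n A.
Proof.
move=> mE A mA.
pose G : set (set (n.-tuple E)) := [set [set t | forall i, B i (tnth t i)] |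
  B in [set B : 'I_n -> set E | forall i, measurable (B i)]].
have GT : G setT.
  by exists (fun=> setT) => //=; apply/seteqP; split.
have mG C : G C -> measurable C.
  move=> [B mB <-].
  rewrite (_ : [set t | _] = \bigcap_(i in [set: 'I_n])
      (fun t : n.-tuple E => tnth t i) @^-1` B i); last first.
    by apply/seteqP; split => t /= H i; [move=> _|]; exact: H.
  apply: fin_bigcap_measurable => [|i _]; first exact: finite_finset.
  by rewrite -[X in measurable X]setTI; apply: measurable_tnth => //; exact: mB.
apply: (measure_unique G (fun=> setT)) => //.
- apply/seteqP; split; last first.
    by apply: smallest_sub; [exact: sigma_algebra_measurable|exact: mG].
  apply: smallest_sub; first exact: smallest_sigma_algebra.
  rewrite -bigcup_seq/= => C [i _ [D mD <-]]; apply: sub_sigma_algebra.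
  exists (fun j => if j == i then D else setT).
    by move=> j; case: ifP.
  rewrite setTI; apply/seteqP; split => t /=.
    by move=> /(_ i); rewrite eqxx.
  by move=> Dt j; case: eqP => // ->.
- move=> _ _ [B mB <-] [C mC <-]; exists (fun i => B i `&` C i).
    by move=> i /=; apply: measurableI; [exact: mB|exact: mC].
  apply/seteqP; split => t /=.
    by move=> H; split => i; have [] := H i.
  by move=> [HB HC] i; split.
- by rewrite bigcup_const//; exists 0%N.
- by move=> _ [B mB <-]; rewrite mE//; apply/esym; exact: tuple_power_box.
- move=> _; have -> : setT = [set t : n.-tuple E | forall i : 'I_n, setT (tnth t i)].
    by apply/seteqP; split.
  by rewrite (mE (fun=> setT))// big1 ?ltry// => i _; exact: probability_setT.
Qed.

Lemma ge0_integral_iid dS (S : measurableType dS) (P : probability S R) n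
    (X : 'I_n -> S -> E) (F : n.-tuple E -> \bar R) :
  (forall i, measurable_fun setT (X i)) ->
  (forall B : 'I_n -> set E, (forall i, measurable (B i)) ->
    P [set w | forall i, B i (X i w)] = \prod_(i < n) mu (B i)) ->
  measurable_fun setT F -> (forall t, 0 <= F t) ->
  \int[P]_w F [tuple X i w | i < n] = \int[pow n]_t F t.
Proof.
move=> mX PX mF F0.
pose f w := [tuple X i w | i < n].
have mf : measurable_fun setT f by exact: measurable_mktuple.
transitivity (\int[pushforward P f]_t F t).
  by rewrite (ge0_integral_pushforward mf)// preimage_setT.
apply: eq_measure_integral => A mA _.
pose fi := isMeasurableFun.Build _ _ _ _ f mf.
pose fp : {mfun S >-> n.-tuple E} := HB.pack f fi.
apply: (@tuple_power_unique n (pushforward P fp)) => // B mB.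
rewrite -PX//; congr (P _); apply/seteqP; split => w /= H i; have := H i;
  by rewrite tnth_mktuple.
Qed.

(** Exchangeability, combined with a symmetry of [mu] chosen separately in each coordinate: this
    will move any signed facet to a standard position. *)
Lemma ge0_integral_tuple_power_perm n (s : 'S_n) (th : 'I_n -> E -> E)
    (F : n.-tuple E -> \bar R) :
  (forall i, measurable_fun setT (th i)) ->
  (forall i B, measurable B -> mu (th i @^-1` B) = mu B) ->
  measurable_fun setT F -> (forall t, 0 <= F t) ->
  \int[pow n]_t F [tuple th i (tnth t (s i)) | i < n] = \int[pow n]_t F t.
Proof.
move=> mth thmu mF F0.
have mX i : measurable_fun setT (fun t : n.-tuple E => th i (tnth t (s i))).
  by apply: (measurableT_comp (mth i)); exact: measurable_tnth.
rewrite (ge0_integral_iid mX)// => B mB.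
pose C j := th (s^-1%g j) @^-1` B (s^-1%g j).
have mC j : measurable (C j) by rewrite -[C j]setTI; apply: mth.
rewrite (_ : [set t | _] = [set t : n.-tuple E | forall i, C i (tnth t i)]).
  rewrite tuple_power_box// [RHS](reindex_inj (@perm_inj _ (s^-1)%g)).
  by apply: eq_bigr => i _; rewrite /C thmu.
apply/seteqP; split => t /= H i; rewrite /C /=.
  by have := H (s^-1%g i); rewrite permKV.
by have := H (s i); rewrite /C/= permK.
Qed.

Lemma ge0_integral_tuple_power_cat m n (F : (m + n).-tuple E -> \bar R) :
  measurable_fun setT F -> (forall t, 0 <= F t) ->
  \int[pow (m + n)]_t F t =
  \int[pow m]_s \int[pow n]_t F [tuple of s ++ t].
Proof.
move=> + F0; elim: m F F0 => [|m IH] F F0 mF.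
  rewrite ge0_integral_tuple_power0.
    by apply: eq_integral => t _; congr F; exact: val_inj.
  apply: (@measurable_integral2 _ _ _ _ _ (pow n)
    (fun (s : 0.-tuple E) t => F [tuple of s ++ t])) => [|s t]; last exact: F0.
  by apply: (measurableT_comp mF); exact: measurable_cat_tuple.
rewrite [LHS](@ge0_integral_tuple_powerS (m + n))// ge0_integral_tuple_powerS.
- apply: eq_integral => x _; rewrite (IH _ (fun t => F0 _)); last first.
    by apply: (measurableT_comp mF); exact: measurable_cons.
  apply: eq_integral => s _; apply: eq_integral => t _; congr F.
  exact: val_inj.
- apply: (@measurable_integral2 _ _ _ _ _ (pow n)
    (fun (s : m.+1.-tuple E) t => F [tuple of s ++ t])) => [|s t]; last exact: F0.
  by apply: (measurableT_comp mF); exact: measurable_cat_tuple.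
- by move=> s; apply: integral_ge0 => t _; exact: F0.
Qed.

Lemma ge0_integral_tuple_power_prod n (h : E -> \bar R) :
  measurable_fun setT h -> (forall x, 0 <= h x) ->
  \int[pow n]_t \prod_(i < n) h (tnth t i) = \prod_(i < n) \int[mu]_x h x.
Proof.
move=> mh h0; elim: n => [|n IH].
  rewrite ge0_integral_tuple_power0; last first.
    by under eq_fun do rewrite big_ord0; exact: measurable_cst.
  by rewrite !big_ord0.
have mprod k : measurable_fun setT
    (fun t : k.-tuple E => \prod_(i < k) h (tnth t i)).
  apply: emeasurable_prod => i; apply: (measurableT_comp mh).
  exact: measurable_tnth.
rewrite ge0_integral_tuple_powerS//; last by move=> t; exact: prode_ge0.
rewrite big_ord_recl -IH -ge0_integralZr//; last first.
  by apply: integral_ge0 => t _; exact: prode_ge0.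
apply: eq_integral => x _; rewrite -ge0_integralZl//; last first.
  by move=> t _; exact: prode_ge0.
  exact: mprod.
apply: eq_integral => t _; rewrite big_ord_recl tnth0; congr (_ * _).
by apply: eq_bigr => i _; rewrite tnthS.
Qed.

End tuple_power.

Section tuple_power_two.
Context {d1 d2} {E1 : measurableType d1} {E2 : measurableType d2} {R : realType}.
Local Open Scope ereal_scope.

(** A weighted change of variables for one point, with constant [q], acts on independent points one
    at a time and collects one factor [q] from each. It serves to complete the square in all
    vertices of a facet. *)
Lemma tuple_power_substitution (mu1 : probability E1 R) (mu2 : probability E2 R)
    (th : E2 -> E1) (w : E1 -> \bar R) (q : \bar R) n
    (F : n.-tuple E1 -> \bar R) :
  measurable_fun setT th -> measurable_fun setT w -> (forall x, 0 <= w x) ->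
  0 <= q ->
  (forall G : E1 -> \bar R, measurable_fun setT G -> (forall x, 0 <= G x) ->
    \int[mu1]_x (G x * w x) = q * \int[mu2]_u G (th u)) ->
  measurable_fun setT F -> (forall t, 0 <= F t) ->
  \int[tuple_power mu1 n]_t (F t * \prod_(i < n) w (tnth t i)) =
  q ^+ n * \int[tuple_power mu2 n]_u F [tuple th (tnth u i) | i < n].
Proof.
move=> mth mw w0 q0 wq; elim: n F => [|n IH] F mF F0.
  rewrite expe0 mul1e !ge0_integral_tuple_power0.
  - by rewrite big_ord0 mule1; congr F; apply: eq_from_tnth => -[].
  - apply: (measurableT_comp mF); apply: measurable_mktuple => i.
    by apply: (measurableT_comp mth); exact: measurable_tnth.
  - apply: emeasurable_funM => //; apply: emeasurable_prod => i.
    by apply: (measurableT_comp mw); exact: measurable_tnth.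
have mwp k : measurable_fun setT
    (fun t : k.-tuple E1 => \prod_(i < k) w (tnth t i)).
  apply: emeasurable_prod => i; apply: (measurableT_comp mw).
  exact: measurable_tnth.
have mmap k : measurable_fun setT
    (fun t : k.-tuple E2 => [tuple th (tnth t i) | i < k]).
  apply: measurable_mktuple => i.
  by apply: (measurableT_comp mth); exact: measurable_tnth.
have wp0 k (t : k.-tuple E1) : 0 <= \prod_(i < k) w (tnth t i).
  by apply: prode_ge0.
rewrite ge0_integral_tuple_powerS; last 2 first.
- by apply: emeasurable_funM => //; exact: mwp.
- by move=> t; exact: mule_ge0.
rewrite ge0_integral_tuple_powerS; last 2 first.
- exact: (measurableT_comp mF (mmap n.+1)).
- by move=> t; exact: F0.
pose H x := \int[tuple_power mu2 n]_u F [tuple of x :: [tuple th (tnth u i) | i < n]].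
have mH : measurable_fun setT H.
  apply: (@measurable_integral2 _ _ _ _ _ (tuple_power mu2 n)
    (fun x u => F [tuple of x :: [tuple th (tnth u i) | i < n]])) => [|x u];
      last exact: F0.
  apply: (measurableT_comp mF); apply: measurable_cons => //.
  exact: (measurableT_comp (mmap n)).
have H0 x : 0 <= H x by apply: integral_ge0 => u _; exact: F0.
transitivity (\int[mu1]_x (q ^+ n * (H x * w x))).
  apply: eq_integral => x _.
  rewrite muleA -(IH (fun t => F [tuple of x :: t]))//; last first.
    by apply: (measurableT_comp mF); exact: measurable_cons.
  rewrite -ge0_integralZr//; last 2 first.
  - apply: emeasurable_funM; last exact: mwp.
    by apply: (measurableT_comp mF); exact: measurable_cons.
  - by move=> t _; exact: mule_ge0.
  apply: eq_integral => t _; rewrite big_ord_recl tnth0 -muleA; congr (_ * _).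
  by rewrite muleC; congr (_ * _); apply: eq_bigr => i _; rewrite tnthS.
rewrite ge0_integralZl//; last 3 first.
- exact: emeasurable_funM.
- by move=> x _; exact: mule_ge0.
- exact: expe_ge0.
rewrite wq// muleA expeS (muleC q); congr (_ * _).
apply: eq_integral => x _; apply: eq_integral => u _; congr F.
apply: eq_from_tnth => i; rewrite [RHS]tnth_mktuple.
by have [j ->|->] := unliftP ord0 i; rewrite ?tnthS ?tnth0 ?tnth_mktuple.
Qed.

(** Independent pairs amount to two independent tuples; this separates the points from their
    heights. *)
Lemma ge0_integral_tuple_zip (mu1 : probability E1 R) (mu2 : probability E2 R) n
    (F : n.-tuple (E1 * E2) -> \bar R) :
  measurable_fun setT F -> (forall t, 0 <= F t) ->
  \int[tuple_power mu1 n]_s \int[tuple_power mu2 n]_t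
    F [tuple (tnth s i, tnth t i) | i < n] =
  \int[tuple_power (mu1 \x mu2) n]_w F w.
Proof.
have mzip k : measurable_fun setT (fun p : k.-tuple E1 * k.-tuple E2 =>
    [tuple (tnth p.1 i, tnth p.2 i) | i < k]).
  apply: measurable_mktuple => i; apply: measurable_fun_pair.
    exact: (measurableT_comp (measurable_tnth i)).
  exact: (measurableT_comp (measurable_tnth i)).
elim: n F => [|n IH] F mF F0.
  have mFz : measurable_fun setT (fun p : 0.-tuple E1 * 0.-tuple E2 =>
      F [tuple (tnth p.1 i, tnth p.2 i) | i < 0]) by exact: (measurableT_comp
        mF (mzip _)).
  rewrite !ge0_integral_tuple_power0//.
  - by congr F; apply: eq_from_tnth => -[].
  - by apply: (measurableT_comp mF); apply: measurable_mktuple => -[].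
  - apply: (@measurable_integral2 _ _ _ _ _ (tuple_power mu2 0)
      (fun (s : 0.-tuple E1) t => F [tuple (tnth s i, tnth t i) | i < 0])) =>
        [|s t]; last exact: F0.
    exact: mFz.
have mFz : measurable_fun setT (fun p : n.+1.-tuple E1 * n.+1.-tuple E2 =>
    F [tuple (tnth p.1 i, tnth p.2 i) | i < n.+1]) by exact: (measurableT_comp
      mF (mzip _)).
have consE (x : E1) (y : E2) (s : n.-tuple E1) (t : n.-tuple E2) :
    [tuple (tnth [tuple of x :: s] i, tnth [tuple of y :: t] i) | i < n.+1] =
    [tuple of (x, y) :: [tuple (tnth s i, tnth t i) | i < n]].
  apply: eq_from_tnth => i; rewrite tnth_mktuple.
  by have [j ->|->] := unliftP ord0 i; rewrite ?tnthS ?tnth0 ?tnth_mktuple.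
rewrite ge0_integral_tuple_powerS; last 2 first.
- by apply: (@measurable_integral2 _ _ _ _ _ (tuple_power mu2 n.+1)
    (fun (s : n.+1.-tuple E1) t => F [tuple (tnth s i, tnth t i) | i < n.+1]))
      => [|s t]; [exact: mFz|exact: F0].
- by move=> s; apply: integral_ge0 => t _; exact: F0.
rewrite [RHS]ge0_integral_tuple_powerS//.
rewrite fubini_tonelli1/=; last 2 first.
- apply: (@measurable_integral2 _ _ _ _ _ (tuple_power (mu1 \x mu2) n)
    (fun x t => F [tuple of x :: t])) => [|s t]; last exact: F0.
  by apply: (measurableT_comp mF); exact: measurable_cons.
- by move=> s; apply: integral_ge0 => t _; exact: F0.
apply: eq_integral => x _; rewrite /fubini_F/=.
transitivity (\int[tuple_power mu1 n]_s \int[mu2]_y \int[tuple_power mu2 n]_t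
    F [tuple of (x, y) :: [tuple (tnth s i, tnth t i) | i < n]]).
  apply: eq_integral => s _; rewrite ge0_integral_tuple_powerS.
  - by apply: eq_integral => y _; apply: eq_integral => t _; rewrite consE.
  - exact: (measurableT_comp mFz (@pair1_measurable _ _ _ _ [tuple of x :: s])).
  - by move=> t; exact: F0.
(* The head of the second tuple has to pass the tail of the first one before the induction
   hypothesis applies. *)
rewrite (ge0_integral_swap (tuple_power mu1 n) mu2
  (f := fun s y => \int[tuple_power mu2 n]_t
    F [tuple of (x, y) :: [tuple (tnth s i, tnth t i) | i < n]])); last 2 first.
- apply: (@measurable_integral2 _ _ _ _ _ (tuple_power mu2 n)
    (fun (p : n.-tuple E1 * E2) t =>
    F [tuple of (x, p.2) :: [tuple (tnth p.1 i, tnth t i) | i < n]])) => [|s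
      t]; last exact: F0.
  apply: (measurableT_comp mF); apply: measurable_cons.
    apply: measurable_fun_pair => //.
    exact: (measurableT_comp measurable_snd).
  apply: measurable_mktuple => i; apply: measurable_fun_pair.
    apply: measurable_tnth_comp; exact: (measurableT_comp measurable_fst).
  exact: measurable_tnth_comp.
- by move=> s y; apply: integral_ge0 => t _; exact: F0.
apply: eq_integral => y _.
rewrite -(IH (fun w => F [tuple of (x, y) :: w]))//.
by apply: (measurableT_comp mF); exact: measurable_cons.
Qed.

End tuple_power_two.

(** * Basic solutions of linear programs *)

Section basic_solutions.
Context {R : realFieldType} {N : nat} {K : finType}.
Variables (v : K -> 'rV[R]_N) (z : K -> R) (u : 'rV[R]_N).
Implicit Type f : {ffun 'I_N -> K}.

(** The linear program maximises [\sum_k l k * z k] over nonnegative [l] with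
    [\sum_k l k *: v k = u]. A basis is an ordered list [f], so each one is met in all its
    orderings. For homogenised points, [basis_wt] consists of barycentric coordinates and
    [basis_dual] of the coefficients of the hyperplane through the lifted points of the basis. *)
Definition basis_mx f : 'M[R]_N := \matrix_i v (f i).
Definition basis_wt f : 'rV[R]_N := u *m invmx (basis_mx f).
Definition basis_dual f : 'rV[R]_N := (\row_i z (f i)) *m invmx (basis_mx f)^T.
Definition basis_obj f : R := \sum_i basis_wt f 0 i * z (f i).
Definition dotp (x y : 'rV[R]_N) : R := \sum_j x 0 j * y 0 j.

Definition feasible f :=
  (basis_mx f \in unitmx) && [forall i, 0 <= basis_wt f 0 i].
Definition dual_feasible f :=
  [forall k, z k <= dotp (v k) (basis_dual f)].
Definition strictly_dual_feasible f :=
  [forall k, (k \notin codom f) ==> (z k < dotp (v k) (basis_dual f))].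

Lemma mulmx_basis f (l : 'rV[R]_N) : l *m basis_mx f = \sum_i l 0 i *: v (f i).
Proof.
by rewrite mulmx_sum_row; apply: eq_bigr => i _; rewrite rowK.
Qed.

Lemma basis_wtE f : basis_mx f \in unitmx ->
  u = \sum_i basis_wt f 0 i *: v (f i).
Proof. by move=> uf; rewrite -mulmx_basis mulmxKV. Qed.

Lemma basis_wt_unique f (l : 'rV[R]_N) : basis_mx f \in unitmx ->
  u = \sum_i l 0 i *: v (f i) -> basis_wt f = l.
Proof. by move=> uf; rewrite -mulmx_basis /basis_wt => ->; rewrite mulmxK. Qed.

Lemma dotp_sum (I : finType) (l : I -> R) (w : I -> 'rV[R]_N) y :
  dotp (\sum_i l i *: w i) y = \sum_i l i * dotp (w i) y.
Proof.
rewrite /dotp; under eq_bigr do rewrite summxE mulr_suml.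
rewrite exchange_big; apply: eq_bigr => i _; rewrite mulr_sumr.
by apply: eq_bigr => j _; rewrite mxE mulrA.
Qed.

Lemma dotpE (x y : 'rV[R]_N) : dotp x y = (y *m x^T) 0 0.
Proof. by rewrite mxE; apply: eq_bigr => j _; rewrite mxE mulrC. Qed.

Lemma dotp_basis_dual f i : basis_mx f \in unitmx ->
  dotp (v (f i)) (basis_dual f) = z (f i).
Proof.
move=> uf; have uT : (basis_mx f)^T \in unitmx by rewrite unitmx_tr.
have /rowP/(_ i) : basis_dual f *m (basis_mx f)^T = \row_i z (f i).
  by rewrite mulmxKV.
by rewrite !mxE => <-; apply: eq_bigr => j _; rewrite !mxE mulrC.
Qed.

Lemma basis_dual_unique f y : basis_mx f \in unitmx ->
  (forall i, dotp (v (f i)) y = z (f i)) -> basis_dual f = y.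
Proof.
move=> uf yz; rewrite /basis_dual (_ : \row_i _ = y *m (basis_mx f)^T).
  by rewrite mulmxK// unitmx_tr.
apply/rowP => i; rewrite !mxE -yz; apply: eq_bigr => j _.
by rewrite !mxE mulrC.
Qed.

Lemma basis_inj f : basis_mx f \in unitmx -> injective f.
Proof.
move=> uf i j fij; apply: contraTeq uf => ij.
rewrite unitmxE unitfE negbK; apply/eqP; apply: (determinant_alternate ij).
by move=> k; rewrite !mxE fij.
Qed.

Lemma basis_objE f : basis_mx f \in unitmx ->
  basis_obj f = dotp u (basis_dual f).
Proof.
move=> uf; rewrite [in RHS](basis_wtE uf) dotp_sum.
by apply: eq_bigr => i _; rewrite dotp_basis_dual.
Qed.

Lemma unit_basisP f :
  (forall l : 'rV[R]_N, \sum_i l 0 i *: v (f i) = 0 -> l = 0) ->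
  basis_mx f \in unitmx.
Proof.
move=> H; rewrite -row_free_unit; apply: inj_row_free => l.
by rewrite mulmx_basis; exact: H.
Qed.

Section permutation.
Variables (f : {ffun 'I_N -> K}) (s : 'S_N).
Let fs : {ffun 'I_N -> K} := [ffun i => f (s i)].

Lemma basis_mx_perm : basis_mx fs = row_perm s (basis_mx f).
Proof. by apply/matrixP => i j; rewrite !mxE ffunE. Qed.

Lemma unit_basis_perm : (basis_mx fs \in unitmx) = (basis_mx f \in unitmx).
Proof.
by rewrite basis_mx_perm row_permE unitmx_mul unitmx_perm.
Qed.

Lemma feasible_perm : feasible f -> feasible fs.
Proof.
move=> /andP[uf /forallP wf]; rewrite /feasible unit_basis_perm uf/=.
suff wE : basis_wt fs = \row_i basis_wt f 0 (s i).
  by apply/forallP => i; rewrite wE mxE.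
apply: basis_wt_unique; first by rewrite unit_basis_perm.
rewrite [LHS](basis_wtE uf) (reindex_inj (@perm_inj _ s)).
by apply: eq_bigr => j _; rewrite mxE ffunE.
Qed.

Lemma dual_feasible_perm : feasible f -> dual_feasible f -> dual_feasible fs.
Proof.
move=> /andP[uf _] /forallP df; apply/forallP => k.
suff -> : basis_dual fs = basis_dual f by [].
apply: basis_dual_unique => [|i]; first by rewrite unit_basis_perm.
by rewrite ffunE dotp_basis_dual.
Qed.

End permutation.

(** Primal nondegeneracy: it makes all weights of a feasible basis positive. For homogenised points
    it holds at almost every [u]. *)
Hypothesis vgen : forall (g : 'I_N.-1 -> K) (a : 'I_N.-1 -> R),
  u != \sum_i a i *: v (g i).

Lemma basis_wt_neq0 f i : basis_mx f \in unitmx -> basis_wt f 0 i != 0.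
Proof.
move=> uf; apply/eqP => w0.
move: (basis_wtE uf) vgen; move: (basis_wt f) w0 => w.
case: N v u f i w {uf} => [|N'] v' u' f i w; first by case: i.
move=> w0 uE vg; have := vg (fun j => f (lift i j)) (fun j => w 0 (lift i j)).
by rewrite {1}uE (bigD1_ord i)//= w0 scale0r add0r eqxx.
Qed.

Lemma basis_wt_gt0 f i : feasible f -> 0 < basis_wt f 0 i.
Proof.
by move=> /andP[uf /forallP wf]; rewrite lt_neqAle wf eq_sym basis_wt_neq0.
Qed.

(** By weak duality both bases have the same objective. A member of [f'] outside [f] would carry
    positive weight and strict slack in the dual of [f], making the objective of [f'] smaller; so
    [f'] reorders [f]. *)
Lemma strictly_dual_feasible_unique f f' :
  feasible f -> strictly_dual_feasible f ->
  feasible f' -> dual_feasible f' \/ strictly_dual_feasible f' ->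
  exists s : 'S_N, f' = [ffun i => f (s i)].
Proof.
move=> ff sf ff' df'; have /andP[uf _] := ff; have /andP[uf' _] := ff'.
have weak h : basis_mx h \in unitmx -> strictly_dual_feasible h ->
    forall k, z k <= dotp (v k) (basis_dual h).
  move=> uh /forallP sh k.
  have [/codomP[i ->]|/(implyP (sh k))/ltW//] := boolP (k \in codom h).
  by rewrite dotp_basis_dual.
have wf' k : z k <= dotp (v k) (basis_dual f').
  by case: df' => [/forallP|/(weak _ uf')]; exact.
have obj_le h h' : basis_mx h' \in unitmx -> feasible h ->
    (forall k, z k <= dotp (v k) (basis_dual h')) ->
    basis_obj h <= basis_obj h'.
  move=> uh' /[dup] fh /andP[uh _] wh'; rewrite (basis_objE uh').
  rewrite (basis_wtE uh) dotp_sum; apply: ler_sum => i _.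
  by rewrite ler_pM2l ?basis_wt_gt0.
have objE : basis_obj f' = basis_obj f.
  by apply/eqP; rewrite eq_le !obj_le//; exact: weak.
have f'f i : f' i \in codom f.
  apply/negPn/negP => nfi; suff : basis_obj f' < basis_obj f.
    by rewrite objE ltxx.
  rewrite (basis_objE uf) (basis_wtE uf') dotp_sum.
  rewrite /basis_obj (bigD1 i)//= [ltRHS](bigD1 i)//=.
  apply: ltr_leD.
    rewrite ltr_pM2l ?basis_wt_gt0//.
    by move/forallP: sf => /(_ (f' i)); rewrite nfi.
  by apply: ler_sum => j _; rewrite ler_pM2l ?basis_wt_gt0// weak.
pose g i := iinv (f'f i).
have fg i : f (g i) = f' i by rewrite /g f_iinv.
have gI : injective g.
  by move=> i j gij; apply: (basis_inj uf'); rewrite -!fg gij.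
by exists (perm gI); apply/ffunP => i; rewrite ffunE permE fg.
Qed.

Lemma card_strictly_dual_feasible :
  (#|[set f | feasible f && strictly_dual_feasible f]%SET| <= N`!)%N.
Proof.
set S := [set f | _]%SET; have [->|[f0]] := set_0Vmem S; first by rewrite cards0.
rewrite inE => /andP[ff0 sf0].
have SI : S \subset [set [ffun i => f0 (s i)] | s : 'S_N]%SET.
  apply/fintype.subsetP => f; rewrite inE => /andP[ff sf].
  have [|s ->] := strictly_dual_feasible_unique ff0 sf0 ff; first by right.
  exact: imset_f.
apply: leq_trans (subset_leq_card SI) _.
by apply: leq_trans (leq_imset_card _ _) _; rewrite card_Sn.
Qed.

Lemma card_dual_feasible f0 : feasible f0 -> dual_feasible f0 ->
  (N`! <= #|[set f | feasible f && dual_feasible f]%SET|)%N.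
Proof.
move=> ff0 df0; have /andP[uf0 _] := ff0.
have SI : [set [ffun i => f0 (s i)] | s : 'S_N]%SET \subset
    [set f | feasible f && dual_feasible f]%SET.
  apply/fintype.subsetP => _ /imsetP[s _ ->]; rewrite inE.
  by rewrite feasible_perm//= dual_feasible_perm.
apply: leq_trans _ (subset_leq_card SI).
rewrite card_imset ?card_Sn// => s t /ffunP st; apply/permP => i.
by apply: (basis_inj uf0); have := st i; rewrite !ffunE.
Qed.

Section pivoting.
Variable i0 : 'I_N.
Hypothesis v1 : forall k, v k 0 i0 = 1.

(** A step of the simplex method: [k] violates the dual constraint and enters, the index of minimal
    ratio leaves. The gain is strict because nondegeneracy makes the step length [t] positive. *)
Lemma pivot f k : feasible f -> dotp (v k) (basis_dual f) < z k ->
  exists2 f', feasible f' & basis_obj f < basis_obj f'.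
Proof.
move=> ff zk; have /andP[uf _] := ff.
pose a := v k *m invmx (basis_mx f).
have aE : v k = \sum_i a 0 i *: v (f i) by rewrite -mulmx_basis mulmxKV.
have suma : \sum_i a 0 i = 1.
  have /rowP/(_ i0) := aE; rewrite v1 summxE => ->; apply: eq_bigr => i _.
  by rewrite [RHS]mxE v1 mulr1.
(* The coefficients of [v k] sum to 1, as seen on coordinate [i0], so one of them is positive and
   the ratio test always finds a leaving index. *)
have [i1 ai1] : exists i, 0 < a 0 i.
  apply/existsP; apply: contraT => /existsPn na.
  have : \sum_i a 0 i <= 0 by apply: sumr_le0 => i _; rewrite leNgt.
  by rewrite suma ler10.
pose r i := basis_wt f 0 i / a 0 i.
have [j aj rj] := @arg_minP _ _ _ i1 (fun i => 0 < a 0 i) r ai1.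
pose t := r j.
have t0 : 0 < t by rewrite divr_gt0 ?basis_wt_gt0.
pose f' : {ffun 'I_N -> K} := [ffun i => if i == j then k else f i].
pose l : 'rV[R]_N := \row_i (if i == j then t else basis_wt f 0 i - t * a 0 i).
have tj : basis_wt f 0 j - t * a 0 j = 0.
  by rewrite /t /r divfK ?subrr// gt_eqF.
have uf' : basis_mx f' \in unitmx.
  apply: unit_basisP => w w0.
  have : (\row_i ((if i == j then 0 else w 0 i) + w 0 j * a 0 i)) *m basis_mx f = 0.
    rewrite -[RHS]w0 mulmx_basis [in RHS](bigD1 j)//= ffunE eqxx aE.
    under eq_bigr do rewrite mxE scalerDl.
    rewrite big_split/= addrC; congr (_ + _).
      by rewrite scaler_sumr; apply: eq_bigr => i _; rewrite scalerA.
    rewrite (bigD1 j)//= eqxx scale0r add0r; apply: eq_bigr => i ij.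
    by rewrite ffunE (negbTE ij).
  move/(congr1 (mulmx^~ (invmx (basis_mx f)))); rewrite mulmxK// mul0mx.
  move/rowP => w'0; have wj : w 0 j = 0.
    have := w'0 j; rewrite [LHS]mxE [RHS]mxE eqxx add0r => /eqP.
    by rewrite mulf_eq0 (gt_eqF aj) orbF => /eqP.
  apply/rowP => i; rewrite [RHS]mxE; have := w'0 i.
  rewrite [LHS]mxE [RHS]mxE wj mul0r addr0.
  by case: eqP => [-> _|_ ->].
have sumE (V : lmodType R) (g : K -> V) :
    \sum_i l 0 i *: g (f' i) = t *: g k +
      (\sum_i basis_wt f 0 i *: g (f i) - t *: \sum_i a 0 i *: g (f i)).
  rewrite (bigD1 j)//= mxE ffunE eqxx; congr (_ + _).
  rewrite scaler_sumr -sumrB [RHS](bigD1 j)//=.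
  rewrite scalerA -scalerBl tj scale0r add0r; apply: eq_bigr => i ij.
  by rewrite mxE ffunE (negbTE ij) scalerBl scalerA.
have wt' : basis_wt f' = l.
  apply: basis_wt_unique => //.
  by rewrite sumE -aE -basis_wtE// addrC subrK.
exists f'.
  rewrite /feasible uf' wt'/=; apply/forallP => i; rewrite mxE.
  case: eqP => [_|/eqP ij]; first exact: ltW.
  have [ai|ai] := ltP 0 (a 0 i).
    by rewrite subr_ge0 -ler_pdivlMr// rj.
  rewrite addr_ge0//; first by rewrite ltW// basis_wt_gt0.
  by rewrite oppr_ge0 mulr_ge0_le0// ltW.
have -> : basis_obj f' = t * z k + (basis_obj f - t * \sum_i a 0 i * z (f i)).
  by rewrite /basis_obj wt'; have := sumE R^o z.
rewrite addrCA ltrDl -mulrBr mulr_gt0// subr_gt0.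
suff -> : \sum_i a 0 i * z (f i) = dotp (v k) (basis_dual f) by [].
rewrite aE dotp_sum; apply: eq_bigr => i _.
by rewrite dotp_basis_dual.
Qed.

(** There are finitely many bases, and one of maximal objective admits no pivot. *)
Lemma dual_feasible_exists f : feasible f ->
  exists2 f', feasible f' & dual_feasible f'.
Proof.
move=> ff; have [f' ff' maxf'] := @arg_maxP _ _ _ f feasible basis_obj ff.
exists f' => //; apply/forallP => k; rewrite leNgt; apply/negP => zk.
have [f'' ff''] := pivot ff' zk.
by have /= := maxf' _ ff''; rewrite ltNge => ->.
Qed.

End pivoting.

End basic_solutions.

(** * Caratheodory's theorem and the existence of a feasible basis *)

Section caratheodory.
Context {R : realFieldType} {N : nat} {K : finType}.
Variables (v : K -> 'rV[R]_N) (i0 : 'I_N).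
Hypothesis v1 : forall k, v k 0 i0 = 1.

Definition rows_mx (S : {set K}) : 'M[R]_(#|S|, N) := \matrix_i v (enum_val i).

Lemma mulmx_rows (S : {set K}) (w : 'rV[R]_#|S|) :
  w *m rows_mx S = \sum_i w 0 i *: v (enum_val i).
Proof. by rewrite mulmx_sum_row; apply: eq_bigr => i _; rewrite rowK. Qed.

(** If the support is linearly dependent, subtracting the largest admissible multiple of the
    dependency kills one weight and keeps the others nonnegative. Such a multiple exists because the
    coefficients of the dependency sum to 0, by coordinate [i0], so one is positive. *)
Lemma caratheodory (l : K -> R) : (forall k, 0 <= l k) ->
  exists2 S : {set K}, row_free (rows_mx S) &
    exists2 w : 'rV[R]_#|S|, forall i, 0 <= w 0 i &
      w *m rows_mx S = \sum_k l k *: v k.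
Proof.
have [n] := ubnP #|[set k | l k != 0]%SET|.
elim: n l => // n IH l; rewrite ltnS => ln l0.
pose S := [set k | l k != 0]%SET.
have sumS (c : K -> R) : (forall k, k \notin S -> c k = 0) ->
    \sum_k c k *: v k = \sum_(i < #|S|) c (enum_val i) *: v (enum_val i).
  move=> c0; rewrite (bigID (mem S))/= [X in _ + X]big1 ?addr0; last first.
    by move=> k /c0 ->; rewrite scale0r.
  by rewrite big_enum_val.
have lS k : k \notin S -> l k = 0 by rewrite inE negbK => /eqP.
have [Sfree|Sfree] := boolP (row_free (rows_mx S)).
  exists S => //; exists (\row_i l (enum_val i)) => [i|]; first by rewrite mxE.
  by rewrite mulmx_rows sumS//; apply: eq_bigr => i _; rewrite mxE.
have [w w0 wA] : exists2 w : 'rV[R]_#|S|, w != 0 & w *m rows_mx S = 0.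
  move: Sfree; rewrite -kermx_eq0 => /rowV0Pn[w /sub_kermxP wA w0].
  by exists w.
have [i1 wi1] : exists i, 0 < w 0 i.
  have sumw : \sum_i w 0 i = 0.
    move/rowP: wA => /(_ i0); rewrite mulmx_rows summxE [RHS]mxE => w1.
    rewrite -[RHS]w1; apply: eq_bigr => i _.
    by rewrite [RHS]mxE v1 mulr1.
  apply/existsP; apply: contraT => /existsPn nw.
  have {}nw i : 0 <= - w 0 i by rewrite oppr_ge0 leNgt.
  case/eqP: w0; apply/rowP => i; rewrite mxE.
  have : \sum_i (- w 0 i) = 0 by rewrite sumrN sumw oppr0.
  move/psumr_eq0P => /(_ (fun i _ => nw i) i isT)/eqP.
  by rewrite oppr_eq0 => /eqP.
pose r i := l (enum_val i) / w 0 i.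
have [j wj rj] := @arg_minP _ _ _ i1 (fun i => 0 < w 0 i) r wi1.
pose t := r j.
have t0 : 0 <= t by rewrite divr_ge0// ltW.
pose wK k := if [pick i | enum_val i == k] is Some i then w 0 i else 0.
have wKE i : wK (enum_val i) = w 0 i.
  rewrite /wK; case: pickP => [i' /eqP/enum_val_inj -> //|/(_ i)].
  by rewrite eqxx.
have wKS k : k \notin S -> wK k = 0.
  move=> kS; rewrite /wK; case: pickP => // i /eqP ik.
  by move: kS; rewrite -ik enum_valP.
pose l' k := l k - t * wK k.
have l'E k : k \notin S -> l' k = 0.
  by move=> kS; rewrite /l' lS// wKS// mulr0 subr0.
have -> : \sum_k l k *: v k = \sum_k l' k *: v k; last first.
  apply: (IH l').
    apply: leq_trans ln; apply: proper_card; apply/properP; split.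
      apply/fintype.subsetP => k; rewrite inE; apply: contraNT => kS.
      by apply/eqP; exact: l'E.
    exists (enum_val j); first exact: enum_valP.
    by rewrite inE negbK /l' wKE /t /r divfK ?subrr// gt_eqF.
  move=> k; have [kS|kS] := boolP (k \in S); last by rewrite l'E.
  rewrite -(enum_rankK_in kS kS); set i := enum_rank_in _ _.
  rewrite /l' wKE; have [wi|wi] := ltP 0 (w 0 i).
    by rewrite subr_ge0 -ler_pdivlMr// rj.
  by rewrite addr_ge0// oppr_ge0 mulr_ge0_le0.
rewrite (sumS l)// (sumS l')//.
under [in RHS]eq_bigr do rewrite /l' wKE scalerBl -scalerA.
by rewrite sumrB -scaler_sumr -mulmx_rows wA scaler0 subr0.
Qed.

Lemma feasible_exists (u : 'rV[R]_N) (l : K -> R) : u 0 i0 = 1 ->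
  (forall (g : 'I_N.-1 -> K) (a : 'I_N.-1 -> R), u != \sum_i a i *: v (g i)) ->
  (forall k, 0 <= l k) -> u = \sum_k l k *: v k -> exists f, feasible v u f.
Proof.
move=> u1 vgen l0 uE; have [S Sfree [w w0 wE]] := caratheodory l0.
rewrite -uE in wE; pose s := #|S|.
have N0 : (0 < N)%N by case: N i0 => // -[].
have sN : (s <= N)%N by rewrite /s -(eqP Sfree) rank_leq_col.
have [sltN|] := ltnP s N; last first.
  move=> Ns; have {}sN : N = s by apply/eqP; rewrite eqn_leq Ns sN.
  pose f : {ffun 'I_N -> K} := [ffun i => enum_val (cast_ord sN i)].
  have bij : {on xpredT, bijective (cast_ord sN)}.
    by apply: onW_bij; exists (cast_ord (esym sN)) => j;
      rewrite ?cast_ordK ?cast_ordKV.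
  have uf : basis_mx v f \in unitmx.
    apply: unit_basisP => x x0.
    have : (\row_i x 0 (cast_ord (esym sN) i)) *m rows_mx S = 0.
      rewrite mulmx_rows -[RHS]x0 [LHS](reindex (cast_ord sN))//=.
      by apply: eq_bigr => i _; rewrite mxE ffunE cast_ordK.
    move/eqP; rewrite mulmx_free_eq0// => /eqP/rowP x'0.
    apply/rowP => i; have := x'0 (cast_ord sN i).
    by rewrite !mxE cast_ordK.
  exists f; rewrite /feasible uf/=; apply/forallP => i.
  suff -> : basis_wt v u f = \row_i w 0 (cast_ord sN i) by rewrite mxE.
  apply: basis_wt_unique => //; rewrite -[LHS]wE mulmx_rows.
  rewrite [LHS](reindex (cast_ord sN))//=.
  by apply: eq_bigr => j _; rewrite mxE ffunE.
have k0 : K.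
  case: (pickP (xpredT : pred K)) => [k _|K0]; first exact: k.
  by move: u1; rewrite uE big_pred0// mxE => /eqP; rewrite eq_sym oner_eq0.
have sN1 : (s <= N.-1)%N by rewrite -ltnS prednK.
(* A free family with fewer than [N] members, padded with zero coefficients at [k0] to length
   [N.-1], contradicts the genericity of [u]. *)
pose g (i : 'I_N.-1) : K := if insub (i : nat) is Some j
  then enum_val (j : 'I_s) else k0.
pose a (i : 'I_N.-1) : R := if insub (i : nat) is Some j
  then w 0 (j : 'I_s) else 0.
have /eqP[] := vgen g a.
pose F (i : nat) := if insub i is Some j
  then w 0 (j : 'I_s) *: v (enum_val j) else 0.
rewrite -[LHS]wE mulmx_rows.
transitivity (\sum_(i < s) F i).
  by apply: eq_bigr => i _; rewrite /F valK.
rewrite (big_ord_widen N.-1 F)// big_mkcond; apply: eq_bigr => i _.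
rewrite /F /a /g; case: ltnP => si; first by rewrite insubT.
by rewrite insubF ?scale0r// ltnNge si.
Qed.

End caratheodory.

(** * Convex hulls *)

Section finite_convex_hull.
Context {R : realType} {M : lmodType R} {K : finType}.
Variable p : K -> M.

Definition convex_combinations : set M :=
  [set y | exists l : K -> R,
    [/\ forall k, 0 <= l k, \sum_k l k = 1 & y = \sum_k l k *: p k]].

Lemma convex_hull_finite : convex_hull (range p) = convex_combinations.
Proof.
apply/seteqP; split => y.
  apply; split => [|_ [k _ <-]].
    move=> x x' t; rewrite !inE => -[l [l0 l1 ->]] [l' [l'0 l'1 ->]].
    exists (fun k => t%:num * l k + (1 - t%:num) * l' k); split.
    - by move=> k; rewrite addr_ge0// mulr_ge0// subr_ge0.
    - by rewrite big_split/= -!mulr_sumr l1 l'1 !mulr1 addrC subrK.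
    - rewrite /conv/=.
      under [RHS]eq_bigr do rewrite scalerDl -!scalerA.
      by rewrite big_split/= -!scaler_sumr.
  exists (fun k' => (k' == k)%:R); split => //.
    by rewrite (bigD1 k)//= eqxx big1 ?addr0// => k' /negbTE ->.
  rewrite (bigD1 k)//= eqxx scale1r big1 ?addr0// => k' /negbTE ->.
  by rewrite scale0r.
move=> [l [l0 l1 ->]] C [cC pC].
(* Convexity is a condition on two points, so the induction runs over partial sums normalised by
   their total weight. *)
suff H (s : seq K) : 0 < \sum_(k <- s) l k ->
    C ((\sum_(k <- s) l k)^-1 *: \sum_(k <- s) l k *: p k).
  by have := H (index_enum K); rewrite l1 invr1 scale1r; apply.
elim: s => [|k s IH]; first by rewrite big_nil ltxx.
have Cp i : p i \in C by rewrite inE; apply: pC; exists i.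
rewrite !big_cons; set a := \sum_(j <- s) l j in IH *.
have a0 : 0 <= a by exact: sumr_ge0.
have [a_eq0|aN0] := eqVneq a 0.
  rewrite a_eq0 addr0 => lk0.
  have s0 : \sum_(j <- s) l j *: p j = 0.
    rewrite big_seq big1// => j js.
    have /eqP : a = 0 by [].
    rewrite psumr_eq0// => /allP/(_ _ js)/= /eqP ->.
    by rewrite scale0r.
  by rewrite s0 addr0 scalerA mulVf ?gt_eqF// scale1r; apply/set_mem/Cp.
have {}a0 : 0 < a by rewrite lt_neqAle eq_sym aN0.
move=> la0; have t01 : 0 <= l k / (l k + a) <= 1.
  apply/andP; split; first by rewrite divr_ge0// ltW.
  by rewrite ler_pdivrMr// mul1r lerDl; exact: ltW.
pose t := Itv01 (andP t01).1 (andP t01).2.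
have := cC (p k) (a^-1 *: \sum_(j <- s) l j *: p j) t (Cp k).
rewrite !inE => /(_ (IH a0)); rewrite /conv/=.
congr (C _); rewrite scalerDr !scalerA mulrC; congr (_ + _ *: _).
have la00 := lt0r_neq0 la0; rewrite /unstable.onem.
by field; rewrite la00 aN0.
Qed.

End finite_convex_hull.

Section homogeneous.
Context {R : realType} {d : nat}.
Implicit Types x y : 'rV[R]_d.

Definition hom x : 'rV[R]_d.+1 := cons_rV (1, x).

Lemma hom0 x : hom x 0 ord0 = 1.
Proof. exact: cons_rV0. Qed.

Lemma homS x j : hom x 0 (lift ord0 j) = x 0 j.
Proof. exact: cons_rVS. Qed.

Lemma measurable_hom dT (T : measurableType dT) (f : T -> 'rV[R]_d) :
  measurable_fun setT f -> measurable_fun setT (fun t => hom (f t)).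
Proof. by move=> mf; exact: measurable_cons_rV2. Qed.

Lemma measurable_homT : measurable_fun setT hom.
Proof. exact: (@measurable_hom _ _ id (@measurable_id _ _ _)). Qed.

Lemma hom_sum (I : finType) (l : I -> R) (p : I -> 'rV[R]_d) y :
  (hom y = \sum_i l i *: hom (p i)) <->
  (\sum_i l i = 1 /\ y = \sum_i l i *: p i).
Proof.
split=> [/rowP H|[l1 yE]].
  split; first by have := H ord0; rewrite hom0 summxE => ->;
    apply: eq_bigr => i _; rewrite mxE hom0 mulr1.
  apply/rowP => j; have := H (lift ord0 j); rewrite homS => ->.
  by rewrite !summxE; apply: eq_bigr => i _; rewrite [LHS]mxE [RHS]mxE homS.
apply/rowP => j; rewrite summxE; have [i ->|->] := unliftP ord0 j.
  by rewrite homS yE summxE; apply: eq_bigr => k _; rewrite [LHS]mxE [RHS]mxE homS.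
by rewrite hom0 -l1; apply: eq_bigr => k _; rewrite mxE hom0 mulr1.
Qed.

Lemma dotp_cons (a b : R) x y :
  dotp (cons_rV (a, x) : 'rV_d.+1) (cons_rV (b, y)) = a * b + dotp x y.
Proof.
rewrite /dotp big_ord_recl !cons_rV0; congr (_ + _).
by apply: eq_bigr => j _; rewrite !cons_rVS.
Qed.

Lemma dotp_hom x (a : R) b : dotp (hom x) (cons_rV (a, b)) = a + dotp x b.
Proof. by rewrite dotp_cons mul1r. Qed.

End homogeneous.

Section measurable_linear.
Context {R : realType} {dT} {T : measurableType dT}.

Lemma measurable_dotp d (f g : T -> 'rV[R]_d) :
  measurable_fun setT f -> measurable_fun setT g ->
  measurable_fun setT (fun t => dotp (f t) (g t)).
Proof.
move=> mf mg; apply: measurable_sum => j.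
by apply: measurable_funM; exact: measurable_rV_coord.
Qed.

Lemma measurable_eq0 (f : T -> R) : measurable_fun setT f ->
  measurable [set t | f t = 0].
Proof.
move=> mf; rewrite [X in measurable X](_ : _ = f @^-1` [set 0]);
  last by apply/seteqP; split.
by rewrite -[X in measurable X]setTI; apply: mf.
Qed.

Lemma measurable_ge0 (f : T -> R) : measurable_fun setT f ->
  measurable [set t | 0 <= f t].
Proof.
move=> mf; rewrite [X in measurable X](_ : _ = f @^-1` `[0, +oo[%classic).
  by rewrite -[X in measurable X]setTI; apply: mf.
by apply/seteqP; split => t /=; rewrite in_itv/= andbT.
Qed.

Lemma measurable_finforall (I : finType) (A : I -> set T) :
  (forall i, measurable (A i)) -> measurable [set t | forall i, A i t].
Proof.
move=> mA; rewrite [X in measurable X](_ : _ = \bigcap_(i in [set: I]) A i).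
  by apply: fin_bigcap_measurable => // i _; exact: finite_finset.
by apply/seteqP; split => t /= H i; [move=> _|]; exact: H.
Qed.

Lemma measurable_finexists (I : finType) (A : I -> set T) :
  (forall i, measurable (A i)) -> measurable [set t | exists i, A i t].
Proof.
move=> mA; rewrite [X in measurable X](_ : _ = \bigcup_(i in [set: I]) A i).
  by apply: fin_bigcup_measurable => // i _; exact: finite_finset.
by apply/seteqP; split => t /= [i]; [exists i|move=> _; exists i].
Qed.

End measurable_linear.

(** * Null sets and points in general position *)

Section hyperplane.
Context {R : realType}.
Local Notation mu := (@lebesgue_measure R).
Local Notation leb d := (lebesgue_rV R d).

(** Homogenising covers affine hyperplanes. If the coefficient [c1] of the first coordinate
    vanishes, that coordinate is free and the induction hypothesis applies to [c']; otherwise each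
    line in its direction meets the set in one point. In dimension 0 the set is empty. *)
Lemma lebesgue_rV_hyperplane d (c : 'rV[R]_d.+1) : c != 0 ->
  leb d [set y | dotp (hom y) c = 0] = 0%E.
Proof.
elim: d c => [|d IH] c c0.
  rewrite (_ : [set y | _] = set0) ?measure0//; apply/seteqP; split => // y /=.
  rewrite /dotp big_ord1 hom0 mul1r => c00; case/eqP: c0.
  by apply/rowP => i; rewrite ord1 mxE.
have mA : measurable [set y : 'rV[R]_d.+1 | dotp (hom y) c = 0].
  apply: measurable_eq0; apply: measurable_dotp => //.
  exact: measurable_homT.
pose c1 : R := c 0 (lift ord0 ord0).
pose c' : 'rV[R]_d.+1 :=
  \row_j c 0 (if unlift ord0 j is Some k then lift ord0 (lift ord0 k) else ord0).
have dotpE a x : dotp (hom (cons_rV (a, x))) c = a * c1 + dotp (hom x) c'.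
  rewrite /dotp big_ord_recl [X in _ + X]big_ord_recl [in RHS]big_ord_recl.
  rewrite !hom0 !homS cons_rV0 !mxE unlift_none addrCA; congr (_ + (_ + _)).
  by apply: eq_bigr => j _; rewrite !homS cons_rVS mxE liftK.
rewrite -(setIT [set y | dotp (hom y) c = 0]) -integral_indic//.
have mi : measurable_fun setT
    (fun y : 'rV[R]_d.+1 => (\1_[set y | dotp (hom y) c = 0] y : R)%:E).
  by apply/measurable_EFinP; exact: measurable_indic.
have [c10|c10] := eqVneq c1 0.
  rewrite ge0_integral_lebesgue_rVS//.
  apply: integral0_eq => a _.
  rewrite (eq_integral (fun y => (\1_[set y | dotp (hom y) c' = 0] y : R)%:E)).
    rewrite integral_indic; [|by []|]; last first.
      apply: measurable_eq0; apply: measurable_dotp => //.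
      exact: measurable_homT.
    rewrite setIT.
    apply: IH; apply: contra c0 => /eqP/rowP c'0; apply/eqP/rowP => i.
      rewrite mxE; have [j ->|->] := unliftP ord0 i; last first.
        by have := c'0 ord0; rewrite !mxE unlift_none.
      have [k ->|->] := unliftP ord0 j; last exact: c10.
      by have := c'0 (lift ord0 k); rewrite !mxE liftK.
  move=> y _; rewrite !indicE; congr ((nat_of_bool _)%:R%:E).
  by apply/idP/idP; rewrite !inE/= dotpE c10 mulr0 add0r.
rewrite ge0_integral_lebesgue_rVS2//.
apply: integral0_eq => x _.
rewrite (eq_integral (fun a : measurableTypeR R => (\1_[set - dotp (hom x) c' /
  c1] a : R)%:E)).
  by rewrite integral_indic// setIT; exact: lebesgue_measure_set1.
move=> a _; rewrite !indicE; congr ((nat_of_bool _)%:R%:E).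
apply/idP/idP; rewrite !inE/= dotpE.
  by move/eqP; rewrite addr_eq0 => /eqP <-; rewrite mulfK.
by move=> ->; rewrite divfK// addNr.
Qed.

End hyperplane.

Section hull_generic.
Context {R : realType} {d : nat} {K : finType}.
Variable p : K -> 'rV[R]_d.
Local Notation leb d := (lebesgue_rV R d).
Local Notation hull := (convex_hull (range p)).
Local Notation v := (fun k => hom (p k)).

Lemma convex_hull_homP y : hull y <->
  exists2 l : K -> R, forall k, 0 <= l k & hom y = \sum_k l k *: hom (p k).
Proof.
rewrite convex_hull_finite; split=> [[l [l0 l1 yE]]|[l l0 /hom_sum[l1 yE]]].
  by exists l => //; apply/hom_sum.
by exists l.
Qed.

(** Caratheodory's theorem turns the hull into a finite union over affinely independent subfamilies.
    There the pseudo-inverse yields the weights as linear functions of [hom y], and the last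
    condition says that [y] lies in the affine span. *)
Lemma measurable_convex_hull : measurable (hull : set 'rV[R]_d).
Proof.
have -> : hull = [set y | exists S : {set K}, [/\ row_free (rows_mx v S),
    forall i, 0 <= (hom y *m pinvmx (rows_mx v S)) 0 i &
    forall j, (hom y *m pinvmx (rows_mx v S) *m rows_mx v S - hom y) 0 j = 0]].
  apply/seteqP; split => y /=.
    move/convex_hull_homP => [l l0 yE].
    have [S Sf [w w0 wE]] := caratheodory (v := v) (fun k => hom0 (p k)) l0.
    rewrite -yE in wE; exists S; split => // [i|j].
      by rewrite -wE mulmxKp.
    by rewrite -wE mulmxKp// subrr mxE.
  move=> [S [Sf w0 wE]]; apply/convex_hull_homP.
  set w := hom y *m pinvmx (rows_mx v S) in w0 wE.
  pose l k := if [pick i | enum_val i == k] is Some i then w 0 i else 0.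
  exists l => [k|]; first by rewrite /l; case: pickP.
  have {1}<- : w *m rows_mx v S = hom y.
    by apply/rowP => j; apply/eqP; rewrite -subr_eq0; have := wE j;
      rewrite !mxE => ->.
  rewrite mulmx_rows [RHS](bigID (mem S))/= [X in _ = _ + X]big1 ?addr0.
    rewrite [RHS]big_enum_val.
apply: eq_bigr => i _; congr (_ *: _).
    rewrite /l; case: pickP => [i' /eqP/enum_val_inj -> //|/(_ i)].
    by rewrite eqxx.
  move=> k kS; rewrite /l; case: pickP => [i /eqP ik|]; last by rewrite scale0r.
  by move: kS; rewrite -ik enum_valP.
apply: measurable_finexists => S.
have [Sf|Sf] := boolP (row_free (rows_mx v S)); last first.
  rewrite [X in measurable X](_ : _ = set0)//.
  by apply/seteqP; split => // y [].
have mh : measurable_fun setT (@hom R d) by exact: measurable_homT.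
rewrite [X in measurable X](_ : _ =
  [set y | forall i, 0 <= (hom y *m pinvmx (rows_mx v S)) 0 i] `&`
  [set y | forall j, (hom y *m pinvmx (rows_mx v S) *m rows_mx v S - hom y) 0 j = 0]);
  last by apply/seteqP; split => y /=; [case|case=> ? ?; split].
apply: measurableI.
  apply: measurable_finforall => i; apply: measurable_ge0.
  by apply: measurable_rV_coord; exact: measurable_rV_mulmx.
apply: measurable_finforall => i; apply: measurable_eq0.
under eq_fun do rewrite mxE [X in _ + X]mxE.
apply: measurable_funB; last exact: measurable_rV_coord.
apply: measurable_rV_coord; apply: measurable_rV_mulmx => //.
exact: measurable_rV_mulmx.
Qed.

(** Any [d] homogenised points are annihilated by a nonzero [c], since they live in dimension
    [d.+1]; the excluded [y] thus lie in finitely many hyperplanes. *)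
Lemma ae_affinely_generic : {ae leb d, forall y,
  forall (g : 'I_d -> K) (a : 'I_d -> R), hom y != \sum_i a i *: hom (p (g i))}.
Proof.
pose P (g : {ffun 'I_d -> K}) (y : 'rV[R]_d) :=
  forall a : 'I_d -> R, hom y != \sum_i a i *: hom (p (g i)).
(* The choices of [g] form a finite type, enumerated here through its pickling so that [ae_foralln]
   applies. *)
pose Q n y := if unpickle n is Some g then P g y else True.
suff H n : {ae leb d, forall y, Q n y}.
  have := ae_foralln H; apply: filterS => y Qy g a.
  have := Qy (pickle [ffun i => g i]); rewrite /Q pickleK => /(_ a).
  by under eq_bigr do rewrite ffunE.
rewrite /Q; case: unpickle => [g|]; last exact: aeW.
pose A : 'M[R]_(d.+1, d) := \matrix_(j, i) hom (p (g i)) 0 j.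
have [c c0 cA] : exists2 c : 'rV[R]_d.+1, c != 0 & c *m A = 0.
  have : kermx A != 0.
    rewrite kermx_eq0 -row_leq_rank -ltnNge.
    by apply: leq_ltn_trans (rank_leq_col _) _.
  by move/rowV0Pn => [c /sub_kermxP cA c0]; exists c.
exists [set y | dotp (hom y) c = 0]; split.
- apply: measurable_eq0; apply: measurable_dotp => //.
  exact: measurable_homT.
- exact: lebesgue_rV_hyperplane.
- move=> y /= nP; apply: contrapT => yc; apply: nP => a; apply/eqP => yE.
  apply: yc; rewrite yE dotp_sum big1// => i _.
  have /rowP/(_ i) := cA; rewrite [LHS]mxE [RHS]mxE => cAi.
  rewrite /dotp (_ : \sum_j _ = 0) ?mulr0// -[RHS]cAi.
  by apply: eq_bigr => j _; rewrite [A _ _]mxE mulrC.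
Qed.

(** The exceptional null set depends on the points alone, which lets the heights be quantified
    inside. In the hull, at most the orderings of a single basis are strictly optimal, and at least
    the orderings of one are weakly optimal; outside the hull no basis is feasible. *)
Lemma ae_card_strictly_dual_feasible : {ae leb d, forall y (z : K -> R),
  ((#|[set f | feasible v (hom y) f && strictly_dual_feasible v z f]%SET|)%:R
    <= (d.+1)`!%:R * \1_hull y :> R) /\
  ((d.+1)`!%:R * \1_hull y <=
   (#|[set f | feasible v (hom y) f && dual_feasible v z f]%SET|)%:R :> R)}.
Proof.
apply: filterS ae_affinely_generic => y gen z.
rewrite indicE; have [/set_mem yh|yh] := boolP (y \in hull).
  rewrite mulr1 !ler_nat; split; first exact: (@card_strictly_dual_feasible _
    d.+1 _ v z (hom y) gen).
  have [l l0 yE] := (convex_hull_homP y).1 yh.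
  have [f0 ff0] := @feasible_exists _ _ _ _ ord0 (fun k => hom0 (p k)) (hom y) l
    (hom0 y) gen l0 yE.
  have [f ff df] := @dual_feasible_exists _ d.+1 _ v z (hom y) gen ord0 (fun k
    => hom0 (p k)) f0 ff0.
  exact: card_dual_feasible ff df.
rewrite mulr0; split => //.
rewrite lern0 cards_eq0; apply/eqP/finset.setP => f; rewrite !inE.
apply/negP => /andP[/andP[uf /forallP wf] _]; case/negP: yh; apply/mem_set.
apply/convex_hull_homP.
exists (fun k => \sum_(i | f i == k) basis_wt v (hom y) f 0 i).
  by move=> k; apply: sumr_ge0 => i _; exact: wf.
rewrite {1}(basis_wtE (hom y) uf) (partition_big f xpredT)//=; apply: eq_bigr => k _.
by rewrite scaler_suml; apply: eq_bigr => i /eqP ->.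
Qed.

End hull_generic.

(** * Gaussian vectors *)

Section density.
Context {d} {T : measurableType d} {R : realType}.
Variables (m mu : {measure set T -> \bar R}) (g : T -> R).
Hypotheses (mg : measurable_fun setT g) (g0 : forall x, 0 <= g x).
Local Open Scope ereal_scope.
Hypothesis mE : forall A, measurable A -> m A = \int[mu]_(x in A) (g x)%:E.

Import HBNNSimple.

(** Linearity extends [mE] to simple functions, and monotone convergence along [nnsfun_approx]
    extends it to [F]. *)
Lemma ge0_integral_density (F : T -> \bar R) :
  measurable_fun setT F -> (forall x, 0 <= F x) ->
  \int[m]_x F x = \int[mu]_x (F x * (g x)%:E).
Proof.
move=> mF F0.
have mge : measurable_fun setT (EFin \o g) by exact/measurable_EFinP.
pose h := nnsfun_approx measurableT mF.
have Flim x : F x = limn (EFin \o h ^~ x).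
  by apply/esym/cvg_lim => //; exact: cvg_nnsfun_approx.
transitivity (limn (fun n => \int[m]_x (h n x)%:E)).
  rewrite -monotone_convergence//.
  - by apply: eq_integral => x _; exact: Flim.
  - by move=> n; exact/measurable_EFinP.
  - by move=> n x _; rewrite lee_fin.
  - by move=> x _ a b ab; rewrite lee_fin; exact/lefP/nd_nnsfun_approx.
transitivity (limn (fun n => \int[mu]_x ((h n x)%:E * (g x)%:E))); last first.
  rewrite -monotone_convergence//.
  - apply: eq_integral => x _; apply/cvg_lim => //; apply: cvgeZr => //.
    exact: cvg_nnsfun_approx.
  - by move=> n; apply: emeasurable_funM => //; exact/measurable_EFinP.
  - by move=> n x _; rewrite mule_ge0 ?lee_fin.
  - move=> x _ a b ab; rewrite lee_wpmul2r ?lee_fin//.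
    exact/lefP/nd_nnsfun_approx.
congr (limn _); apply/funext => n.
have mind r : measurable (h n @^-1` [set r]).
  by rewrite -[X in measurable X]setTI; exact: measurable_funP.
transitivity (\sum_(r \in range (h n)) (r%:E * m (h n @^-1` [set r]))).
  rewrite (integralT_nnsfun m (h n)) sintegralE//.
transitivity (\int[mu]_x \sum_(r \in range (h n))
    ((r * \1_(h n @^-1` [set r]) x)%:E * (g x)%:E)); last first.
  apply: eq_integral => x _.
  rewrite -ge0_mule_fsuml => [|y]; last exact: nnfun_muleindic_ge0.
  by rewrite fsumEFin// -(fimfunE _ x).
rewrite ge0_integral_fsum//.
- apply: eq_fsbigr => r /set_mem [x _ hx].
  rewrite mE// integral_mkcond -ge0_integralZl//.
  + apply: eq_integral => y _; rewrite patchE indicE.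
    by case: ifPn => _; rewrite ?mulr1 ?mulr0 ?mul0e ?mule0.
  + by apply/(measurable_restrictT _ _).1 => //; exact: measurable_funS mge.
  + by move=> y _; rewrite patchE; case: ifPn => // _; rewrite lee_fin.
  + by rewrite lee_fin -hx.
- move=> r; apply: emeasurable_funM => //; apply/measurable_EFinP.
  by apply: measurable_funM => //; exact: measurable_indic.
- by move=> r x _; apply: mule_ge0; [exact: nnfun_muleindic_ge0|rewrite lee_fin].
Qed.

End density.

Section gaussian.
Context {R : realType}.
Local Notation mu := (@lebesgue_measure R).
Local Notation leb d := (lebesgue_rV R d).

Definition std_normal : probability (measurableTypeR R) R := normal_prob 0 1.

Lemma measurable_phi : measurable_fun setT (@phi R).
Proof. exact: measurable_normal_pdf. Qed.

Lemma phi_ge0 (t : R) : 0 <= phi t.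
Proof. exact: normal_pdf_ge0. Qed.

Lemma phiN (t : R) : phi (- t) = phi t.
Proof. by rewrite !phiE sqrrN. Qed.

Lemma ge0_integral_std_normal (F : R -> \bar R) :
  measurable_fun setT F -> (forall x, 0 <= F x)%E ->
  (\int[std_normal]_x F x = \int[mu]_x (F x * (phi x)%:E))%E.
Proof.
move=> mF F0; apply: ge0_integral_density => //.
- exact: measurable_phi.
- exact: phi_ge0.
Qed.

Definition row_of_tuple d (t : d.-tuple (measurableTypeR R)) : 'rV[R]_d :=
  \row_i tnth t i.

Lemma measurable_row_of_tuple d : measurable_fun setT
  (@row_of_tuple d).
Proof.
apply: measurable_rVP => i; under eq_fun do rewrite mxE.
exact: measurable_tnth.
Qed.

HB.instance Definition _ d := isMeasurableFun.Build _ _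
  (d.-tuple (measurableTypeR R)) 'rV[R]_d (@row_of_tuple d)
  (@measurable_row_of_tuple d).

(** The image of a product of one-dimensional laws: a probability by construction, with coordinates
    that can be integrated one by one. [gauss_rVE] recovers the density. *)
Definition gauss_rV d : probability 'rV[R]_d R :=
  distribution (tuple_power std_normal d) (@row_of_tuple d).

Definition prod_phi d (x : 'rV[R]_d) : R := \prod_(i < d) phi (x 0 i).

Lemma prod_phi_ge0 d (x : 'rV[R]_d) : 0 <= prod_phi x.
Proof. by apply: prodr_ge0 => i _; exact: phi_ge0. Qed.

Lemma measurable_prod_phi d : measurable_fun setT (@prod_phi d).
Proof.
apply: measurable_prod => i _.
exact: (measurableT_comp measurable_phi (measurable_coord i)).
Qed.

Lemma prod_phi_cons d a (x : 'rV[R]_d) :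
  prod_phi (cons_rV (a, x)) = phi a * prod_phi x.
Proof.
rewrite /prod_phi big_ord_recl cons_rV0; congr (_ * _).
by apply: eq_bigr => i _; rewrite cons_rVS.
Qed.

Lemma prod_phiE d (x : 'rV[R]_d) : prod_phi x = std_normal_vector_pdf x.
Proof.
rewrite /prod_phi /std_normal_vector_pdf.
under eq_bigr do rewrite phiE.
rewrite big_split/= prodr_const card_ord exprVn; congr (_ * _).
rewrite -expR_sum; congr expR; rewrite -mulr_suml; congr (_ / _).
by rewrite sumrN.
Qed.

Local Open Scope ereal_scope.

Lemma ge0_integral_row_of_tuple d (F : 'rV[R]_d -> \bar R) :
  measurable_fun setT F -> (forall x, 0 <= F x) ->
  \int[tuple_power std_normal d]_t F (row_of_tuple t) =
  \int[leb d]_x (F x * (prod_phi x)%:E).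
Proof.
elim: d F => [|d IH] F mF F0.
  rewrite ge0_integral_tuple_power0; last first.
    exact: (measurableT_comp mF (@measurable_row_of_tuple 0)).
  rewrite ge0_integral_lebesgue_rV0.
    rewrite /prod_phi big_ord0 mule1; congr F; by apply/rowP => -[].
  by apply: emeasurable_funM => //; apply/measurable_EFinP; exact: measurable_prod_phi.
have mFphi : measurable_fun setT (fun x => F x * (prod_phi x)%:E).
  by apply: emeasurable_funM => //; apply/measurable_EFinP; exact: measurable_prod_phi.
have mc (a : R) : measurable_fun setT (fun y : 'rV[R]_d => F (cons_rV (a, y))).
  by apply: (measurableT_comp mF); exact: measurable_cons_rV2.
rewrite ge0_integral_tuple_powerS; last 2 first.
- exact: (measurableT_comp mF (@measurable_row_of_tuple _)).
- by move=> t; exact: F0.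
rewrite ge0_integral_lebesgue_rVS//; last first.
  by move=> x; rewrite mule_ge0// lee_fin prod_phi_ge0.
have consE a (t : d.-tuple (measurableTypeR R)) :
    row_of_tuple [tuple of a :: t] = cons_rV (a, row_of_tuple t).
  apply/rowP => i; rewrite !mxE.
  by case: unliftP => [j|] ->; rewrite ?tnthS ?tnth0 ?mxE.
have mI : measurable_fun setT
    (fun a : R => \int[leb d]_x (F (cons_rV (a, x)) * (prod_phi x)%:E)).
  apply: (@measurable_integral2 _ _ _ _ _ (leb d) (fun (a : measurableTypeR R) x =>
    F (cons_rV (a, x)) * (prod_phi x)%:E)).
    apply: emeasurable_funM; first exact: (measurableT_comp mF (@measurable_cons_rV R d)).
    apply/measurable_EFinP.
    exact: (measurableT_comp (@measurable_prod_phi d) measurable_snd).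
  by move=> a x; rewrite mule_ge0// lee_fin prod_phi_ge0.
transitivity (\int[std_normal]_a
   \int[leb d]_x (F (cons_rV (a, x)) * (prod_phi x)%:E)).
  apply: eq_integral => a _; rewrite -IH//.
  by apply: eq_integral => t _; rewrite consE.
rewrite ge0_integral_std_normal//; last first.
  by move=> a; apply: integral_ge0 => x _; rewrite mule_ge0// lee_fin prod_phi_ge0.
apply: eq_integral => a _; rewrite -ge0_integralZr//.
- apply: eq_integral => x _; rewrite prod_phi_cons EFinM -muleA.
  by rewrite [(phi a)%:E * _]muleC.
- by apply: emeasurable_funM => //; apply/measurable_EFinP; exact: measurable_prod_phi.
- by move=> x _; rewrite mule_ge0// lee_fin prod_phi_ge0.
- by rewrite lee_fin phi_ge0.
Qed.

Lemma ge0_integral_gauss_rV d (F : 'rV[R]_d -> \bar R) :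
  measurable_fun setT F -> (forall x, 0 <= F x) ->
  \int[gauss_rV d]_x F x = \int[leb d]_x (F x * (prod_phi x)%:E).
Proof.
move=> mF F0; rewrite /gauss_rV ge0_integral_distribution//.
exact: ge0_integral_row_of_tuple.
Qed.

Lemma gauss_rVE d (A : set 'rV[R]_d) : measurable A ->
  gauss_rV d A = \int[leb d]_(x in A) (std_normal_vector_pdf x)%:E.
Proof.
move=> mA; rewrite -[X in gauss_rV d X]setIT -integral_indic//.
rewrite ge0_integral_gauss_rV//; last first.
  by apply/measurable_EFinP; exact: measurable_indic.
rewrite [RHS]integral_mkcond; apply: eq_integral => x _.
rewrite patchE indicE -prod_phiE.
by case: ifPn => _; rewrite ?mul1e ?mul0e.
Qed.

End gaussian.

(** * Second moments of the normal law *)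

Section second_moment.
Context {R : realType}.
Local Notation mu := (@lebesgue_measure R).
Local Open Scope ereal_scope.
Local Notation g := (@gauss_fun R).

Let dg (x : R) : is_derive x 1%R (fun t => - g t)%R (2 * x * g x)%R.
Proof.
rewrite /gauss_fun.
apply: is_derive_eq.
by rewrite /GRing.scale/=; ring.
Qed.

Let continuous_tg : continuous (fun t : R => 2 * t * g t)%R.
Proof.
move=> x; apply: cvgM; last exact: continuous_gauss_fun.
by apply: cvgM; [exact: cvg_cst|exact: cvg_id].
Qed.

Lemma integral_id_gauss_tail (x : R) : (0 <= x)%R ->
  \int[mu]_(t in `[x, +oo[) (2 * t * g t)%:E = (g x)%:E.
Proof.
move=> x0; rewrite (@ge0_continuous_FTC2y _ _ (fun t => - g t)%R _ 0%R).
- by rewrite EFinN oppeK add0e.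
- move=> t xt; rewrite !mulr_ge0// ?gauss_fun_ge0//; exact: le_trans xt.
- exact: continuous_subspaceT.
- by rewrite -oppr0; apply: cvgN; exact: cvg_gauss_fun.
- by move=> t _; exact: ex_derive.
- by apply: cvg_at_right_filter; apply: cvgN; exact: continuous_gauss_fun.
- by move=> t _; rewrite derive1E; exact: derive_val.
Qed.

(** Tonelli's theorem replaces integration by parts: [2 * t ^+ 2 * g t] is the integral of
    [2 * t * g t] over [x] in [[0, t]], and integrating over [t >= x] instead leaves [g x]. *)
Lemma integral0y_sqr_gauss :
  \int[mu]_(t in `[0%R, +oo[) (2 * t ^+ 2 * g t)%:E = (Num.sqrt pi / 2)%:E.
Proof.
rewrite -integral0y_gauss [in LHS]integral_mkcond [in RHS]integral_mkcond.
pose f (x t : R) : R := (((0 <= x) && (x <= t))%R%:R * (2 * t * g t))%R.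
have f0 x t : (0 <= f x t)%R.
  rewrite /f; case: andP => [[x0 xt]|_]; rewrite ?mul0r ?mul1r//.
  by rewrite !mulr_ge0// ?gauss_fun_ge0//; exact: le_trans xt.
have mtg : measurable_fun setT (fun t : R => 2 * t * g t)%R.
  exact: continuous_measurable_fun.
have mf : measurable_fun setT
    (fun p : measurableTypeR R * measurableTypeR R => (f p.1 p.2)%:E).
  apply/measurable_EFinP; apply: measurable_funM; last first.
    exact: (measurableT_comp mtg measurable_snd).
  rewrite (_ : (fun _ => _) = (fun p => \1_[set p : R * R | (0 <= p.1)%R &&
    (p.1 <= p.2)%R] p)); last first.
    by apply/funext => p; rewrite indicE; congr ((nat_of_bool _)%:R);
      apply/idP/idP; rewrite inE.
  apply: measurable_indic.
  rewrite -[X in measurable X]setTI.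
  apply: (@measurable_and _ _ setT (fun p : measurableTypeR R * measurableTypeR
    R => (0 <= p.1)%R) (fun p => (p.1 <= p.2)%R) _ _ measurableT [set true]) => //.
    by apply: measurable_fun_ler => //.
  by apply: measurable_fun_ler => //.
transitivity (\int[mu]_t \int[mu]_x (f x t)%:E).
  apply: eq_integral => t _; rewrite patchE mem_setE in_itv/= andbT.
  have [t0|t0] := leP 0%R t; last first.
    rewrite integral0_eq// => x _; rewrite /f; case: andP => [[x0 xt]|_].
      by have := le_lt_trans (le_trans x0 xt) t0; rewrite ltxx.
    by rewrite mul0r.
  transitivity (\int[mu]_x ((2 * t * g t)%:E * (\1_`[0%R, t] x)%:E)); last first.
    apply: eq_integral => x _; rewrite -EFinM mulrC indicE;
      congr (((nat_of_bool _)%:R * _)%:E).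
    by rewrite mem_setE in_itv.
  rewrite ge0_integralZl//.
  - rewrite integral_indic// setIT /= lebesgue_measure_itv/= lte_fin.
    have [_|t00] := ltP 0%R t.
      by rewrite oppr0 adde0 -EFinM; congr EFin; ring.
    have -> : t = 0%R by apply/eqP; rewrite eq_le t00 t0.
    by rewrite mule0 expr0n/= mulr0 mul0r.
  - by apply/measurable_EFinP; exact: measurable_indic.
  - by rewrite lee_fin !mulr_ge0// gauss_fun_ge0.
rewrite (ge0_integral_swap mu mu (f := fun t x => (f x t)%:E)); last 2 first.
- apply: (measurableT_comp mf (_ : measurable_fun setT (fun p => (p.2, p.1)))).
  exact: measurable_fun_pair.
- by move=> t x; rewrite lee_fin.
apply: eq_integral => x _; rewrite patchE mem_setE in_itv/= andbT.
have [x0|x0] := leP 0%R x; last first.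
  rewrite integral0_eq// => t _; rewrite /f; case: andP => [[+ _]|_].
    by rewrite leNgt x0.
  by rewrite mul0r.
rewrite -integral_id_gauss_tail// [RHS]integral_mkcond.
apply: eq_integral => t _; rewrite patchE mem_setE in_itv/= andbT /f x0/=.
by case: leP => _; rewrite ?mul1r ?mul0r.
Qed.

Lemma integralT_sqr_gauss : \int[mu]_t (2 * t ^+ 2 * g t)%:E = (Num.sqrt pi)%:E.
Proof.
rewrite ge0_symfun_integralT.
- rewrite (_ : [set x | _] = `[0%R, +oo[%classic); last first.
    by apply/seteqP; split => x/=; rewrite in_itv/= andbT.
  by rewrite integral0y_sqr_gauss -EFinM mulrCA divff// mulr1.
- by move=> t; apply: mulr_ge0; [rewrite mulr_ge0// sqr_ge0|exact: gauss_fun_ge0].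
- move=> x; apply: cvgM; last exact: continuous_gauss_fun.
  by apply: cvgM; [exact: cvg_cst|exact: exprn_continuous].
- by move=> t; rewrite /= /gauss_fun !sqrrN.
Qed.

Lemma std_normal_second_moment : \int[@std_normal R]_t (t ^+ 2)%:E = 1.
Proof.
have m2 : measurable_fun setT (fun t : R => (t ^+ 2)%:E).
  by apply/measurable_EFinP; exact: measurable_funX.
rewrite ge0_integral_std_normal//; last first.
  by move=> x; rewrite lee_fin sqr_ge0.
have s20 : (0 < Num.sqrt 2 :> R)%R by rewrite sqrtr_gt0.
have spi : (0 < Num.sqrt pi :> R)%R by rewrite sqrtr_gt0 pi_gt0.
(* This substitution turns the exponent of [phi] into that of [gauss_fun]. *)
rewrite (@ge0_integral_lebesgue_scale R (Num.sqrt 2)); last 3 first.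
- exact: lt0r_neq0.
- apply: emeasurable_funM => //.
  by apply/measurable_EFinP; exact: measurable_phi.
- by move=> x; rewrite mule_ge0// lee_fin ?sqr_ge0 ?phi_ge0.
rewrite (eq_integral (fun t : measurableTypeR R => (Num.sqrt (2 * pi))^-1%:E *
  (2 * t ^+ 2 * g t)%:E)); last first.
  move=> t _; rewrite phiE -!EFinM exprMn sqr_sqrtr//; congr EFin.
  rewrite [RHS]mulrCA; congr (_ * _)%R; first by rewrite mulrC.
  by congr (_ * _)%R; rewrite /gauss_fun mulNr mulfK.
rewrite ge0_integralZl//; last 2 first.
- apply/measurable_EFinP; apply: measurable_funM.
    by apply: measurable_funM => //; exact: measurable_funX.
  exact: measurable_gauss_fun.
- by move=> x _; rewrite lee_fin; apply: mulr_ge0;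
  [rewrite mulr_ge0// sqr_ge0|exact: gauss_fun_ge0].
rewrite integralT_sqr_gauss -!EFinM gtr0_norm// sqrtrM// invfM.
by congr EFin; field; rewrite (gt_eqF s20) (gt_eqF spi).
Qed.

End second_moment.

Lemma integral_probability_cst dT (T : measurableType dT) (R : realType)
    (P : probability T R) (c : R) : (\int[P]_x c%:E = c%:E)%E.
Proof.
by rewrite integral_cst// -[RHS]mule1; congr (_ * _)%E; exact: probability_setT.
Qed.

Section gaussian_moments.
Context {R : realType}.
Local Notation mu := (@lebesgue_measure R).
Local Notation nu := (@std_normal R).
Local Open Scope ereal_scope.

Let measurable_opp : measurable_fun setT (fun x : R => - x)%R.
Proof. exact: (measurable_funN (@measurable_id _ _ setT)). Qed.

Lemma ge0_integral_std_normalN (F : R -> \bar R) :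
  measurable_fun setT F -> (forall x, 0 <= F x) ->
  \int[nu]_x F (- x)%R = \int[nu]_x F x.
Proof.
move=> mF F0.
have mFN : measurable_fun setT (fun x : R => F (- x)%R).
  exact: (measurableT_comp mF measurable_opp).
rewrite !ge0_integral_std_normal//.
have mphi : measurable_fun setT (fun x : R => F x * (phi x)%:E).
  by apply: emeasurable_funM => //; apply/measurable_EFinP; exact: measurable_phi.
rewrite [RHS](@ge0_integral_lebesgue_scale R (-1)%R _ _ mphi); last 2 first.
- by rewrite oppr_eq0 oner_eq0.
- by move=> x; rewrite mule_ge0// lee_fin phi_ge0.
rewrite normrN1 mul1e; apply: eq_integral => x _.
by rewrite mulrN1 phiN.
Qed.

(** Adding the integrals of [F x] and [F (- x)] cancels the cross term, so only the second moment
    enters and no signed integral occurs. *)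
Lemma std_normal_affine_sqr (a b : R) :
  \int[nu]_x ((a + b * x) ^+ 2)%:E = (a ^+ 2 + b ^+ 2)%:E.
Proof.
pose F (x : R) : R := ((a + b * x) ^+ 2)%R.
have mF : measurable_fun setT (fun x => (F x)%:E).
  apply/measurable_EFinP; apply: measurable_funX.
  by apply: measurable_funD => //; exact: measurable_funM.
have F0 x : 0 <= (F x)%:E by rewrite lee_fin sqr_ge0.
have msqr : measurable_fun setT (fun x : R => (x ^+ 2)%:E).
  by apply/measurable_EFinP; exact: measurable_funX.
pose I := \int[nu]_x (F x)%:E.
have II : I + I = (2 * (a ^+ 2 + b ^+ 2))%:E.
  rewrite {2}/I -ge0_integral_std_normalN// -ge0_integralD//; last first.
    exact: (measurableT_comp mF measurable_opp).
  rewrite (eq_integral (fun x : measurableTypeR R =>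
    (2 * a ^+ 2)%:E + (2 * b ^+ 2)%:E * (x ^+ 2)%:E)); last first.
    by move=> x _; rewrite /F -!EFinM -!EFinD; congr EFin; ring.
  rewrite ge0_integralD//; last 3 first.
  - by move=> x _; rewrite lee_fin mulr_ge0// sqr_ge0.
  - by move=> x _; apply: mule_ge0; rewrite lee_fin ?sqr_ge0// mulr_ge0// sqr_ge0.
  - exact: emeasurable_funM.
  rewrite integral_probability_cst ge0_integralZl//; last 2 first.
  - by move=> x _; rewrite lee_fin sqr_ge0.
  - by rewrite lee_fin mulr_ge0// sqr_ge0.
  by rewrite std_normal_second_moment mule1 -EFinD mulrDr.
rewrite -/I; case: I II => [r| |]//; rewrite -EFinD => -[rr].
by congr EFin; lra.
Qed.

Lemma ge0_integral_gauss_rVS d (F : 'rV[R]_d.+1 -> \bar R) :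
  measurable_fun setT F -> (forall x, 0 <= F x) ->
  \int[gauss_rV d.+1]_x F x = \int[nu]_a \int[gauss_rV d]_x F (cons_rV (a, x)).
Proof.
move=> mF F0; rewrite ge0_integral_gauss_rV//.
have mFphi : measurable_fun setT (fun x => F x * (prod_phi x)%:E).
  by apply: emeasurable_funM => //; apply/measurable_EFinP; exact: measurable_prod_phi.
have mc (a : R) : measurable_fun setT (fun y : 'rV[R]_d => F (cons_rV (a, y))).
  by apply: (measurableT_comp mF); exact: measurable_cons_rV2.
rewrite ge0_integral_lebesgue_rVS//; last first.
  by move=> x; rewrite mule_ge0// lee_fin prod_phi_ge0.
rewrite ge0_integral_std_normal//; last 2 first.
- apply: (@measurable_integral2 _ _ _ _ _ (gauss_rV d)
    (fun (a : measurableTypeR R) x => F (cons_rV (a, x)))) => //.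
  exact: (measurableT_comp mF (@measurable_cons_rV R d)).
- by move=> a; apply: integral_ge0.
apply: eq_integral => a _; rewrite ge0_integral_gauss_rV// -ge0_integralZr//.
- apply: eq_integral => x _; rewrite prod_phi_cons EFinM -muleA.
  by rewrite [(phi a)%:E * _]muleC.
- by apply: emeasurable_funM => //; apply/measurable_EFinP; exact: measurable_prod_phi.
- by move=> x _; rewrite mule_ge0// lee_fin prod_phi_ge0.
- by rewrite lee_fin phi_ge0.
Qed.

Lemma gauss_rV_affine_sqr d (a : R) (b : 'rV[R]_d) :
  \int[gauss_rV d]_x ((a + dotp x b) ^+ 2)%:E = (a ^+ 2 + dotp b b)%:E.
Proof.
have mF k (c : R) (w : 'rV[R]_k) : measurable_fun setT
    (fun x : 'rV[R]_k => ((c + dotp x w) ^+ 2)%:E).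
  apply/measurable_EFinP; apply: measurable_funX; apply: measurable_funD => //.
  exact: measurable_dotp.
elim: d a b => [|d IH] a b.
  have b0 (x : 'rV[R]_0) : dotp x b = 0%R by rewrite /dotp big_ord0.
  rewrite (eq_integral (cst (a ^+ 2)%:E)); last by move=> x _; rewrite b0 addr0.
  by rewrite integral_probability_cst b0 addr0.
rewrite ge0_integral_gauss_rVS//; last by move=> x; rewrite lee_fin sqr_ge0.
pose b1 := b 0%R ord0; pose b' := (\row_j b 0%R (lift ord0 j))%R.
have bE : b = cons_rV (b1, b').
  apply/rowP => i; rewrite mxE; case: unliftP => [j|] -> //=.
  by rewrite mxE.
rewrite (eq_integral (fun x : measurableTypeR R =>
    ((a + b1 * x) ^+ 2)%:E + (dotp b' b')%:E)); last first.
  move=> x _; rewrite -EFinD -IH; apply: eq_integral => y _.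
  by rewrite {1}bE dotp_cons addrA [(x * _)%R]mulrC.
rewrite ge0_integralD//; last 3 first.
- by move=> x _; rewrite lee_fin sqr_ge0.
- apply/measurable_EFinP; apply: measurable_funX; apply: measurable_funD => //.
- by move=> x _; rewrite lee_fin; apply: sumr_ge0 => i _; rewrite -expr2 sqr_ge0.
rewrite std_normal_affine_sqr integral_probability_cst.
have -> : dotp b b = (b1 * b1 + dotp b' b')%R by rewrite {1 2}bE dotp_cons.
by rewrite -EFinD -addrA -expr2.
Qed.

(** The second moment matrix of [hom x] is the identity, the constant coordinate included; this
    drives the determinant computation. *)
Lemma gauss_rV_hom_sqr d (c : 'rV[R]_d.+1) :
  \int[gauss_rV d]_x ((dotp (hom x) c) ^+ 2)%:E = (dotp c c)%:E.
Proof.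
pose b := (\row_j c 0%R (lift ord0 j))%R.
have cE : c = cons_rV (c 0%R ord0, b).
  apply/rowP => i; rewrite mxE; case: unliftP => [j|] -> //=.
  by rewrite mxE.
have -> : dotp c c = (c 0 ord0 ^+ 2 + dotp b b)%R.
  by rewrite {1 2}cE dotp_cons -expr2.
rewrite -gauss_rV_affine_sqr.
by apply: eq_integral => x _; rewrite {1}cE dotp_hom.
Qed.

End gaussian_moments.

(** * The expected squared determinant of homogenised Gaussian points *)

Section gaussian_determinant.
Context {R : realType} (d : nat).
Local Notation N := d.+1.
Local Open Scope ereal_scope.

(** Rows come from a sequence so that fixed rows and random rows can be concatenated. *)
Definition det_rows (s : seq 'rV[R]_N) : R :=
  (\det (\matrix_(i < N) nth 0 s i))%R.

Let e (j : 'I_N) : 'rV[R]_N := delta_mx 0%R j.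

(** Expansion along the row at position [size pre], whose cofactors do not involve [x]. *)
Lemma det_rows_linear (pre post : seq 'rV[R]_N) x :
  (size pre + (size post).+1 = N)%N ->
  det_rows (pre ++ x :: post) =
  dotp x (\row_j det_rows (pre ++ e j :: post))%R.
Proof.
move=> sN; have pN : (size pre < N)%N by have := leq_addr (size post) (size
  pre).+1; rewrite addSnnS sN.
pose i0 := Ordinal pN.
pose A y := (\matrix_(i < N) nth 0 (pre ++ y :: post) i)%R : 'M[R]_N.
have rowA y : row i0 (A y) = y by rewrite rowK nth_cat ltnn subnn.
have row'A y z : row' i0 (A y) = row' i0 (A z).
  apply/row_matrixP => i; rewrite !row_rowsub !rowK !nth_cat.
  case: ltnP => // h; have : (size pre < lift i0 i)%N.
    by rewrite ltn_neqAle h andbT -[size pre]/(val i0) (inj_eq val_inj) neq_lift.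
  by rewrite -subn_gt0; case: (_ - _)%N.
have cofA y j : cofactor (A y) i0 j = cofactor (A 0%R) i0 j.
  rewrite /cofactor; congr (_ * \det _)%R; apply/matrixP => i k.
  by have /matrixP/(_ i (lift j k)) := row'A y 0%R; rewrite !mxE.
have detA y : det_rows (pre ++ y :: post) =
    (\sum_j y 0 j * cofactor (A 0) i0 j)%R.
  rewrite /det_rows (expand_det_row _ i0); apply: eq_bigr => j _.
  by rewrite cofA; congr (_ * _)%R; rewrite -[in RHS](rowA y) !mxE.
rewrite detA; apply: eq_bigr => j _; congr (_ * _)%R.
rewrite mxE detA (bigD1 j)//= big1 => [|k kj]; rewrite mxE ?eqxx.
  by rewrite mul1r addr0.
by rewrite (negbTE kj) mul0r.
Qed.

Local Notation pow := (tuple_power (gauss_rV d : probability 'rV[R]_d R)).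

Lemma measurable_det dT (T : measurableType dT) k (A : T -> 'M[R]_k) :
  (forall i j, measurable_fun setT (fun t => A t i j)) ->
  measurable_fun setT (fun t => \det (A t))%R.
Proof.
move=> mA; apply: measurable_sum => s; apply: measurable_funM => //.
by apply: measurable_prod => i _; exact: mA.
Qed.

Let measurable_det_rows k (pre : seq 'rV[R]_N) :
  measurable_fun setT (fun t : k.-tuple 'rV[R]_d =>
    det_rows (pre ++ map (@hom R d) t)).
Proof.
apply: measurable_det => i j; under eq_fun do rewrite mxE nth_cat.
case: ltnP => ip; first exact: measurable_cst.
have [ik|ik] := ltnP (i - size pre) k; last first.
  under eq_fun do rewrite nth_default ?size_map ?size_tuple//.
  exact: measurable_cst.
pose i' := Ordinal ik.
under eq_fun => t.
  rewrite (nth_map 0%R) ?size_tuple// -[(i - size pre)%N]/(val i') -tnth_nth.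
  over.
apply: measurable_rV_coord; apply: measurable_hom.
exact: measurable_tnth.
Qed.

(** The determinant is linear in each row, so by [gauss_rV_hom_sqr] averaging its square over a
    random row amounts to summing it over the basis vectors in place of that row. [pre] holds the
    rows already fixed. *)
Lemma integral_sqr_det_rows k (pre : seq 'rV[R]_N) : (size pre + k = N)%N ->
  \int[pow k]_t ((det_rows (pre ++ map (@hom R d) t)) ^+ 2)%:E =
  (\sum_(s : k.-tuple 'I_N) det_rows (pre ++ map e s) ^+ 2)%:E.
Proof.
have mdet2 l (p : seq 'rV[R]_N) : measurable_fun setT
    (fun t : l.-tuple 'rV[R]_d => (det_rows (p ++ map (@hom R d) t) ^+ 2)%:E).
  by apply/measurable_EFinP; apply: measurable_funX; exact: measurable_det_rows.
elim: k pre => [|k IH] pre pN.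
  rewrite ge0_integral_tuple_power0//=.
  congr EFin; rewrite (bigD1 [tuple])//= big1 ?addr0// => s.
  by rewrite (tuple0 s).
rewrite ge0_integral_tuple_powerS//; last by move=> t; rewrite lee_fin sqr_ge0.
transitivity (\int[gauss_rV d]_x (\sum_(s : k.-tuple 'I_N)
    ((dotp (hom x) (\row_j det_rows (pre ++ e j :: map e s))%R) ^+ 2)%:E)).
  apply: eq_integral => x _.
  transitivity (\int[pow k]_t
      ((det_rows (rcons pre (hom x) ++ map (@hom R d) t)) ^+ 2)%:E).
    by apply: eq_integral => t _; rewrite cat_rcons.
  rewrite IH ?size_rcons ?addSnnS// sumEFin; congr EFin.
  apply: eq_bigr => s _; rewrite cat_rcons det_rows_linear//.
  by rewrite size_map size_tuple.
rewrite ge0_integral_sum//; last 2 first.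
- move=> s; apply/measurable_EFinP; apply: measurable_funX.
  by apply: measurable_dotp => //; exact: measurable_homT.
- by move=> s x _; rewrite lee_fin sqr_ge0.
under eq_bigr do rewrite gauss_rV_hom_sqr.
rewrite sumEFin; congr EFin.
rewrite (reindex (fun p : 'I_N * k.-tuple 'I_N => [tuple of p.1 :: p.2]))/=.
  rewrite -(pair_bigA _ (fun j (s : k.-tuple 'I_N) => det_rows (pre ++ e j ::
    map e s) ^+ 2))%R/=.
  rewrite exchange_big/=; apply: eq_bigr => s _.
  by rewrite /dotp; apply: eq_bigr => j _; rewrite mxE -expr2.
exists (fun s : k.+1.-tuple 'I_N => (thead s, [tuple of behead s])).
  by move=> [j s] _ /=; congr pair; exact: val_inj.
by move=> s _; rewrite -tuple_eta.
Qed.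

(** Distinct indices give a permutation matrix, of determinant 1 or -1, and a repeated index gives
    0; so the sum counts permutations. *)
Lemma sum_sqr_det_delta :
  (\sum_(s : N.-tuple 'I_N) det_rows (map e s) ^+ 2)%R = (N`!%:R)%R :> R.
Proof.
have detE (s : N.-tuple 'I_N) : (det_rows (map e s) ^+ 2 = (uniq s)%:R)%R.
  have rowE (i : 'I_N) : nth 0%R (map e s) i = e (tnth s i).
    by rewrite (nth_map ord0) ?size_tuple// -tnth_nth.
  have [us|us] := boolP (uniq s); last first.
    have [i [j [ij sij]]] : exists i j : 'I_N, i != j /\ tnth s i = tnth s j.
      move: us => /(uniqPn ord0)[i [j [ij js sij]]].
      rewrite size_tuple in js; have iN := ltn_trans ij js.
      exists (Ordinal iN), (Ordinal js); split; first by rewrite -val_eqE/= ltn_eqF.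
      by rewrite !(tnth_nth ord0).
    rewrite /det_rows (determinant_alternate ij) ?expr0n// => k.
    by rewrite !mxE !rowE sij.
  have si : injective (tnth s) by exact/tuple_uniqP.
  rewrite /det_rows (_ : (\matrix_(i < N) _)%R = perm_mx (perm si)).
    by rewrite det_perm sqrr_sign.
  by apply/matrixP => i j; rewrite !mxE rowE mxE eqxx permE eq_sym.
under eq_bigr do rewrite detE.
rewrite -natr_sum; congr (_%:R)%R.
have := card_uniq_tuples N (predT : pred 'I_N).
rewrite card_ord ffactnn => <-; rewrite -big_mkcond sum1_card.
by apply: eq_card => s; rewrite !inE all_predT.
Qed.

Lemma gauss_rV_sqr_det :
  \int[pow N]_t ((\det (\matrix_(i < N) hom (tnth t i))) ^+ 2)%:E = (N`!%:R)%:E.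
Proof.
rewrite -sum_sqr_det_delta -(integral_sqr_det_rows (pre := [::]))//.
apply: eq_integral => t _; congr ((\det _ ^+ 2)%:E).
apply/matrixP => i j.
by rewrite [LHS]mxE [RHS]mxE (nth_map 0%R) ?size_tuple// -tnth_nth.
Qed.

End gaussian_determinant.

Section dotp_algebra.
Context {R : realFieldType} {d : nat}.
Implicit Types u v w : 'rV[R]_d.

Lemma dotpC u v : dotp u v = dotp v u.
Proof. by apply: eq_bigr => j _; rewrite mulrC. Qed.

Lemma dotpDl u v w : dotp (u + v) w = dotp u w + dotp v w.
Proof.
by rewrite /dotp -big_split; apply: eq_bigr => j _; rewrite mxE mulrDl.
Qed.

Lemma dotpZl (a : R) u w : dotp (a *: u) w = a * dotp u w.
Proof. by rewrite /dotp mulr_sumr; apply: eq_bigr => j _; rewrite mxE mulrA. Qed.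

Lemma dotp_ge0 u : 0 <= dotp u u.
Proof. by apply: sumr_ge0 => j _; rewrite -expr2 sqr_ge0. Qed.

Lemma mulmx_rank1 u v w : u *m (v^T *m w) = dotp u v *: w.
Proof.
rewrite mulmxA (mx11_scalar (u *m v^T)) mul_scalar_mx; congr (_ *: _).
by rewrite mxE; apply: eq_bigr => j _; rewrite mxE.
Qed.

(** One block matrix has two triangular factorisations, eliminating from either corner; comparing
    their determinants gives the formula. *)
Lemma det_rank1 (k : R) u v : \det (1%:M - k *: (u^T *m v)) = 1 - k * dotp v u.
Proof.
pose L : 'M[R]_(1 + d) := block_mx 1%:M 0 (k *: u^T) 1%:M.
pose U : 'M[R]_(1 + d) := block_mx 1%:M v 0 (1%:M - k *: (u^T *m v)).
have LU : L *m U = block_mx 1%:M v (k *: u^T) 1%:M.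
  rewrite mulmx_block ?mul1mx ?mul0mx ?mulmx1 ?mulmx0 ?addr0.
  by rewrite -scalemxAl addrC subrK.
pose L' : 'M[R]_(1 + d) := block_mx 1%:M v 0 1%:M.
pose U' : 'M[R]_(1 + d) := block_mx (1 - k * dotp v u)%:M 0 (k *: u^T) 1%:M.
have LU' : L' *m U' = block_mx 1%:M v (k *: u^T) 1%:M.
  rewrite mulmx_block ?mul1mx ?mul0mx ?mulmx1 ?mulmx0 ?add0r; congr block_mx.
  rewrite -scalemxAr (mx11_scalar (v *m u^T)) scale_scalar_mx -raddfD/=.
  congr (_%:M); rewrite mxE -[RHS](subrK (k * dotp v u)); congr (_ + k * _).
  by apply: eq_bigr => j _; rewrite mxE.
have := congr1 determinant (etrans LU (esym LU')).
rewrite !det_mulmx /L /U /L' /U' !det_lblock !det_ublock !det1 !mul1r mulr1.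
by rewrite det_scalar1.
Qed.

End dotp_algebra.

(** * Completing the square in a Gaussian vector *)

Section complete_square.
Context {R : realType} {d : nat}.
Implicit Types (a : R) (b u x : 'rV[R]_d).

Definition hnorm b : R := Num.sqrt (1 + dotp b b).

Lemma hnorm_gt0 b : 0 < hnorm b.
Proof. by rewrite sqrtr_gt0 ltr_pwDl// dotp_ge0. Qed.

Lemma hnorm_sqr b : hnorm b ^+ 2 = 1 + dotp b b.
Proof. by rewrite sqr_sqrtr// addr_ge0// dotp_ge0. Qed.

(* The square root of the inverse of [I + b^T b]. *)
Definition square_mx b : 'M[R]_d :=
  1%:M - (hnorm b * (hnorm b + 1))^-1 *: (b^T *m b).

(** The minimiser of the quadratic function [(a + dotp x b) ^+ 2 + dotp x x] of [x], whose quadratic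
    part has matrix I + b^T b. *)
Definition square_shift a b : 'rV[R]_d := - (a / hnorm b ^+ 2) *: b.

Definition square_map a b u : 'rV[R]_d := u *m square_mx b + square_shift a b.

Lemma det_square_mx b : \det (square_mx b) = (hnorm b)^-1.
Proof.
rewrite det_rank1; have s0 := hnorm_gt0 b.
have -> : dotp b b = hnorm b ^+ 2 - 1 by rewrite hnorm_sqr; ring.
have s1 : hnorm b + 1 != 0 by rewrite gt_eqF// addr_gt0.
by field; rewrite gt_eqF.
Qed.

Lemma square_mapE a b u : square_map a b u =
  u + (- (dotp u b / (hnorm b * (hnorm b + 1)) + a / hnorm b ^+ 2)) *: b.
Proof.
rewrite /square_map /square_mx mulmxBr mulmx1 -scalemxAr mulmx_rank1 scalerA.
rewrite /square_shift -addrA -scaleNr -scalerDl; congr (_ + _ *: _).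
by rewrite opprD mulrC.
Qed.

Lemma square_map_quadratic a b u :
  (a + dotp (square_map a b u) b) ^+ 2 +
    dotp (square_map a b u) (square_map a b u) =
  (a / hnorm b) ^+ 2 + dotp u u.
Proof.
have s0 := hnorm_gt0 b.
rewrite square_mapE; set k := - (_ + _).
rewrite !dotpDl !dotpZl (dotpC _ (_ + _)) (dotpC b (_ + _)) !dotpDl !dotpZl.
rewrite (dotpC b u) /k.
have -> : dotp b b = hnorm b ^+ 2 - 1 by rewrite hnorm_sqr; ring.
have s1 : hnorm b + 1 != 0 by rewrite gt_eqF// addr_gt0.
by field; rewrite s1 gt_eqF.
Qed.

Lemma prod_phi_dotp x :
  prod_phi x = (Num.sqrt (2 * pi)) ^- d * expR (- dotp x x / 2).
Proof. by rewrite prod_phiE. Qed.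

Lemma phi_square_map a b u :
  phi (a + dotp (square_map a b u) b) * prod_phi (square_map a b u) =
  phi (a / hnorm b) * prod_phi u.
Proof.
rewrite !prod_phi_dotp !phiE mulrACA [RHS]mulrACA; congr (_ * _).
rewrite -!expRD; congr expR; rewrite -!mulrDl -!opprD.
by rewrite square_map_quadratic.
Qed.

Lemma measurable_dotpl dT (T : measurableType dT) (f : T -> 'rV[R]_d) b :
  measurable_fun setT f -> measurable_fun setT (fun t => dotp (f t) b).
Proof. by move=> mf; exact: measurable_dotp. Qed.

Lemma measurable_square_map a b : measurable_fun setT (square_map a b).
Proof. by apply: measurable_rVD => //; exact: measurable_mulmxr. Qed.

Local Notation mu := (@lebesgue_measure R).
Local Notation leb := (lebesgue_rV R d).
Local Notation nu := (@std_normal R).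
Local Open Scope ereal_scope.

(** The affine map [square_map a b] carries the exponent to its minimum plus a standard Gaussian:
    [phi (a / hnorm b)] is the contribution of the minimum and [1 / hnorm b] the Jacobian. *)
Lemma gauss_rV_complete_square a b (F : 'rV[R]_d -> \bar R) :
  measurable_fun setT F -> (forall x, 0 <= F x) ->
  \int[gauss_rV d]_x (F x * (phi (a + dotp x b))%:E) =
  (phi (a / hnorm b) / hnorm b)%:E * \int[gauss_rV d]_u F (square_map a b u).
Proof.
move=> mF F0; have s0 := hnorm_gt0 b.
have mphi : measurable_fun setT (fun x : 'rV[R]_d => (phi (a + dotp x b))%:E).
  apply/measurable_EFinP; apply: (measurableT_comp measurable_phi).
  by apply: measurable_funD => //; exact: measurable_dotpl.
have mpp : measurable_fun setT (fun x : 'rV[R]_d => (prod_phi x)%:E).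
  by apply/measurable_EFinP; exact: measurable_prod_phi.
have mFs : measurable_fun setT (fun u => F (square_map a b u)).
  exact: (measurableT_comp mF (measurable_square_map _ _)).
rewrite ge0_integral_gauss_rV//; last 2 first.
- exact: emeasurable_funM.
- by move=> x; rewrite mule_ge0// lee_fin phi_ge0.
rewrite -(ge0_integral_lebesgue_rV_shift (square_shift a b)); last 2 first.
- by apply: emeasurable_funM => //; exact: emeasurable_funM.
- by move=> x; rewrite !mule_ge0// lee_fin ?phi_ge0 ?prod_phi_ge0.
have uA : square_mx b \in unitmx.
  by rewrite unitmxE det_square_mx unitfE invr_eq0 gt_eqF.
rewrite (ge0_integral_lebesgue_rV_linear uA); last 2 first.
- pose G (x : 'rV[R]_d) := F x * (phi (a + dotp x b))%:E * (prod_phi x)%:E.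
  apply: (measurableT_comp (_ : measurable_fun setT G)).
    by apply: emeasurable_funM => //; exact: emeasurable_funM.
  exact: measurable_rVD.
- by move=> x; rewrite !mule_ge0// lee_fin ?phi_ge0 ?prod_phi_ge0.
rewrite det_square_mx gtr0_norm ?invr_gt0//.
rewrite [in RHS]ge0_integral_gauss_rV// EFinM [in RHS]muleC [in RHS]muleA.
rewrite [RHS]muleC; congr (_ * _).
rewrite muleC -ge0_integralZl//; last 3 first.
- exact: emeasurable_funM.
- by move=> x _; rewrite mule_ge0// lee_fin prod_phi_ge0.
- by rewrite lee_fin phi_ge0.
apply: eq_integral => u _; rewrite -/(square_map a b u) -muleA -EFinM.
by rewrite phi_square_map EFinM muleCA.
Qed.

Lemma gauss_rV_phi_affine a b :
  \int[gauss_rV d]_x (phi (a + dotp x b))%:E = (phi (a / hnorm b) / hnorm b)%:E.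
Proof.
have := @gauss_rV_complete_square a b (cst 1) (measurable_cst _) (fun=> lee01).
rewrite (integral_probability_cst (gauss_rV d) 1) mule1 => <-.
by apply: eq_integral => x _; rewrite mul1e.
Qed.

(** After a shift of the height, the density of [z - dotp x b] at [w] is the Gaussian mean of
    [phi (w + dotp x b)], which is the case [F = 1] of completing the square. *)
Lemma gauss_affine_law b (G : R -> \bar R) :
  measurable_fun setT G -> (forall t, 0 <= G t) ->
  \int[gauss_rV d]_x \int[nu]_z G (z - dotp x b)%R =
  \int[nu]_t G (t * hnorm b)%R.
Proof.
move=> mG G0; have s0 := hnorm_gt0 b.
have mphi : measurable_fun setT (fun t : R => (phi t)%:E).
  by apply/measurable_EFinP; exact: measurable_phi.
transitivity (\int[gauss_rV d]_x \int[mu]_w (G w * (phi (w + dotp x b))%:E)).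
  apply: eq_integral => x _.
  have mGx : measurable_fun setT (fun z : R => G (z - dotp x b)%R).
    by apply: (measurableT_comp mG); exact: measurable_funB.
  rewrite (ge0_integral_std_normal mGx (fun z => G0 (z - dotp x b)%R)).
  rewrite -(@ge0_integral_lebesgue_shift R (dotp x b)).
  - by apply: eq_integral => w _; rewrite addrK.
  - exact: emeasurable_funM.
  - by move=> z; rewrite mule_ge0// lee_fin phi_ge0.
have m2 : measurable_fun setT (fun p : 'rV[R]_d * measurableTypeR R =>
    G p.2 * (phi (p.2 + dotp p.1 b))%:E).
  apply: emeasurable_funM; first exact: (measurableT_comp mG measurable_snd).
  apply: (measurableT_comp mphi); apply: measurable_funD => //.
  exact: measurable_dotpl.
rewrite (ge0_integral_swap (gauss_rV d) mu
  (f := fun x w => G w * (phi (w + dotp x b))%:E))//; last first.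
  by move=> x w; rewrite mule_ge0// lee_fin phi_ge0.
have sE w : \int[gauss_rV d]_x (G w * (phi (w + dotp x b))%:E) =
    G w * (phi (w / hnorm b) / hnorm b)%:E.
  rewrite ge0_integralZl//.
  - by rewrite gauss_rV_phi_affine.
  - apply: (measurableT_comp mphi); apply: measurable_funD => //.
    exact: measurable_dotpl.
  - by move=> x _; rewrite lee_fin phi_ge0.
under eq_integral do rewrite sE.
have mphis : measurable_fun setT (fun w : R => (phi (w / hnorm b) / hnorm b)%:E).
  apply/measurable_EFinP; apply: measurable_funM => //.
  by apply: (measurableT_comp measurable_phi); exact: measurable_funM.
rewrite (ge0_integral_lebesgue_scale (lt0r_neq0 s0)); last 2 first.
- exact: emeasurable_funM.
- by move=> w; rewrite mule_ge0// lee_fin mulr_ge0 ?phi_ge0// invr_ge0 ltW.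
have mGs : measurable_fun setT (fun t : R => G (t * hnorm b)%R).
  by apply: (measurableT_comp mG); exact: measurable_funM.
rewrite gtr0_norm// ge0_integral_std_normal// -ge0_integralZl//; last 3 first.
- apply: emeasurable_funM => //; apply/measurable_EFinP.
  apply: measurable_funM => //; apply: (measurableT_comp measurable_phi).
  by apply: measurable_funM => //; exact: measurable_funM.
- by move=> w _; rewrite mule_ge0// lee_fin mulr_ge0 ?phi_ge0// invr_ge0 ltW.
- by rewrite lee_fin ltW.
apply: eq_integral => w _; rewrite mulfK ?gt_eqF// muleCA -EFinM.
by rewrite mulrCA divff ?mulr1// gt_eqF.
Qed.

End complete_square.

Section std_normal_cdf.
Context {R : realType}.
Local Notation nu := (@std_normal R).
Local Open Scope ereal_scope.

Lemma std_normal_cdf (t : R) : nu `]-oo, t]%classic = (Phi t)%:E.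
Proof.
rewrite /Phi /Rintegral fineK// -[X in X \is a fin_num]/(nu `]-oo, t]%classic).
exact: fin_num_measure.
Qed.

Lemma std_normal_cdf_open (t : R) : nu `]-oo, t[%classic = (Phi t)%:E.
Proof.
rewrite -std_normal_cdf; apply: (@integral_itv_bndo_bndc R -oo%O t
  (fun x => (normal_pdf 0 1 x)%:E)).
by apply: measurable_funTS; apply/measurable_EFinP; exact: measurable_normal_pdf.
Qed.

Lemma PhiN (t : R) : Phi (- t) = (1 - Phi t)%R.
Proof.
have -> : Phi t = fine (nu `]-oo, t[%classic) by rewrite std_normal_cdf_open.
have -> : Phi (- t) = fine (nu `]-oo, (- t)%R]%classic) by rewrite std_normal_cdf.
have -> : nu `]-oo, (- t)%R]%classic = nu (~` `]-oo, t[%classic).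
  have mc : measurable (~` `]-oo, t[%classic : set R) by exact: measurableC.
  have := @ge0_integral_std_normalN R (fun x => (\1_(~` `]-oo, t[%classic) x)%:E).
  move=> /(_ _ _)/esym; rewrite integral_indic// setIT => ->.
  - rewrite (eq_integral (fun x : measurableTypeR R => (\1_(`]-oo, (-
    t)%R]%classic : set R) x)%:E)).
      by rewrite integral_indic// setIT.
    move=> x _; rewrite !indicE; congr (((nat_of_bool _)%:R)%:E).
    by apply/idP/idP; rewrite !inE/= !in_itv/=; [move/negP|move=> h; apply/negP];
      rewrite -leNgt lerNr.
  - by apply/measurable_EFinP; exact: measurable_indic.
  - by move=> x; rewrite lee_fin.
rewrite probability_setC// fineB//.
exact: fin_num_measure.
Qed.

(** Endpoints carry no mass. Both open and closed intervals are needed, for the strict and the weak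
    facet rule. *)
Lemma std_normal_itv (b0 b1 : bool) (t : R) : (0 <= t)%R ->
  nu [set` Interval (BSide b0 (- t)%R) (BSide b1 t)] = (2 * Phi t - 1)%:E.
Proof.
move=> t0.
have H : nu `[(- t)%R, t]%classic = (2 * Phi t - 1)%:E.
  have : nu `]-oo, t]%classic = nu `]-oo, (- t)%R[%classic + nu `[(- t)%R, t]%classic.
    rewrite -measureU//.
      by rewrite -itv_bndbnd_setU// bnd_simp; lra.
    by apply/seteqP; split => x //=; rewrite !in_itv/= => -[xt /andP[]]; lra.
  rewrite std_normal_cdf std_normal_cdf_open PhiN.
  have : nu `[(- t)%R, t]%classic \is a fin_num by exact: fin_num_measure.
  case: (nu _) => [r| |]// _; rewrite -EFinD => -[rE].
  by congr EFin; lra.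
have mpdf : measurable_fun `](- t)%R, t[%classic (fun x : R => (normal_pdf 0 1 x)%:E).
  by apply: measurable_funTS; apply/measurable_EFinP; exact: measurable_normal_pdf.
rewrite -H; transitivity (nu `](- t)%R, t[%classic).
  exact: integral_itv_bndoo.
by apply/esym; exact: integral_itv_bndoo.
Qed.

End std_normal_cdf.

(** * The volume of a simplex *)

Section measurable_bool.
Context {R : realType} {dT} {T : measurableType dT}.

Lemma measurable_bool_natr (b : T -> bool) : measurable [set t | b t] ->
  measurable_fun setT (fun t => (b t)%:R : R).
Proof.
move=> mb; rewrite (_ : (fun _ => _) = \1_[set t | b t]).
  exact: measurable_indic.
by apply/funext => t; rewrite indicE; congr ((nat_of_bool _)%:R);
  apply/idP/idP; rewrite inE.
Qed.

Lemma measurable_inv (f : T -> R) : measurable_fun setT f ->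
  measurable_fun setT (fun t => (f t)^-1).
Proof.
move=> mf; rewrite (_ : (fun _ => _) = (fun t => f t * (f t ^+ 2) `^ (-1))).
  apply: measurable_funM => //.
  apply: (measurableT_comp (@measurable_powR R (-1))).
  exact: measurable_funX.
apply/funext => t; rewrite powR_inv1 ?sqr_ge0//.
have [->|f0] := eqVneq (f t) 0; first by rewrite invr0 mul0r.
by rewrite expr2 invfM mulrA divff// mul1r.
Qed.

Lemma measurable_invmx n (A : T -> 'M[R]_n) :
  (forall i j, measurable_fun setT (fun t => A t i j)) ->
  forall i j, measurable_fun setT (fun t => invmx (A t) i j).
Proof.
move=> mA i j.
have mdet : measurable_fun setT (fun t => \det (A t)) by exact: measurable_det.
(* On singular matrices [invmx] returns its argument, whence the second summand. *)
rewrite (_ : (fun _ => _) = (fun t => (\det (A t) != 0)%:R *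
   ((\det (A t))^-1 * cofactor (A t) j i) + (\det (A t) == 0)%:R * A t i j)).
  have mz : measurable [set t | \det (A t) == 0].
    rewrite [X in measurable X](_ : _ = [set t | \det (A t) = 0]).
      exact: measurable_eq0.
    by apply/seteqP; split => t /= /eqP.
  apply: measurable_funD; apply: measurable_funM => //.
  - apply: measurable_bool_natr.
    rewrite [X in measurable X](_ : _ = ~` [set t | \det (A t) == 0]).
      exact: measurableC.
    by apply/seteqP; split => t /= /negP.
  - apply: measurable_funM; first exact: measurable_inv.
    apply: measurable_funM => //; apply: measurable_det => k l.
    by under eq_fun do rewrite !mxE; exact: mA.
  - exact: measurable_bool_natr.
apply/funext => t; rewrite /invmx unitmxE unitfE.
by case: eqP => _; rewrite ?mxE !(mul0r, mul1r, add0r, addr0)// mxE.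
Qed.

End measurable_bool.

Section simplex_volume.
Context {R : realType}.
Local Notation mu := (@lebesgue_measure R).
Local Notation leb d := (lebesgue_rV R d).

Definition std_simplex d (t : R) (x : 'rV[R]_d) : bool :=
  [forall i, 0 <= x 0 i] && (\sum_i x 0 i <= t).

Lemma measurable_std_simplex d dT (T : measurableType dT) (f : T -> 'rV[R]_d)
    (g : T -> R) : measurable_fun setT f -> measurable_fun setT g ->
  measurable_fun setT (fun t => (std_simplex (g t) (f t))%:R : R).
Proof.
move=> mf mg; apply: measurable_bool_natr.
rewrite [X in measurable X](_ : _ = [set t | forall i, 0 <= f t 0 i] `&`
    [set t | 0 <= g t - \sum_i f t 0 i]).
  apply: measurableI.
    apply: measurable_finforall => i; apply: measurable_ge0.
    exact: measurable_rV_coord.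
  apply: measurable_ge0; apply: measurable_funB => //.
  by apply: measurable_sum => i; exact: measurable_rV_coord.
apply/seteqP; split => t /=; rewrite /std_simplex.
  by move=> /andP[/forallP ft gt]; split; rewrite ?subr_ge0.
by move=> [ft]; rewrite subr_ge0 => gt; rewrite gt andbT; exact/forallP.
Qed.

Lemma std_simplex_cons d t a (x : 'rV[R]_d) :
  std_simplex t (cons_rV (a, x)) = (0 <= a) && std_simplex (t - a) x.
Proof.
rewrite /std_simplex big_ord_recl cons_rV0 lerBrDl.
under eq_bigr do rewrite cons_rVS.
rewrite andbA; congr (_ && _); apply/forallP/andP => [H|[a0 /forallP H] i].
  split; first by have := H ord0; rewrite cons_rV0.
  by apply/forallP => i; have := H (lift ord0 i); rewrite cons_rVS.
by have [j ->|->] := unliftP ord0 i; rewrite ?cons_rV0 ?cons_rVS.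
Qed.

Let integral_pow (d : nat) (t : R) : 0 < t ->
  (\int[mu]_(a in `[0%R, t]) ((t - a) ^+ d / d`!%:R)%:E =
   (t ^+ d.+1 / d.+1`!%:R)%:E)%E.
Proof.
move=> t0.
pose F (a : R) : R := - ((t - a) ^+ d.+1 / d.+1`!%:R).
have dF (a : R) : is_derive a 1 F ((t - a) ^+ d / d`!%:R).
  have dh : is_derive a (1 : R) (cst t - @id R : R -> R) (0 - 1).
    exact: is_deriveB.
  have dZ := is_deriveZ (- d.+1`!%:R^-1) (is_deriveX d.+1 dh).
  have -> : F = (- d.+1`!%:R^-1) \*: (cst t - @id R : R -> R) ^+ d.+1.
    by apply/funext => x; rewrite /F /= fctE/= /GRing.scale/= mulNr mulrC.
  apply: (is_derive_eq dZ).
  rewrite !fctE/= /GRing.scale/= factS natrM.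
  have d0 : d.+1%:R != 0 :> R by rewrite pnatr_eq0.
  have f0 : d`!%:R != 0 :> R by rewrite pnatr_eq0 -lt0n fact_gt0.
  rewrite sub0r mulrN1 mulrNN invfM.
  move: d0 f0; set k := d.+1%:R; set m := d`!%:R => k0 m0.
  by field; apply/andP; split.
have cF : continuous F.
  move=> x; apply: differentiable_continuous; apply/derivable1_diffP; exact: ex_derive.
rewrite (@continuous_FTC2 _ _ F)//.
- by rewrite -EFinB /F subrr subr0 expr0n/= mul0r oppr0 sub0r opprK.
- apply: continuous_subspaceT => a.
  apply: cvgM; last exact: cvg_cst.
  apply: (@continuous_comp _ _ _ (fun a : R => t - a) (fun x => x ^+ d));
    last exact: exprn_continuous.
  by apply: cvgB; [exact: cvg_cst|exact: cvg_id].
- split.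
  + by move=> a _; exact: ex_derive.
  + by apply: cvg_at_right_filter; exact: cF.
  + by apply: cvg_at_left_filter; exact: cF.
- by move=> a _; rewrite derive1E; exact: derive_val.
Qed.

(** Slicing by the first coordinate [a] leaves a simplex of size [t - a], which may be negative; the
    factor [(0 <= t)%:R] keeps the formula valid in the induction. *)
Lemma integral_std_simplex d (t : R) :
  (\int[leb d]_x (std_simplex t x)%:R%:E =
   ((0 <= t)%R%:R * (t ^+ d / d`!%:R))%R%:E)%E.
Proof.
elim: d t => [|d IH] t.
  rewrite ge0_integral_lebesgue_rV0.
    rewrite expr0 divff// mulr1 /std_simplex big_ord0; congr ((nat_of_bool _)%:R%:E).
    by apply: andb_idl => _; apply/forallP => -[].
  by apply/measurable_EFinP; exact: measurable_std_simplex.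
rewrite ge0_integral_lebesgue_rVS//; last first.
  by apply/measurable_EFinP; exact: measurable_std_simplex.
have IHa (a : R) : (\int[leb d]_x (std_simplex t (cons_rV (a, x)))%:R%:E =
    ((a \in `[0, t])%R%:R * ((t - a) ^+ d / d`!%:R))%R%:E)%E.
  under eq_integral do rewrite std_simplex_cons -mulnb natrM EFinM.
  rewrite ge0_integralZl//; last first.
    by apply/measurable_EFinP; exact: measurable_std_simplex.
  rewrite IH -EFinM; congr EFin; rewrite in_itv/= subr_ge0.
  by case: (0 <= a); case: (a <= t); rewrite ?mul1r ?mul0r.
under eq_integral do rewrite IHa.
transitivity (\int[mu]_(a in `[0%R, t]) ((t - a) ^+ d / d`!%:R)%:E)%E.
  rewrite [RHS]integral_mkcond.
  apply: eq_integral => a _; rewrite patchE mem_setE.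
  by case: (a \in _); rewrite ?mul1r ?mul0r.
have [t0|t0] := ltP 0 t; first by rewrite integral_pow// ltW// mul1r.
rewrite (@integral_Sset1 _ _ _ 0).
  have [t00|tn0] := leP 0 t; last by rewrite mul0r.
  have -> : t = 0 by apply/eqP; rewrite eq_le t0.
  by rewrite expr0n/= mul0r mulr0.
move=> a /=; rewrite in_itv/= => /andP[a0 at_].
by apply/eqP; rewrite eq_le a0 (le_trans at_).
Qed.

Section simplex.
Variables (d : nat) (v : 'I_d.+1 -> 'rV[R]_d).

Let M : 'M[R]_d.+1 := \matrix_i hom (v i).
Let D : 'M[R]_d := \matrix_i (v (lift ord0 i) - v ord0).

Let hom_edge (x : 'rV[R]_d) :
  hom (x *m D + v ord0) = cons_rV (1 - \sum_i x 0 i, x) *m M.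
Proof.
have -> : cons_rV (1 - \sum_i x 0 i, x) *m M =
    \sum_i cons_rV (1 - \sum_i x 0 i, x) 0 i *: hom (v i).
  by rewrite mulmx_sum_row; apply: eq_bigr => i _; rewrite rowK.
apply/hom_sum; split.
  rewrite big_ord_recl cons_rV0.
  by under [X in _ + X = _]eq_bigr do rewrite cons_rVS; rewrite subrK.
rewrite [RHS]big_ord_recl cons_rV0.
under [X in _ = _ + X]eq_bigr do rewrite cons_rVS.
rewrite scalerBl scale1r mulmx_sum_row.
under [in LHS]eq_bigr do rewrite rowK scalerBr.
by rewrite sumrB -scaler_suml -addrA addrC [- _ + _]addrC.
Qed.

(** Subtracting the first homogenised vertex from the others leaves the edge vectors next to a
    column of zeros. *)
Lemma det_edge : \det D = \det M.
Proof.
pose L : 'M[R]_(1 + d) := block_mx 1%:M 0 (const_mx 1) 1%:M.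
pose U : 'M[R]_(1 + d) := block_mx 1%:M (v ord0) 0 D.
have ML : (M : 'M[R]_(1 + d)) = L *m U.
  rewrite mulmx_block ?mul1mx ?mul0mx ?mulmx1 ?mulmx0 ?addr0.
  apply/row_matrixP => i; rewrite rowK.
  rewrite /hom cons_rVE.
  case: (split_ordP i) => j ->.
    rewrite ord1 rowKu row_row_mx; congr row_mx.
      by apply/rowP => k; rewrite !mxE !ord1.
    apply/rowP => k; rewrite [RHS]mxE; congr (v _ _ _); exact: val_inj.
  rewrite rowKd row_row_mx; congr row_mx.
    by apply/rowP => k; rewrite !mxE ord1.
  apply/rowP => k; rewrite !mxE big_ord1 !mxE mul1r addrC subrK.
  by congr (v _ 0 k); exact: val_inj.
have dL : \det L = 1 by rewrite /L det_lblock !det1 mulr1.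
have dU : \det U = \det D by rewrite /U det_ublock det1 mul1r.
by rewrite -dU -[LHS]mul1r -dL -det_mulmx ML.
Qed.

Lemma measurable_simplex_indicator : measurable_fun setT
  (fun y : 'rV[R]_d => [forall i, 0 <= (hom y *m invmx M) 0 i]%:R : R).
Proof.
apply: measurable_bool_natr.
rewrite [X in measurable X](_ : _ =
    [set y | forall i, 0 <= (hom y *m invmx M) 0 i]).
  apply: measurable_finforall => i; apply: measurable_ge0.
  apply: measurable_rV_coord; apply: measurable_rV_mulmx => //.
  exact: measurable_homT.
by apply/seteqP; split => y /= /forallP.
Qed.

(** The map [x *m D + v ord0] sends the standard simplex onto this one, and by [hom_edge] the
    barycentric coordinates of the image are [x] preceded by [1 - \sum_i x 0 i]. *)
Lemma simplex_volume : M \in unitmx ->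
  (\int[leb d]_y ([forall i, 0 <= (hom y *m invmx M) 0%R i]%R)%:R%:E =
   (`|\det M| / d`!%:R)%R%:E)%E.
Proof.
move=> uM.
have uD : D \in unitmx by rewrite unitmxE det_edge -unitmxE.
have mG := measurable_simplex_indicator.
have mG' : measurable_fun setT
    (fun y : 'rV[R]_d => ([forall i, 0 <= (hom y *m invmx M) 0 i]%:R : R)%:E).
  exact/measurable_EFinP.
rewrite -(ge0_integral_lebesgue_rV_shift (v ord0))//.
rewrite (ge0_integral_lebesgue_rV_linear uD)//; last first.
  by apply: (measurableT_comp mG'); exact: measurable_rVD.
rewrite det_edge (eq_integral (fun x => ((std_simplex 1 x)%:R : R)%:E)).
  by rewrite integral_std_simplex ler01 mul1r expr1n div1r -EFinM.
move=> x _; congr ((nat_of_bool _)%:R%:E).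
rewrite hom_edge mulmxK// /std_simplex.
apply/forallP/andP => [H|[/forallP x0 x1] i].
  split; last by have := H ord0; rewrite cons_rV0 subr_ge0.
  by apply/forallP => i; have := H (lift ord0 i); rewrite cons_rVS.
have [j ->|->] := unliftP ord0 i; first by rewrite cons_rVS.
by rewrite cons_rV0 subr_ge0.
Qed.

End simplex.

End simplex_volume.

(** * The constant kappa *)

Section kappa_integral.
Context {R : realType}.
Local Notation mu := (@lebesgue_measure R).
Local Notation leb d := (lebesgue_rV R d).
Local Open Scope ereal_scope.

Lemma integral_expR_sqr (t : R) : (0 < t)%R ->
  \int[mu]_x (expR (- (t * x ^+ 2)))%:E = (Num.sqrt (pi / t))%:E.
Proof.
move=> t0; have st : (0 < Num.sqrt t)%R by rewrite sqrtr_gt0.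
rewrite (@ge0_integral_lebesgue_scale R (Num.sqrt t)^-1); last 3 first.
- by rewrite invr_eq0 gt_eqF.
- apply/measurable_EFinP; apply: (measurableT_comp (@measurable_expR R)).
  by apply: measurable_funN; apply: measurable_funM => //; exact: measurable_funX.
- by move=> x; rewrite lee_fin expR_ge0.
rewrite (eq_integral (fun x : measurableTypeR R => (gauss_fun x)%:E)).
  rewrite integralT_gauss -EFinM gtr0_norm ?invr_gt0//.
  by rewrite sqrtrM ?pi_ge0// sqrtrV ?ltW// mulrC.
move=> x _; rewrite /gauss_fun exprMn exprVn sqr_sqrtr ?ltW// mulrCA divff ?mulr1//.
by rewrite gt_eqF.
Qed.

Lemma integral_expR_dotp d (t : R) : (0 < t)%R ->
  \int[leb d]_x (expR (- (t * dotp x x)))%:E = (Num.sqrt (pi / t) ^+ d)%:E.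
Proof.
move=> t0.
have mF k : measurable_fun setT (fun x : 'rV[R]_k => (expR (- (t * dotp x x)))%:E).
  apply/measurable_EFinP; apply: (measurableT_comp (@measurable_expR R)).
  apply: measurable_funN; apply: measurable_funM => //.
  exact: measurable_dotp.
have m1 : measurable_fun setT (fun a : R => (expR (- (t * a ^+ 2)))%:E).
  apply/measurable_EFinP; apply: (measurableT_comp (@measurable_expR R)).
  by apply: measurable_funN; apply: measurable_funM => //; exact: measurable_funX.
elim: d => [|d IH].
  by rewrite ge0_integral_lebesgue_rV0// /dotp big_ord0 mulr0 oppr0 expR0.
rewrite ge0_integral_lebesgue_rVS//.
transitivity (\int[mu]_a ((expR (- (t * a ^+ 2)))%:E * (Num.sqrt (pi / t) ^+ d)%:E)).
  apply: eq_integral => a _; rewrite -IH -ge0_integralZl//.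
  - apply: eq_integral => x _; rewrite -EFinM -expRD dotp_cons; congr (expR _)%:E.
    by rewrite mulrDr opprD expr2.
  - exact: mF.
rewrite ge0_integralZr//.
by rewrite integral_expR_sqr// -EFinM exprS.
Qed.

Lemma integral0y_expRN : \int[mu]_(t in `]0%R, +oo[) (expR (- t))%:E = 1.
Proof.
rewrite integral_itv_obnd_cbnd; last first.
  apply/measurable_EFinP; apply: measurable_funTS.
  apply: (measurableT_comp (@measurable_expR R)).
  exact: (measurable_funN (@measurable_id _ _ setT)).
rewrite (@ge0_continuous_FTC2y _ _ (fun t => - expR (- t))%R _ 0%R).
- by rewrite oppr0 expR0 EFinN oppeK add0e.
- by move=> x _; rewrite expR_ge0.
- apply: continuous_subspaceT => x; apply: continuous_comp.
    by apply: cvgN; exact: cvg_id.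
  exact: continuous_expR.
- by rewrite -oppr0; apply: cvgN; exact: cvgr_expR.
- by move=> t _; exact: ex_derive.
- apply: cvg_at_right_filter; apply: cvgN.
  apply: continuous_comp; last exact: continuous_expR.
  by apply: cvgN; exact: cvg_id.
- move=> t _; rewrite derive1E; apply: derive_val.
  by apply: is_derive_eq; rewrite /GRing.scale/=; ring.
Qed.

Let Gamma_fun (k t : R) : R := ((0 < t)%R%:R * (t `^ k * expR (- t)))%R.

Let Gamma_fun_ge0 k t : (0 <= Gamma_fun k t)%R.
Proof. by rewrite !mulr_ge0// ?powR_ge0 ?expR_ge0. Qed.

Let measurable_gt0 : measurable_fun setT (fun t : R => (0 < t)%R%:R : R).
Proof.
apply: measurable_bool_natr.
rewrite [X in measurable X](_ : _ = `]0%R, +oo[%classic)//.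
by apply/seteqP; split => t /=; rewrite in_itv/= andbT.
Qed.

Let measurable_Gamma_fun k : measurable_fun setT (Gamma_fun k).
Proof.
apply: measurable_funM => //; apply: measurable_funM.
  exact: measurable_powR.
apply: (measurableT_comp (@measurable_expR R)).
exact: (measurable_funN (@measurable_id _ _ setT)).
Qed.

Let Gamma_scale (k v : R) : (0 < v)%R ->
  (v `^ (k + 1))^-1%:E * \int[mu]_t (Gamma_fun k t)%:E =
  \int[mu]_t ((0 < t)%R%:R * (t `^ k * expR (- (t * v))))%R%:E.
Proof.
move=> v0; rewrite (ge0_integral_lebesgue_scale (lt0r_neq0 v0)); last 2 first.
- by apply/measurable_EFinP; exact: measurable_Gamma_fun.
- by move=> t; rewrite lee_fin Gamma_fun_ge0.
have vk0 : (v `^ (k + 1) != 0)%R by rewrite gt_eqF// powR_gt0.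
have vk : (v `^ (k + 1) = v `^ k * v)%R.
  by rewrite powRD ?powRr1 ?ltW// (gt_eqF v0) implybT.
rewrite muleA -EFinM gtr0_norm// -ge0_integralZl//; last 3 first.
- apply/measurable_EFinP; apply: (measurableT_comp (measurable_Gamma_fun k)).
  exact: measurable_funM.
- by move=> t _; rewrite lee_fin Gamma_fun_ge0.
- by rewrite lee_fin mulr_ge0// ?ltW// invr_gt0 powR_gt0.
apply: eq_integral => t _; rewrite -EFinM /Gamma_fun pmulr_lgt0//.
congr EFin; have [t0|t0] := ltP 0%R t; last by rewrite !mul0r mulr0.
rewrite !mul1r powRM ?ltW//; move: vk0; rewrite vk; move: (v `^ k)%R => c.
rewrite mulf_eq0 negb_or => /andP[c0 _].
by field; rewrite c0 gt_eqF.
Qed.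

(** With [k = d / 2], the product of [hnorm b ^- d.+2] and Gamma(k + 1) is the integral over [t > 0]
    of [t]^ k * expR (- (t * (1 + dotp b b)))[. Integrating over]b[first yields the power]k[of]pi /
    t[, so]t [^ k] cancels and pi^k times the integral of exp(-t) remains. *)
Lemma integral_hnorm_kappa d :
  \int[leb d]_b ((hnorm b) ^- d.+2)%:E = (kappa R d)%:E.
Proof.
pose k : R := (d%:R / 2)%R.
have k0 : (0 <= k)%R by rewrite divr_ge0.
have hE (b : 'rV[R]_d) : (hnorm b ^+ d.+2 = (1 + dotp b b) `^ (k + 1))%R.
  have v0 : (0 <= 1 + dotp b b)%R by rewrite addr_ge0// dotp_ge0.
  rewrite /hnorm -powR12_sqrt// -powR_mulrn ?powR_ge0// -powRrM.
  by congr powR; rewrite /k -[d.+2]addn2 natrD; field.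
pose C := \int[leb d]_b ((hnorm b) ^- d.+2)%:E.
pose GE := \int[mu]_t (Gamma_fun k t)%:E.
have mh : measurable_fun setT (fun b : 'rV[R]_d => ((hnorm b) ^- d.+2)%:E).
  apply/measurable_EFinP; apply: measurable_inv; under eq_fun do rewrite hE.
  apply: (measurableT_comp (@measurable_powR R _)).
  by apply: measurable_funD => //; exact: measurable_dotp.
have h0 (b : 'rV[R]_d) : (0 <= hnorm b ^- d.+2)%R.
  by rewrite invr_ge0 exprn_ge0// ltW// hnorm_gt0.
have C0 : 0 <= C by apply: integral_ge0 => b _; rewrite lee_fin.
have GE0 : 0 <= GE by apply: integral_ge0 => t _; rewrite lee_fin Gamma_fun_ge0.
have CG : C * GE = (pi `^ k)%:E.
  rewrite /C -ge0_integralZr//; last by move=> b _; rewrite lee_fin.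
  transitivity (\int[leb d]_b \int[mu]_t
      ((0 < t)%R%:R * (t `^ k * expR (- (t * (1 + dotp b b)))))%R%:E).
    apply: eq_integral => b _; rewrite hE Gamma_scale//.
    by rewrite ltr_pwDl// dotp_ge0.
  rewrite (ge0_integral_swap (leb d) mu (f := fun b t =>
    ((0 < t)%R%:R * (t `^ k * expR (- (t * (1 + dotp b b)))))%R%:E)); last 2 first.
  - apply/measurable_EFinP; apply: measurable_funM.
      exact: (measurableT_comp measurable_gt0 measurable_snd).
    apply: measurable_funM.
      exact: (measurableT_comp (@measurable_powR R k) measurable_snd).
    apply: (measurableT_comp (@measurable_expR R)); apply: measurable_funN.
    apply: measurable_funM => //; apply: measurable_funD => //.
    by apply: measurable_dotp; exact: measurable_fst.
  - by move=> b t; rewrite lee_fin !mulr_ge0// ?powR_ge0 ?expR_ge0.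
  transitivity (\int[mu]_t ((pi `^ k)%:E *
      ((fun t => (expR (- t))%:E) \_ `]0%R, +oo[) t)).
    apply: eq_integral => t _; rewrite patchE mem_setE in_itv/= andbT.
    have [t0|t0] := ltP 0%R t; last first.
      by rewrite mule0 integral0_eq// => b _; rewrite mul0r.
    rewrite (eq_integral (fun b : 'rV[R]_d =>
      (t `^ k * expR (- t))%:E * (expR (- (t * dotp b b)))%:E)).
      rewrite ge0_integralZl//; last 2 first.
      - apply/measurable_EFinP; apply: (measurableT_comp (@measurable_expR R)).
        apply: measurable_funN; apply: measurable_funM => //.
        exact: measurable_dotp.
      - by rewrite lee_fin mulr_ge0// ?powR_ge0 ?expR_ge0.
      rewrite integral_expR_dotp// -!EFinM; congr EFin.
      rewrite mulrAC; congr (_ * _)%R.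
      rewrite -powR12_sqrt ?divr_ge0 ?pi_ge0 ?ltW// -powR_mulrn ?powR_ge0//.
      rewrite -powRrM (_ : 2^-1 * d%:R = k)%R; last by rewrite mulrC.
      rewrite -powRM ?ltW ?divr_gt0 ?pi_gt0//; congr powR.
      by rewrite mulrCA divff ?mulr1// gt_eqF.
    move=> b _; rewrite -EFinM mul1r -mulrA -expRD; congr (_ * expR _)%:E.
    by rewrite mulrDr mulr1 opprD.
  rewrite ge0_integralZl//.
  - by rewrite -integral_mkcond integral0y_expRN mule1.
  - apply/(measurable_restrictT _ _).1 => //; apply: measurable_funTS.
    apply/measurable_EFinP; apply: (measurableT_comp (@measurable_expR R)).
    exact: (measurable_funN (@measurable_id _ _ setT)).
  - by move=> t _; rewrite patchE; case: ifPn => // _; rewrite lee_fin expR_ge0.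
  - by rewrite lee_fin powR_ge0.
have pk : (0 < pi `^ k :> R)%R by rewrite powR_gt0 ?pi_gt0.
have GammaE : Gamma (k + 1) = fine GE.
  rewrite /Gamma /Rintegral addrK integral_mkcond; congr fine.
  apply: eq_integral => t _; rewrite patchE mem_setE in_itv/= andbT /Gamma_fun.
  by case: ltP => _; rewrite ?mul1r ?mul0r.
rewrite -/C /kappa -/k GammaE.
(* A finite positive product forces both factors to be finite, so no convergence needs to be checked
   separately. *)
have Gfin : GE \is a fin_num.
  rewrite ge0_fin_numE// ltNge leye_eq; apply/negP => /eqP GEy.
  move: CG; rewrite GEy; have [C00|Cn0] := eqVneq C 0.
    by rewrite C00 mul0e => -[] /eqP; rewrite lt_eqF.
  by rewrite gt0_muley ?lt0e ?Cn0.
have Cfin : C \is a fin_num.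
  rewrite ge0_fin_numE// ltNge leye_eq; apply/negP => /eqP Cy.
  move: CG; rewrite Cy; have [G00|Gn0] := eqVneq GE 0.
    by rewrite G00 mule0 => -[] /eqP; rewrite lt_eqF.
  by rewrite gt0_mulye ?lt0e ?Gn0.
rewrite -(fineK Cfin) -(fineK Gfin) -EFinM in CG.
case: CG => CG; rewrite -(fineK Cfin) -CG mulfK//.
by apply/eqP => G0; move: pk; rewrite -CG G0 mulr0 ltxx.
Qed.

End kappa_integral.

(** * Integration over hyperplanes *)

Section facet_integral.
Context {R : realType} {d : nat}.
Local Notation N := d.+1.
Local Notation mu := (@lebesgue_measure R).
Local Notation leb d := (lebesgue_rV R d).
Local Notation gamma := (gauss_rV d : probability 'rV[R]_d R).
Local Notation pow := (tuple_power gamma).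

Definition hom_mx n (X : n.-tuple 'rV[R]_d) : 'M[R]_(n, N) :=
  \matrix_i hom (tnth X i).

Definition rV_tail (c : 'rV[R]_N) : 'rV[R]_d := \row_j c 0 (lift ord0 j).

(* Signed distance from the origin to the hyperplane
   [z = c_0 + c_1 x_1 + ... + c_d x_d] of R^(d+1). *)
Definition height (c : 'rV[R]_N) : R := c 0 ord0 / hnorm (rV_tail c).

Lemma cons_rV_tail (c : 'rV[R]_N) : cons_rV (c 0 ord0, rV_tail c) = c.
Proof.
apply/rowP => i; have [j ->|->] := unliftP ord0 i; last by rewrite cons_rV0.
by rewrite cons_rVS mxE.
Qed.

Lemma rV_tail_cons a b : rV_tail (cons_rV (a, b)) = b.
Proof. by apply/rowP => i; rewrite mxE cons_rVS. Qed.

Lemma height_cons a b : height (cons_rV (a, b)) = a / hnorm b.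
Proof. by rewrite /height cons_rV0 rV_tail_cons. Qed.

Lemma measurable_hnorm dT (T : measurableType dT) k (f : T -> 'rV[R]_k) :
  measurable_fun setT f -> measurable_fun setT (fun t => hnorm (f t)).
Proof.
move=> mf; rewrite (_ : (fun _ => _) = (fun t => (1 + dotp (f t) (f t)) `^ 2^-1)).
  apply: (measurableT_comp (@measurable_powR R _)).
  by apply: measurable_funD => //; exact: measurable_dotp.
by apply/funext => t; rewrite powR12_sqrt// addr_ge0// dotp_ge0.
Qed.

Lemma measurable_height : measurable_fun setT height.
Proof.
apply: measurable_funM; first exact: measurable_coord.
apply: measurable_inv; apply: measurable_hnorm; apply: measurable_rVP => i.
by under eq_fun do rewrite mxE; exact: measurable_coord.
Qed.

Lemma measurable_hom_mx n dT (T : measurableType dT)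
    (f : T -> n.-tuple 'rV[R]_d) i j : measurable_fun setT f ->
  measurable_fun setT (fun t => hom_mx (f t) i j).
Proof.
move=> mf; under eq_fun do rewrite mxE.
apply: measurable_rV_coord; apply: measurable_hom.
exact: measurable_tnth_comp.
Qed.

Lemma measurable_det_hom_mx dT (T : measurableType dT)
    (f : T -> N.-tuple 'rV[R]_d) : measurable_fun setT f ->
  measurable_fun setT (fun t => \det (hom_mx (f t))).
Proof. by move=> mf; apply: measurable_det => i j; exact: measurable_hom_mx. Qed.

(** On homogenised points the affine map is right multiplication by a block matrix with determinant
    [\det (square_mx b)]. *)
Lemma det_hom_mx_square_map (U : N.-tuple 'rV[R]_d) a b :
  \det (hom_mx [tuple square_map a b (tnth U i) | i < N]) =
  \det (hom_mx U) / hnorm b.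
Proof.
pose B : 'M[R]_(1 + d) := block_mx 1%:M (square_shift a b) 0 (square_mx b).
have dB : \det B = (hnorm b)^-1 by rewrite /B det_ublock det1 mul1r det_square_mx.
rewrite -dB -det_mulmx; congr (\det _).
apply/row_matrixP => i; rewrite row_mul !rowK tnth_mktuple /hom !cons_rVE.
have E u : row_mx (1%:M : 'rV_1) u *m B = row_mx 1%:M (square_map a b u).
  by rewrite mul_row_block mul1mx mulmx0 addr0 mul1mx addrC.
exact/esym/E.
Qed.

Local Open Scope ereal_scope.

(** Completing the square at each vertex gives [N] factors [phi (height c) / hnorm b]; the squared
    determinant is rescaled by [hnorm b ^- 2], and its own mean is [N!]. *)
Lemma gauss_rV_det_phi (c : 'rV[R]_N) :
  \int[pow N]_X (((\det (hom_mx X)) ^+ 2)%:E *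
    \prod_(i < N) (phi (dotp (hom (tnth X i)) c))%:E) =
  (N`!%:R * (phi (height c) / hnorm (rV_tail c)) ^+ N /
    hnorm (rV_tail c) ^+ 2)%R%:E.
Proof.
rewrite -(cons_rV_tail c); move: (c 0%R ord0) (rV_tail c) => a b.
rewrite height_cons rV_tail_cons; have s0 := hnorm_gt0 b.
pose q : R := (phi (a / hnorm b) / hnorm b)%R.
have q0 : (0 <= q)%R by rewrite mulr_ge0 ?phi_ge0// invr_ge0 ltW.
have mdet2 : measurable_fun setT (fun X : N.-tuple 'rV[R]_d =>
    ((\det (hom_mx X)) ^+ 2)%:E).
  apply/measurable_EFinP; apply: measurable_funX.
  exact: (measurable_det_hom_mx (@measurable_id _ _ _)).
have mw : measurable_fun setT (fun x : 'rV[R]_d => (phi (a + dotp x b))%:E).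
  apply/measurable_EFinP; apply: (measurableT_comp measurable_phi).
  by apply: measurable_funD => //; exact: measurable_dotpl.
transitivity (q%:E ^+ N * \int[pow N]_U
    ((\det (hom_mx [tuple square_map a b (tnth U i) | i < N])) ^+ 2)%:E).
  rewrite -(@tuple_power_substitution _ _ _ _ _ gamma gamma (square_map a b)
    (fun x => (phi (a + dotp x b))%:E) q%:E N
    (fun X => ((\det (hom_mx X)) ^+ 2)%:E))//.
  - apply: eq_integral => X _; congr (_ * _).
    by apply: eq_bigr => i _; rewrite dotp_hom.
  - exact: measurable_square_map.
  - by move=> x; rewrite lee_fin phi_ge0.
  - by move=> G mG G0; rewrite gauss_rV_complete_square.
  - by move=> X; rewrite lee_fin sqr_ge0.
rewrite (eq_integral (fun U : N.-tuple 'rV[R]_d =>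
    ((hnorm b) ^- 2)%:E * ((\det (hom_mx U)) ^+ 2)%:E)); last first.
  by move=> U _; rewrite det_hom_mx_square_map -EFinM exprMn exprVn mulrC.
rewrite ge0_integralZl//; last 2 first.
- by move=> U _; rewrite lee_fin sqr_ge0.
- by rewrite lee_fin invr_ge0 sqr_ge0.
rewrite gauss_rV_sqr_det -EFin_expe -!EFinM; congr EFin.
by rewrite -/q mulrC [X in (X * _)%R = _]mulrC mulrAC.
Qed.

(** One factor |det| comes from the volume of the simplex, the second from passing from the heights
    [z] to the hyperplane [c] with [z = c *m (hom_mx X)^T]. Only their product, a square, has to be
    averaged. *)
Lemma facet_integral (H : R -> \bar R) :
  measurable_fun setT H -> (forall t, 0 <= H t) ->
  \int[pow N]_X \int[gauss_rV N]_z (`|\det (hom_mx X)|%R%:E *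
    H (height (z *m invmx (hom_mx X)^T))%R) =
  (N`!%:R * kappa R d)%R%:E * \int[mu]_t (H t * (phi t ^+ N)%:E).
Proof.
move=> mH H0.
have mHh : measurable_fun setT (fun c : 'rV[R]_N => H (height c)).
  exact: (measurableT_comp mH measurable_height).
have mpp k : measurable_fun setT (fun x : 'rV[R]_k => (prod_phi x)%:E).
  by apply/measurable_EFinP; exact: measurable_prod_phi.
transitivity (\int[pow N]_X \int[leb N]_c (((\det (hom_mx X)) ^+ 2)%:E *
    \prod_(i < N) (phi (dotp (hom (tnth X i)) c))%:E * H (height c))).
  apply: eq_integral => X _; set M := hom_mx X.
  have mHM : measurable_fun setT (fun z : 'rV[R]_N =>
      `|\det M|%R%:E * H (height (z *m invmx M^T))%R).
    apply: emeasurable_funM => //.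
    by apply: (measurableT_comp mHh); exact: measurable_mulmxr.
  rewrite ge0_integral_gauss_rV//; last by move=> z; rewrite mule_ge0.
  (* A singular matrix contributes 0 on both sides. *)
  have [uM|uM] := boolP (M \in unitmx); last first.
    have M0 : \det M = 0%R.
      by move: uM; rewrite unitmxE unitfE negbK => /eqP.
    rewrite !integral0_eq// => c _; rewrite M0 ?expr0n/= ?normr0 !mul0e//.
  have uMT : M^T \in unitmx by rewrite unitmx_tr.
  rewrite (ge0_integral_lebesgue_rV_linear uMT); last 2 first.
  - by apply: emeasurable_funM => //; exact: mpp.
  - by move=> z; rewrite !mule_ge0// lee_fin prod_phi_ge0.
  rewrite det_tr -ge0_integralZl//; last 2 first.
  - pose F (z : 'rV[R]_N) := `|\det M|%R%:E * H (height (z *m invmx M^T))%R *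
      (prod_phi z)%:E.
    apply: (measurableT_comp (_ : measurable_fun setT F)).
      by apply: emeasurable_funM => //; exact: mpp.
    exact: measurable_mulmxr.
  - by move=> z _; rewrite !mule_ge0// lee_fin prod_phi_ge0.
  apply: eq_integral => c _; rewrite mulmxK// !muleA -EFinM -normrM -expr2.
  rewrite ger0_norm ?sqr_ge0// muleAC; congr (_ * _ * _).
  rewrite /prod_phi -prodEFin; apply: eq_bigr => i _.
  congr (phi _)%:E; rewrite mxE; apply: eq_bigr => j _.
  by rewrite [M^T _ _]mxE [M _ _]mxE mulrC.
rewrite (ge0_integral_swap (pow N) (leb N) (f := fun X c =>
  ((\det (hom_mx X)) ^+ 2)%:E *
    \prod_(i < N) (phi (dotp (hom (tnth X i)) c))%:E * H (height c))); last 2 first.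
- apply: emeasurable_funM; last exact: (measurableT_comp mHh measurable_snd).
  apply: emeasurable_funM.
    apply/measurable_EFinP; apply: measurable_funX.
    exact: (measurable_det_hom_mx measurable_fst).
  apply: emeasurable_prod => i; apply/measurable_EFinP.
  apply: (measurableT_comp measurable_phi); apply: measurable_dotp => //.
  by apply: measurable_hom; apply: measurable_tnth_comp.
- by move=> X c; rewrite !mule_ge0// ?lee_fin ?sqr_ge0// prode_ge0// => i _;
    rewrite lee_fin phi_ge0.
rewrite (eq_integral (fun c : 'rV[R]_N =>
  (N`!%:R * (phi (height c) / hnorm (rV_tail c)) ^+ N /
    hnorm (rV_tail c) ^+ 2)%R%:E * H (height c))); last first.
  move=> c _; rewrite -gauss_rV_det_phi ge0_integralZr//.
  - apply: emeasurable_funM.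
      apply/measurable_EFinP; apply: measurable_funX.
      exact: (measurable_det_hom_mx (@measurable_id _ _ _)).
    apply: emeasurable_prod => i; apply/measurable_EFinP.
    apply: (measurableT_comp measurable_phi); apply: measurable_dotp => //.
    by apply: measurable_hom; exact: measurable_tnth.
  - move=> X _; rewrite mule_ge0// ?lee_fin ?sqr_ge0// prode_ge0// => i _.
    by rewrite lee_fin phi_ge0.
pose K (a : R) (b : 'rV[R]_d) : R := (N`!%:R * (phi (a / hnorm b) / hnorm b) ^+ N /
    hnorm b ^+ 2)%R.
have K0 a b : (0 <= K a b)%R.
  by rewrite /K !mulr_ge0// ?exprn_ge0// ?invr_ge0 ?exprn_ge0 ?mulr_ge0 ?phi_ge0//
    ?invr_ge0 ltW// hnorm_gt0.
have mK : measurable_fun setT (fun c : 'rV[R]_N =>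
    (K (c 0%R ord0) (rV_tail c))%:E * H (height c)).
  have mt : measurable_fun setT rV_tail.
    apply: measurable_rVP => i; under eq_fun do rewrite mxE.
    exact: measurable_coord.
  apply: emeasurable_funM => //; apply/measurable_EFinP.
  apply: measurable_funM; last first.
    by apply: measurable_inv; apply: measurable_funX; exact: measurable_hnorm.
  apply: measurable_funM => //; apply: measurable_funX; apply: measurable_funM.
    exact: (measurableT_comp measurable_phi measurable_height).
  by apply: measurable_inv; exact: measurable_hnorm.
rewrite (ge0_integral_lebesgue_rVS2 (F := fun c : 'rV[R]_N =>
    (K (c 0%R ord0) (rV_tail c))%:E * H (height c)))//; last first.
  by move=> c; rewrite mule_ge0// lee_fin.
pose I := \int[mu]_t (H t * (phi t ^+ N)%:E).
transitivity (\int[leb d]_b ((N`!%:R * (hnorm b) ^- d.+2)%R%:E * I)).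
  apply: eq_integral => b _; have s0 := hnorm_gt0 b.
  rewrite (ge0_integral_lebesgue_scale (lt0r_neq0 s0)); last 2 first.
  - apply: (measurableT_comp mK).
    exact: measurable_cons_rV2.
  - by move=> a; rewrite mule_ge0// lee_fin.
  (* The exponent [d.+3] consists of [N] from the densities and 2 from the squared determinant; the
     factor [hnorm b] produced by the scaling lowers it to [d.+2]. *)
  rewrite gtr0_norm// (eq_integral (fun a : measurableTypeR R =>
      (N`!%:R * hnorm b ^- d.+3)%R%:E * (H a * (phi a ^+ N)%:E))); last first.
    move=> a _; rewrite height_cons rV_tail_cons cons_rV0 /K mulfK ?gt_eqF//.
    rewrite muleC muleCA -EFinM; congr (_ * _%:E).
    rewrite exprMn exprVn -[d.+3]addn2 exprD.
    have : (hnorm b ^+ N != 0)%R by rewrite expf_neq0// gt_eqF.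
    move: (hnorm b ^+ N)%R (phi a ^+ N)%R => y p y0.
    by field; rewrite y0 gt_eqF.
  rewrite ge0_integralZl//; last 3 first.
  - apply: emeasurable_funM => //; apply/measurable_EFinP.
    by apply: measurable_funX; exact: measurable_phi.
  - by move=> t _; rewrite mule_ge0// lee_fin exprn_ge0// phi_ge0.
  - by rewrite lee_fin mulr_ge0// invr_ge0 exprn_ge0// ltW.
  rewrite muleA -EFinM; congr (_%:E * _).
  rewrite mulrCA; congr (_ * _)%R.
  by rewrite exprS invfM mulrA divff ?mul1r// gt_eqF.
have mh : measurable_fun setT (fun b : 'rV[R]_d => ((hnorm b) ^- d.+2)%:E).
  apply/measurable_EFinP; apply: measurable_inv; apply: measurable_funX.
  exact: measurable_hnorm.
have h0 (b : 'rV[R]_d) : (0 <= hnorm b ^- d.+2)%R.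
  by rewrite invr_ge0 exprn_ge0// ltW// hnorm_gt0.
have I0 : 0 <= I.
  by apply: integral_ge0 => t _; rewrite mule_ge0// lee_fin exprn_ge0// phi_ge0.
under eq_integral do rewrite EFinM -muleA.
rewrite ge0_integralZl//; last 2 first.
- by apply: emeasurable_funM.
- by move=> b _; rewrite mule_ge0// lee_fin.
rewrite ge0_integralZr//; last by move=> b _; rewrite lee_fin.
by rewrite integral_hnorm_kappa muleA -EFinM.
Qed.

End facet_integral.

(** * Sandwiching the volume by lifted facets *)

Section le_integral.
Local Open Scope ereal_scope.

(* Monotonicity does not need measurability: the integral of a nonnegative
   function is a supremum over the simple functions below it. *)
Lemma ge0_le_integral_nonmeasurable dT (T : measurableType dT) (R : realType)
    (m : {measure set T -> \bar R}) (f g : T -> \bar R) :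
  (forall x, 0 <= f x) -> (forall x, f x <= g x) ->
  \int[m]_x f x <= \int[m]_x g x.
Proof.
move=> f0 fg; have g0 x : 0 <= g x := le_trans (f0 x) (fg x).
rewrite !ge0_integralTE//; apply: le_ereal_sup => _ /= [h hf <-].
by exists h => // x; exact: le_trans (fg x).
Qed.

End le_integral.

Section volume_sandwich.
Context {R : realType} {d : nat} {K : finType}.
Variables (p : K -> 'rV[R]_d) (z : K -> R).
Local Notation N := d.+1.
Local Notation leb := (lebesgue_rV R d).
Local Notation hull := (convex_hull (range p)).
Local Notation v := (fun k => hom (p k)).
Local Open Scope ereal_scope.

Definition facet_wt (f : {ffun 'I_N -> K}) : R :=
  (`|\det (basis_mx v f)| / d`!%:R)%R.

Lemma facet_wt_ge0 f : (0 <= facet_wt f)%R.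
Proof. by rewrite divr_ge0. Qed.

Let measurable_feasible (b : bool) (f : {ffun 'I_N -> K}) :
  measurable_fun setT (fun y : 'rV[R]_d => (feasible v (hom y) f && b)%:R : R).
Proof.
have [uM|uM] := boolP (basis_mx v f \in unitmx); last first.
  rewrite (_ : (fun _ => _) = cst 0%R)//.
  by apply/funext => y; rewrite /feasible (negbTE uM).
rewrite (_ : (fun _ => _) = (fun y : 'rV[R]_d => [forall i,
    0 <= (hom y *m invmx (\matrix_i v (f i))) 0 i]%R%:R * b%:R)%R).
  by apply: measurable_funM => //; exact: measurable_simplex_indicator.
by apply/funext => y; rewrite -natrM mulnb /feasible uM.
Qed.

Lemma integral_feasible (b : bool) (f : {ffun 'I_N -> K}) :
  \int[leb]_y (feasible v (hom y) f && b)%:R%:E = (facet_wt f * b%:R)%:E.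
Proof.
have [uM|uM] := boolP (basis_mx v f \in unitmx); last first.
  rewrite integral0_eq//; last first.
    by move=> y _; rewrite /feasible (negbTE uM).
  move: uM; rewrite unitmxE unitfE negbK /facet_wt => /eqP ->.
  by rewrite normr0 !mul0r.
rewrite (eq_integral (fun y : 'rV[R]_d =>
  (b%:R)%:E * ([forall i, 0 <= (hom y *m invmx (\matrix_i v (f i))) 0%R i]%R)%:R%:E)).
  rewrite ge0_integralZl//; last first.
  - by apply/measurable_EFinP; exact: measurable_simplex_indicator.
  - rewrite simplex_volume//.
    by rewrite -EFinM mulrC.
by move=> y _; rewrite -EFinM -natrM mulnb /feasible uM andbC.
Qed.

Let integral_card (b : {ffun 'I_N -> K} -> bool) :
  \int[leb]_y (#|[set f | feasible v (hom y) f && b f]%SET|%:R)%:E =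
  (\sum_f facet_wt f * (b f)%:R)%:E.
Proof.
rewrite (eq_integral (fun y : 'rV[R]_d =>
  \sum_f (feasible v (hom y) f && b f)%:R%:E)).
  rewrite ge0_integral_sum//; last first.
    by move=> f; apply/measurable_EFinP; exact: measurable_feasible.
  by rewrite -sumEFin; apply: eq_bigr => f _; rewrite integral_feasible.
move=> y _; rewrite sumEFin -natr_sum -sum1_card -big_mkcond; congr (_%:R%:E).
by apply: eq_bigl => f; rewrite inE.
Qed.

Let measurable_card (b : {ffun 'I_N -> K} -> bool) : measurable_fun setT
  (fun y : 'rV[R]_d => (#|[set f | feasible v (hom y) f && b f]%SET|%:R : R)%:E).
Proof.
apply/measurable_EFinP; rewrite (_ : (fun _ => _) =
  (fun y : 'rV[R]_d => \sum_f (feasible v (hom y) f && b f)%:R)%R).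
  by apply: measurable_sum => f; exact: measurable_feasible.
apply/funext => y; rewrite -natr_sum -sum1_card -big_mkcond; congr (_%:R)%R.
by apply: eq_bigl => f; rewrite inE.
Qed.

(* A generic point of the hull lies under exactly one facet of the upper boundary
   of the lifted hull, counted with its N! orderings, unless that facet contains
   more than N lifted points: the two sides settle such ties in opposite ways. *)
Lemma volume_sandwich :
  (\sum_f facet_wt f * (strictly_dual_feasible v z f)%:R)%:E <=
    (N`!%:R)%:E * leb hull <=
  (\sum_f facet_wt f * (dual_feasible v z f)%:R)%:E.
Proof.
have mh := measurable_convex_hull p.
have <- : \int[leb]_y ((N`!%:R)%:E * (\1_hull y)%:E) = (N`!%:R)%:E * leb hull.
  rewrite ge0_integralZl//; last by apply/measurable_EFinP; exact: measurable_indic.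
  by rewrite integral_indic// setIT.
have mN : measurable_fun setT (fun y : 'rV[R]_d => (N`!%:R)%:E * (\1_hull y : R)%:E).
  by apply: emeasurable_funM => //; apply/measurable_EFinP; exact: measurable_indic.
rewrite -!integral_card; apply/andP; split.
  apply: ae_ge0_le_integral => //.
  apply: filterS (ae_card_strictly_dual_feasible p) => y /(_ z)[+ _] _.
  by rewrite -EFinM lee_fin.
apply: ae_ge0_le_integral => //.
apply: filterS (ae_card_strictly_dual_feasible p) => y /(_ z)[_ +] _.
by rewrite -EFinM lee_fin.
Qed.

End volume_sandwich.

(** * The expected contribution of a facet *)

Section facet_expectation.
Context {R : realType} {d : nat}.
Local Notation N := d.+1.
Local Notation mu := (@lebesgue_measure R).
Local Notation nu := (@std_normal R).
Local Notation gamma := (gauss_rV d : probability 'rV[R]_d R).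
Local Notation E := ('rV[R]_d * measurableTypeR R)%type.

(* A point of R^d together with its height in the lifting to R^(d+1). *)
Definition lifted_gauss : probability ('rV[R]_d * measurableTypeR R)%type R :=
  (gamma \x nu)%E.

Definition lifted_mx n (W : n.-tuple E) : 'M[R]_(n, N) :=
  \matrix_i hom (tnth W i).1.

Definition lifted_dual (W : N.-tuple E) : 'rV[R]_N :=
  (\row_i (tnth W i).2) *m invmx (lifted_mx W)^T.

Definition first_part m (W : (N + m).-tuple E) : N.-tuple E :=
  [tuple tnth W (lshift m i) | i < N].

Lemma measurable_first_part m : measurable_fun setT (@first_part m).
Proof. by apply: measurable_mktuple => i; exact: measurable_tnth. Qed.

Lemma measurable_lifted_mx n i j :
  measurable_fun setT (fun W : n.-tuple E => lifted_mx W i j).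
Proof.
under eq_fun do rewrite mxE; apply: measurable_rV_coord; apply: measurable_hom.
exact: (measurableT_comp measurable_fst (measurable_tnth i)).
Qed.

Lemma measurable_lifted_dual : measurable_fun setT lifted_dual.
Proof.
apply: measurable_rV_mulmx => [|i j].
  apply: measurable_rVP => i; under eq_fun do rewrite mxE.
  exact: (measurableT_comp measurable_snd (measurable_tnth i)).
apply: measurable_invmx => k l; under eq_fun do rewrite mxE.
exact: measurable_lifted_mx.
Qed.

(** An abstract acceptance rule: [e] admits a hyperplane according to its height, [h] admits a
    further point relative to the hyperplane, and [p] is the probability of the latter, a function
    of the height alone. The four instances are the weak and strict rules of the two hulls. *)
Variables (m : nat) (e : R -> bool) (h : 'rV[R]_N -> E -> bool) (p : R -> R).
Hypothesis me : measurable_fun setT (fun t => (e t)%:R : R).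
Hypothesis mh : measurable_fun setT (fun q : 'rV[R]_N * E => (h q.1 q.2)%:R : R).
Hypothesis mp : measurable_fun setT p.
Hypothesis ep : forall t, e t -> 0 <= p t.
Hypothesis hp : forall c, e (height c) ->
  (\int[lifted_gauss]_w (h c w)%:R%:E = (p (height c))%:E)%E.

Definition facet_indicator (W : (N + m).-tuple E) : R :=
  `|\det (lifted_mx (first_part W))| / d`!%:R *
    (e (height (lifted_dual (first_part W))))%:R *
    \prod_(k < m) (h (lifted_dual (first_part W)) (tnth W (rshift N k)))%:R.

Lemma facet_indicator_ge0 W : 0 <= facet_indicator W.
Proof. by rewrite !mulr_ge0// prodr_ge0. Qed.

Let measurable_base : measurable_fun setT (fun W : N.-tuple E =>
  `|\det (lifted_mx W)| / d`!%:R * (e (height (lifted_dual W)))%:R : R).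
Proof.
apply: measurable_funM.
  apply: measurable_funM => //; apply: measurableT_comp => //.
  by apply: measurable_det => i j; exact: measurable_lifted_mx.
apply: (measurableT_comp me); apply: (measurableT_comp measurable_height).
exact: measurable_lifted_dual.
Qed.

Lemma measurable_facet_indicator : measurable_fun setT facet_indicator.
Proof.
apply: measurable_funM.
  exact: (measurableT_comp measurable_base (@measurable_first_part m)).
apply: measurable_prod => k _.
apply: (measurableT_comp mh (_ : measurable_fun setT (fun W : (N + m).-tuple E =>
  (lifted_dual (first_part W), tnth W (rshift N k))))).
apply: measurable_fun_pair; last exact: measurable_tnth.
exact: (measurableT_comp measurable_lifted_dual (@measurable_first_part m)).
Qed.

Local Open Scope ereal_scope.

Let H (t : R) : R := ((e t)%:R * p t ^+ m / d`!%:R)%R.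

Let H_ge0 t : (0 <= H t)%R.
Proof.
rewrite /H; case: (boolP (e t)) => [et|_]; last by rewrite !mul0r.
by rewrite !mulr_ge0// exprn_ge0// ep.
Qed.

Let measurable_H : measurable_fun setT H.
Proof.
apply: measurable_funM => //; apply: measurable_funM => //.
exact: measurable_funX.
Qed.

(** Given the first [N] lifted points, the others are accepted independently, each with probability
    [p], whence the power [m]; what remains is [facet_integral]. *)
Lemma integral_facet_indicator :
  \int[tuple_power lifted_gauss (N + m)]_W (facet_indicator W)%:E =
  (N`!%:R * kappa R d / d`!%:R)%R%:E *
    \int[mu]_t ((e t)%:R * p t ^+ m * phi t ^+ N)%R%:E.
Proof.
rewrite ge0_integral_tuple_power_cat; last 2 first.
- by apply/measurable_EFinP; exact: measurable_facet_indicator.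
- by move=> W; rewrite lee_fin facet_indicator_ge0.
pose B (W : N.-tuple E) : R :=
  (`|\det (lifted_mx W)| / d`!%:R * (e (height (lifted_dual W)))%:R)%R.
have B0 W : (0 <= B W)%R by rewrite !mulr_ge0.
have mhc c : measurable_fun setT (fun w : E => (h c w)%:R%:E : \bar R).
  apply/measurable_EFinP.
  exact: (measurableT_comp mh (@pair1_measurable _ _ _ _ c)).
transitivity (\int[tuple_power lifted_gauss N]_W
    (`|\det (lifted_mx W)|%:E * (H (height (lifted_dual W)))%:E)).
  apply: eq_integral => W _.
  transitivity (\int[tuple_power lifted_gauss m]_V ((B W)%:E *
      \prod_(k < m) (h (lifted_dual W) (tnth V k))%:R%:E)).
    apply: eq_integral => V _; rewrite prodEFin -EFinM /facet_indicator.
    have -> : first_part [tuple of W ++ V] = W.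
      by apply: eq_from_tnth => i; rewrite tnth_mktuple tnth_lshift.
    by congr ((_ * _)%R%:E); apply: eq_bigr => k _; rewrite tnth_rshift.
  rewrite ge0_integralZl//; last 3 first.
  - apply: emeasurable_prod => k.
    exact: (measurableT_comp (mhc _) (measurable_tnth k)).
  - by move=> V _; apply: prode_ge0 => k _; rewrite lee_fin.
  - by rewrite lee_fin.
  rewrite (ge0_integral_tuple_power_prod lifted_gauss m (mhc _)); last first.
    by move=> w; rewrite lee_fin.
  rewrite /B /H; case: (boolP (e _)) => [ec|_];
    last by rewrite !(mulr0, mul0r) !(mul0e, mule0).
  rewrite hp// prodEFin prodr_const card_ord -!EFinM; congr EFin.
  by rewrite mulr1 mul1r -!mulrA; congr (_ * _)%R; rewrite mulrC.
have mBH : measurable_fun setT (fun W : N.-tuple E =>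
    `|\det (lifted_mx W)|%:E * (H (height (lifted_dual W)))%:E).
  apply: emeasurable_funM; apply/measurable_EFinP.
    apply: measurableT_comp => //.
    by apply: measurable_det => i j; exact: measurable_lifted_mx.
  apply: (measurableT_comp measurable_H).
  exact: (measurableT_comp measurable_height measurable_lifted_dual).
rewrite -ge0_integral_tuple_zip//; last by move=> W; rewrite mule_ge0// lee_fin.
transitivity (\int[tuple_power gamma N]_X \int[gauss_rV N]_z
  (`|\det (hom_mx X)|%R%:E * (H (height (z *m invmx (hom_mx X)^T))%R)%:E)).
  apply: eq_integral => X _.
  rewrite [RHS]ge0_integral_distribution; last 2 first.
  - apply: emeasurable_funM => //; apply/measurable_EFinP.
    apply: (measurableT_comp measurable_H).
    by apply: (measurableT_comp measurable_height); exact: measurable_mulmxr.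
  - by move=> z; rewrite mule_ge0// lee_fin.
  apply: eq_integral => Z _.
  have E1 : lifted_mx [tuple (tnth X i, tnth Z i) | i < N] = hom_mx X.
    by apply/row_matrixP => i; rewrite !rowK tnth_mktuple.
  rewrite /= E1 /lifted_dual E1; congr (_ * (H (height (_ *m _)))%:E).
  by apply/rowP => i; rewrite !mxE tnth_mktuple.
rewrite (facet_integral (H := fun t => (H t)%:E)); last 2 first.
- by apply/measurable_EFinP; exact: measurable_H.
- by move=> t; rewrite lee_fin.
rewrite (eq_integral (fun t : measurableTypeR R =>
  (d`!%:R^-1)%:E * ((e t)%:R * p t ^+ m * phi t ^+ N)%R%:E)); last first.
  by move=> t _; rewrite -!EFinM /H mulrAC mulrC.
have mf : measurable_fun setT
    (fun t : R => ((e t)%:R * p t ^+ m * phi t ^+ N)%R).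
  apply: measurable_funM; last by apply: measurable_funX; exact: measurable_phi.
  by apply: measurable_funM => //; exact: measurable_funX.
have mf' : measurable_fun setT
    (fun t : R => ((e t)%:R * p t ^+ m * phi t ^+ N)%R%:E).
  exact/measurable_EFinP.
rewrite ge0_integralZl//; last first.
  move=> t _; rewrite lee_fin; case: (boolP (e t)) => [et|_]; last by rewrite !mul0r.
  by rewrite !mulr_ge0// exprn_ge0// ?ep// phi_ge0.
by rewrite muleA -EFinM.
Qed.

End facet_expectation.

(** * Signed and relabelled points *)

(** The symmetric group acts transitively on tuples of distinct elements. *)
Lemma injective_extends_perm (N m : nat) (g : 'I_N -> 'I_(N + m)) :
  injective g -> exists s : 'S_(N + m), forall j, s (lshift m j) = g j.
Proof.
move=> ginj.
have le_Nn : (N <= #|'I_(N + m)|)%N by rewrite card_ord leq_addr.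
have tr := ntransitive_weak le_Nn (Sym_trans 'I_(N + m)).
have dt (g' : 'I_N -> 'I_(N + m)) : injective g' ->
    [tuple g' j | j < N] \in dtuple_on N [set: 'I_(N + m)]%SET.
  move=> g'inj; apply/dtuple_onP; split=> [i j|//].
  by rewrite !tnth_mktuple => /g'inj.
have [s _ sE] := atransP2 tr (dt _ (@lshift_inj N m)) (dt _ ginj).
exists s => j; have := congr1 (fun t => tnth t j) sE.
rewrite tnth_mktuple => ->.
by rewrite /= /n_act tnth_map tnth_mktuple.
Qed.

(** Counts the candidate facets: vertices with distinct indices, each with a free sign. *)
Lemma card_injective_fst (A S : finType) (N : nat) :
  #|[set f : {ffun 'I_N -> A * S} | injectiveb (fun j => (f j).1)]%SET| =
  (#|A| ^_ N * #|S| ^ N)%N.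
Proof.
pose F (p : {ffun 'I_N -> A} * {ffun 'I_N -> S}) : {ffun 'I_N -> A * S} :=
  [ffun j => (p.1 j, p.2 j)].
have Finj : injective F.
  move=> [g1 e1] [g2 e2] /ffunP H; congr pair; apply/ffunP => j;
    by have := H j; rewrite !ffunE => -[].
have -> : [set f : {ffun 'I_N -> A * S} | injectiveb (fun j => (f j).1)]%SET =
    F @: finset.setX [set g : {ffun 'I_N -> A} | injectiveb g]%SET [set: _]%SET.
  apply/setP => f; rewrite inE; apply/injectiveP/imsetP => [finj|].
    exists ([ffun j => (f j).1], [ffun j => (f j).2]).
      rewrite !inE ?andbT; apply/injectiveP => i j; rewrite !ffunE; exact: finj.
    by apply/ffunP => j; rewrite !ffunE; case: (f j).
  move=> [[g e]]; rewrite !inE ?andbT => /injectiveP ginj -> i j.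
  by rewrite !ffunE; exact: ginj.
rewrite card_imset// cardsX cardsT card_ffun card_ord.
by rewrite card_inj_ffuns card_ord.
Qed.

Section signed_points.
Context {R : realType} {d : nat} {S : finType}.
(** [S] indexes the signs: one element with value 1 for the plain hull, two elements with values 1
    and -1 for the symmetric one. *)
Variable sg : S -> R.
Local Notation N := d.+1.
Local Notation nu := (@std_normal R).
Local Notation E := ('rV[R]_d * measurableTypeR R)%type.

Definition signed (s : S) (w : E) : E := (sg s *: w.1, sg s * w.2).

Definition points n (W : n.-tuple E) (k : 'I_n * S) : E :=
  signed k.2 (tnth W k.1).

Lemma measurable_signed s : measurable_fun setT (signed s).
Proof.
apply: measurable_fun_pair.
  by apply: measurable_rVZ; [exact: measurable_cst|exact: measurable_fst].
by apply: measurable_funM => //; exact: measurable_snd.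
Qed.

Lemma ge0_integral_gauss_rVN (F : 'rV[R]_d -> \bar R) :
  measurable_fun setT F -> (forall x, 0 <= F x)%E ->
  (\int[gauss_rV d]_x F (- x)%R = \int[gauss_rV d]_x F x)%E.
Proof.
move=> mF F0.
have mFN : measurable_fun setT (fun x : 'rV[R]_d => F (- x)).
  rewrite (_ : (fun _ => _) = F \o (fun x : 'rV[R]_d => -1 *: x)).
    apply: (measurableT_comp mF).
    by apply: measurable_rVZ => //; exact: measurable_id.
  by apply/funext => x; rewrite /= scaleN1r.
have mprod : measurable_fun setT (fun x => (@prod_phi R d x)%:E).
  by apply/measurable_EFinP; exact: measurable_prod_phi.
rewrite !ge0_integral_gauss_rV//.
rewrite [RHS](@ge0_integral_lebesgue_rV_linear _ d (-1)%:M); last 3 first.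
- by rewrite unitmxE det_scalar unitrX// unitrN1.
- exact: emeasurable_funM.
- by move=> x; rewrite mule_ge0// lee_fin prod_phi_ge0.
rewrite det_scalar normrX normrN1 expr1n mul1e; apply: eq_integral => x _.
rewrite mul_mx_scalar scaleN1r.
suff -> : prod_phi (- x) = prod_phi x by [].
rewrite !prod_phiE /std_normal_vector_pdf.
suff -> : \sum_(j < d) (- x) 0 j ^+ 2 = \sum_(j < d) x 0 j ^+ 2 by [].
by apply: eq_bigr => j _; rewrite mxE sqrrN.
Qed.

Lemma std_normalN (B : set (measurableTypeR R)) : measurable B ->
  nu ((fun x => - x) @^-1` B) = nu B.
Proof.
move=> mB.
have mI : measurable_fun setT (fun x : R => (\1_B x)%:E : \bar R).
  by apply/measurable_EFinP; exact: measurable_indic.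
have mBN : measurable ((fun x : measurableTypeR R => - x) @^-1` B).
  by rewrite -[X in measurable X]setTI; exact: (@oppr_measurable R setT).
have I0 x : (0%:E <= (\1_B x)%:E :> \bar R)%E by rewrite lee_fin.
have := ge0_integral_std_normalN mI I0.
rewrite (eq_integral (fun x : measurableTypeR R => (\1_((fun x => - x) @^-1` B) x)%:E))//.
by rewrite !integral_indic// !setIT.
Qed.

Lemma lifted_gauss_signed s (B : set E) : sg s = 1 \/ sg s = -1 ->
  measurable B -> (@lifted_gauss R d) (signed s @^-1` B) = lifted_gauss B.
Proof.
move=> [s1|sN] mB.
  suff -> : signed s = id by [].
  by apply/funext => -[x y]; rewrite /signed s1 scale1r mul1r.
have mxB := measurable_fun_xsection nu mB.
transitivity (\int[gauss_rV d]_x nu (xsection B (- x)%R))%E; last first.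
  exact: (ge0_integral_gauss_rVN mxB).
apply: eq_integral => x _.
transitivity (nu (xsection (signed s @^-1` B) x)); first by [].
rewrite -(std_normalN (measurable_xsection (- x) mB)).
suff -> : xsection (signed s @^-1` B) x =
    (fun y : measurableTypeR R => - y) @^-1` xsection B (- x) by [].
apply/seteqP; split => y; rewrite /xsection/= !inE /signed/=;
  by rewrite sN scaleN1r mulN1r.
Qed.

Section relabelling.
Variable m : nat.
Local Notation n := (N + m)%N.

(** Brings the signed vertices of a given facet to the first [N] places without changing the law of
    the sample, so that all facets contribute equally in expectation. *)
Definition relabel (s : 'S_n) (eta : 'I_n -> S) (W : n.-tuple E) : n.-tuple E :=
  [tuple signed (eta i) (tnth W (s i)) | i < n].

Lemma integral_relabel s eta (F : n.-tuple E -> \bar R) :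
  (forall i, sg i = 1 \/ sg i = -1) ->
  measurable_fun setT F -> (forall W, 0 <= F W)%E ->
  (\int[tuple_power lifted_gauss n]_W F (relabel s eta W) =
   \int[tuple_power lifted_gauss n]_W F W)%E.
Proof.
move=> sg1 mF F0.
apply: (@ge0_integral_tuple_power_perm _ _ _ lifted_gauss n s
  (fun i => signed (eta i)) F) => //.
  by move=> i; exact: measurable_signed.
by move=> i B mB; exact: lifted_gauss_signed.
Qed.

Lemma measurable_relabel s eta : measurable_fun setT (relabel s eta).
Proof.
apply: measurable_mktuple => i.
exact: (measurableT_comp (measurable_signed _) (measurable_tnth _)).
Qed.

Variables (s : 'S_n) (eta : 'I_n -> S) (W : n.-tuple E).
Variables (f : {ffun 'I_N -> 'I_n * S}).
Hypothesis fE : forall j, f j = (s (lshift m j), eta (lshift m j)).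
Local Notation v := (fun k => hom (points W k).1).
Local Notation z := (fun k => (points W k).2).
Local Notation V := (first_part (relabel s eta W)).

Lemma basis_mx_relabel : basis_mx v f = lifted_mx V.
Proof. by apply/row_matrixP => j; rewrite !rowK !tnth_mktuple fE. Qed.

Lemma basis_dual_relabel : basis_dual v z f = lifted_dual V.
Proof.
rewrite /basis_dual basis_mx_relabel; congr (_ *m _).
by apply/rowP => j; rewrite !mxE !tnth_mktuple fE.
Qed.

Local Notation height_below c w :=
  (forall t : S, (signed t w).2 <= dotp (hom (signed t w).1) c).

(** The rules [e] and [h] are consequences of a whole family of signed copies lying below the
    hyperplane, so dual feasibility implies acceptance. *)
Lemma dual_feasible_le_facet_indicator (s0 : S) (e : R -> bool)
    (h : 'rV[R]_N -> E -> bool) :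
  sg s0 = 1 -> (forall k, eta (rshift N k) = s0) ->
  (forall c w, height_below c w -> e (height c)) ->
  (forall c w, height_below c w -> h c w) ->
  facet_wt (fun k => (points W k).1) f * (dual_feasible v z f)%:R <=
  facet_indicator e h (relabel s eta W).
Proof.
move=> s01 eta0 He Hh; rewrite /facet_wt /facet_indicator basis_mx_relabel.
rewrite -basis_dual_relabel -mulrA ler_wpM2l//.
have [/forallP df|_] := boolP (dual_feasible _ _ _); last first.
  by rewrite mulr_ge0// prodr_ge0.
have below i : height_below (basis_dual v z f) (tnth W i) by move=> t; exact: (df (i, t)).
(* Any sample point can witness the condition on the height; the first one always exists. *)
rewrite (He _ _ (below (lshift m ord0))) mul1r big1// => k _.
rewrite tnth_mktuple eta0 Hh//.
suff -> : signed s0 (tnth W (s (rshift N k))) = tnth W (s (rshift N k)) by exact: below.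
by case: (tnth _ _) => x y; rewrite /signed s01 scale1r mul1r.
Qed.

(** Conversely, strict rules place everything off the basis strictly below: [h] handles the points
    that are not vertices, while [e] handles the other signed copies of the vertices. *)
Lemma facet_indicator_le_strictly_dual_feasible (s0 : S) (e : R -> bool)
    (h : 'rV[R]_N -> E -> bool) :
  sg s0 = 1 -> (forall k, eta (rshift N k) = s0) ->
  (forall c w t t', e (height c) -> t != t' ->
    (signed t w).2 = dotp (hom (signed t w).1) c ->
    (signed t' w).2 < dotp (hom (signed t' w).1) c) ->
  (forall c w t, h c w -> (signed t w).2 < dotp (hom (signed t w).1) c) ->
  facet_indicator e h (relabel s eta W) <=
  facet_wt (fun k => (points W k).1) f * (strictly_dual_feasible v z f)%:R.
Proof.
move=> s01 eta0 He Hh; rewrite /facet_wt /facet_indicator basis_mx_relabel.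
rewrite -basis_dual_relabel -mulrA.
have [uM|] := boolP (lifted_mx V \in unitmx); last first.
  by rewrite unitmxE unitfE negbK => /eqP ->; rewrite normr0 !mul0r.
rewrite ler_wpM2l//; have [ec|_] := boolP (e _); last by rewrite mul0r.
rewrite mul1r.
have [/forallP hc|] := boolP [forall k, h (basis_dual v z f)
    (tnth (relabel s eta W) (rshift N k))]; last first.
  rewrite negb_forall => /existsP[k /negbTE hk].
  by rewrite (bigD1 k)//= hk mul0r.
rewrite [X in X <= _]big1; last by move=> k _; rewrite hc.
rewrite ler1n lt0b; apply/forallP => -[i t]; apply/implyP => it.
have [j iE] : exists j, i = s j by exists ((s^-1)%g i); rewrite permKV.
move: it; rewrite {}iE; case: (split_ordP j) => {}j -> it; last first.
  have := hc j; rewrite tnth_mktuple eta0.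
  suff -> : signed s0 (tnth W (s (rshift N j))) = tnth W (s (rshift N j)).
    by move/Hh; exact.
  by case: (tnth _ _) => x y; rewrite /signed s01 scale1r mul1r.
(* Here the point is a copy of a vertex with another sign, the sign of the vertex itself being
   excluded by [it]. *)
apply: (He _ (tnth W (s (lshift m j))) (eta (lshift m j)) t) => //.
  by apply: contra it => /eqP <-; rewrite -fE codom_f.
have uf : basis_mx v f \in unitmx by rewrite basis_mx_relabel.
by have := dotp_basis_dual z j uf; rewrite fE => ->.
Qed.

End relabelling.

End signed_points.

(** * Auxiliary randomness *)

Section generic_heights.
Context {R : realType}.
Local Notation nu := (@std_normal R).
Local Open Scope ereal_scope.

Lemma gauss_rV_hyperplane n (w : 'rV[R]_n) : w != 0%R ->
  gauss_rV n [set x | dotp x w = 0%R] = 0.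
Proof.
move=> w0.
have mH : measurable [set x : 'rV[R]_n | dotp x w = 0%R].
  by apply: measurable_eq0; apply: measurable_dotpl; exact: measurable_id.
rewrite gauss_rVE//; apply: null_set_integral => //.
  apply: measurable_funTS; apply/measurable_EFinP.
  have -> : @std_normal_vector_pdf R n = @prod_phi R n.
    by apply/funext => x; rewrite prod_phiE.
  exact: measurable_prod_phi.
have c0 : cons_rV (0%R, w) != 0%R.
  apply: contra_neq w0 => /rowP c0; apply/rowP => i.
  by have := c0 (lift ord0 i); rewrite cons_rVS !mxE.
rewrite -(lebesgue_rV_hyperplane c0); congr (lebesgue_rV R n _).
by apply/seteqP; split => y; rewrite /= dotp_hom add0r.
Qed.

(** The height vectors linear in the points form a space of dimension at most [d], contained in the
    hyperplane orthogonal to some nonzero [w], which is null. *)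
Lemma ae_heights_not_linear d n (X : n.-tuple 'rV[R]_d) : (d < n)%N ->
  {ae tuple_power nu n, forall Z, ~ exists b, forall i,
    tnth Z i = dotp (tnth X i) b}.
Proof.
move=> dn; pose A : 'M[R]_(n, d) := (\matrix_i tnth X i)%R.
have : kermx A != 0%R.
  rewrite kermx_eq0 -row_leq_rank -ltnNge.
  by rewrite (leq_ltn_trans (rank_leq_col A)).
move=> /rowV0Pn[w /sub_kermxP wA w0].
have mH : measurable [set x : 'rV[R]_n | dotp x w = 0%R].
  by apply: measurable_eq0; apply: measurable_dotpl; exact: measurable_id.
exists (@row_of_tuple R n @^-1` [set x | dotp x w = 0%R]); split.
- by rewrite -[X in measurable X]setTI; exact: measurable_row_of_tuple.
- exact: gauss_rV_hyperplane.
move=> Z /= /contrapT[b Zb].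
rewrite dotpE.
have -> : row_of_tuple Z = (b *m A^T)%R.
  apply/rowP => i; rewrite !mxE Zb; apply: eq_bigr => j _.
  by rewrite !mxE mulrC.
by rewrite trmx_mul trmxK mulmxA wA mul0mx mxE.
Qed.

End generic_heights.

Section iid_sandwich.
Context {R : realType} {d1 d2 dT : measure_display} {E1 : measurableType d1}
  {E2 : measurableType d2} {T : measurableType dT}.
Variables (mu1 : probability E1 R) (mu2 : probability E2 R) (P : probability T R).
Variables (n : nat) (X : 'I_n -> T -> E1).
Local Open Scope ereal_scope.
Local Notation zip Xs Zs := [tuple (tnth Xs i, tnth Zs i) | i < n].

(* The two bounds replace the measurability of [V]; the second component of the
   pairs is auxiliary randomness. *)
Lemma iid_sandwich (lower upper : n.-tuple (E1 * E2) -> \bar R)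
    (V : n.-tuple E1 -> \bar R) (c : \bar R) :
  (forall i, measurable_fun setT (X i)) ->
  (forall B : 'I_n -> set E1, (forall i, measurable (B i)) ->
    P [set w | forall i, B i (X i w)] = \prod_(i < n) mu1 (B i)) ->
  measurable_fun setT lower -> measurable_fun setT upper ->
  (forall W, 0 <= lower W) -> (forall W, 0 <= upper W) ->
  (forall Xs Zs, lower (zip Xs Zs) <= V Xs) ->
  (forall Xs, {ae tuple_power mu2 n, forall Zs, V Xs <= upper (zip Xs Zs)}) ->
  \int[tuple_power (mu1 \x mu2) n]_W lower W = c ->
  \int[tuple_power (mu1 \x mu2) n]_W upper W = c ->
  \int[P]_w V [tuple X i w | i < n] = c.
Proof.
move=> mX PX ml mu l0 u0 lV Vu lc uc.
have mzip : measurable_fun setT (fun q : n.-tuple E1 * n.-tuple E2 => zip q.1 q.2).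
  apply: measurable_mktuple => i; apply: measurable_fun_pair.
    exact: (measurableT_comp (measurable_tnth i) measurable_fst).
  exact: (measurableT_comp (measurable_tnth i) measurable_snd).
have fubini (F : n.-tuple (E1 * E2) -> \bar R) :
    measurable_fun setT F -> (forall W, 0 <= F W) ->
    \int[P]_w \int[tuple_power mu2 n]_Zs F (zip [tuple X i w | i < n] Zs) =
    \int[tuple_power (mu1 \x mu2) n]_W F W.
  move=> mF F0; rewrite -ge0_integral_tuple_zip//.
  apply: (@ge0_integral_iid _ _ _ mu1 _ _ P n X
    (fun Xs => \int[tuple_power mu2 n]_Zs F (zip Xs Zs))) => //.
    apply: (@measurable_integral2 _ _ _ _ _ (tuple_power mu2 n)
      (fun Xs Zs => F (zip Xs Zs))) => //.
    exact: (measurableT_comp mF mzip).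
  by move=> Xs; exact: integral_ge0.
(* Inherited from [lower], evaluated at some tuple; one exists because the total mass is 1. *)
have V0 Xs : 0 <= V Xs.
  have [Z _] : exists Z : n.-tuple E2, setT Z.
    apply: contrapT => /forallNP H.
    have := @probability_setT _ _ _ (tuple_power mu2 n).
    rewrite (_ : setT = set0) ?measure0.
      by move/eqP; rewrite eq_sym onee_eq0.
    by apply/seteqP; split => // Z; exact: H.
  exact: le_trans (lV Xs Z).
have cstE (a : \bar R) : \int[tuple_power mu2 n]_Zs a = a.
  rewrite (integral_cst (tuple_power mu2 n))// -[RHS]mule1; congr (_ * _).
  exact: probability_setT.
apply/eqP; rewrite eq_le; apply/andP; split.
  rewrite -uc -(fubini upper)//.
  apply: ge0_le_integral_nonmeasurable => // w.
  set Xs := [tuple X i w | i < n].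
  (* [V Xs] equals its mean over the auxiliary variables, and under that mean the almost sure bound
     can be used. *)
  rewrite -[leLHS](cstE (V Xs)).
  apply: ae_ge0_le_integral => //.
    exact: (measurableT_comp mu (measurableT_comp mzip (@pair1_measurable _ _ _ _ Xs))).
  by apply: filterS (Vu Xs) => Zs ? _.
rewrite -lc -(fubini lower)//.
apply: ge0_le_integral_nonmeasurable => w.
  exact: integral_ge0.
rewrite -[leRHS](cstE (V _)).
by apply: ge0_le_integral_nonmeasurable.
Qed.

End iid_sandwich.

(** * The expected volume of a signed hull *)

Section expected_hull_volume.
Context {R : realType} {d m : nat} {S : finType}.
Variables (sg : S -> R) (s0 : S).
Hypotheses (sg1 : forall s, sg s = 1 \/ sg s = -1) (sg_s0 : sg s0 = 1).
Local Notation N := d.+1.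
Local Notation n := (N + m)%N.
Local Notation nu := (@std_normal R).
Local Notation E := ('rV[R]_d * measurableTypeR R)%type.
Local Notation pow := (tuple_power (@lifted_gauss R d) n).
Local Notation regular f := (injectiveb (fun j => (f j).1)).
Local Notation signed := (signed sg).

(** The pair [ele], [hle] is the weak rule and bounds the volume from above, [elt], [hlt] is the
    strict rule and bounds it from below; [J] is the integral common to both. *)
Variables (hle hlt : 'rV[R]_N -> E -> bool) (ele elt : R -> bool) (J : \bar R).
Local Notation FIle := (@facet_indicator R d m ele hle).
Local Notation FIlt := (@facet_indicator R d m elt hlt).
Local Notation C := ((N`!%:R * kappa R d / d`!%:R)%:E * J)%E.
Hypotheses (mle : measurable_fun setT FIle) (mlt : measurable_fun setT FIlt).
Hypotheses (intle : (\int[pow]_W (FIle W)%:E = C)%E)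
           (intlt : (\int[pow]_W (FIlt W)%:E = C)%E).

Local Notation below c w :=
  (forall s : S, (signed s w).2 <= dotp (hom (signed s w).1) c).
Hypothesis ele_below : forall (c : 'rV_N) (w : E), below c w -> ele (height c).
Hypothesis hle_below : forall (c : 'rV_N) (w : E), below c w -> hle c w.
Hypothesis elt_below : forall (c : 'rV_N) (w : E) s s', elt (height c) -> s != s' ->
  (signed s w).2 = dotp (hom (signed s w).1) c ->
  (signed s' w).2 < dotp (hom (signed s' w).1) c.
Hypothesis hlt_below : forall (c : 'rV_N) (w : E) s, hlt c w ->
  (signed s w).2 < dotp (hom (signed s w).1) c.
(* A facet through both [signed s w] and [signed s' w] thus forces the heights to
   be linear in the points, an event of probability zero. *)
Hypothesis degenerate : forall (c : 'rV_N) (w w' : E) s s', s != s' ->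
  (signed s w).2 = dotp (hom (signed s w).1) c ->
  (signed s' w).2 = dotp (hom (signed s' w).1) c ->
  below c w' -> w'.2 = dotp w'.1 (rV_tail c).

Let perm_of : exists s : {ffun 'I_N -> 'I_n * S} -> 'S_n,
  forall f : {ffun 'I_N -> 'I_n * S}, regular f -> forall j, s f (lshift m j) = (f j).1.
Proof.
have ex (f : {ffun 'I_N -> 'I_n * S}) : exists s : 'S_n,
    regular f -> forall j, s (lshift m j) = (f j).1.
  have [/injectiveP/injective_extends_perm[s sE]|] := boolP (regular f).
    by exists s.
  by exists 1%g.
by have [s sE] := choice ex; exists s.
Qed.

(** Points off the facet receive the sign 1, since the rules already account for all their signed
    copies. *)
Let eta (f : {ffun 'I_N -> 'I_n * S}) (i : 'I_n) : S :=
  if fintype.split i is inl j then (f j).2 else s0.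

Let etal f j : eta f (lshift m j) = (f j).2.
Proof. by rewrite /eta -[lshift m j]/(unsplit (inl j)) unsplitK. Qed.

Let etar f k : eta f (rshift N k) = s0.
Proof. by rewrite /eta -[rshift N k]/(unsplit (inr k)) unsplitK. Qed.

Let hull (W : n.-tuple E) : set 'rV[R]_d :=
  convex_hull (range (fun k => (points sg W k).1)).

Local Open Scope ereal_scope.

Section sums.
Variable s : {ffun 'I_N -> 'I_n * S} -> 'S_n.
Hypothesis sE : forall f : {ffun 'I_N -> 'I_n * S}, regular f -> forall j, s f
  (lshift m j) = (f j).1.

Let fE (f : {ffun 'I_N -> 'I_n * S}) : regular f -> forall j, f j = (s f
  (lshift m j), eta f (lshift m j)).
Proof. by move=> rf j; rewrite sE// etal; case: (f j). Qed.

Definition facet_sum (F : n.-tuple E -> R) (W : n.-tuple E) : R :=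
  (\sum_(f : {ffun 'I_N -> 'I_n * S} | regular f) F (relabel sg (s f) (eta f) W))%R.

Let measurable_facet_sum F : measurable_fun setT F ->
  measurable_fun setT (facet_sum F).
Proof.
move=> mF; rewrite /facet_sum.
under eq_fun do rewrite big_mkcond.
apply: measurable_sum => f; case: (regular f); last exact: measurable_cst.
exact: (measurableT_comp mF (measurable_relabel _ _ _)).
Qed.

Let integral_facet_sum (F : n.-tuple E -> R) :
  measurable_fun setT F -> (forall W, 0 <= F W)%R ->
  \int[pow]_W (F W)%:E = C ->
  \int[pow]_W (facet_sum F W)%:E = (n ^_ N * #|S| ^ N)%:R%:E * C.
Proof.
move=> mF F0 FC.
pose fs := [seq f : {ffun 'I_N -> 'I_n * S} <- index_enum {ffun 'I_N -> 'I_n *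
  S} | regular f].
rewrite (eq_integral (fun W : n.-tuple E => \sum_(f <- fs)
    (F (relabel sg (s f) (eta f) W))%:E)); last first.
  by move=> W _; rewrite sumEFin big_filter.
rewrite ge0_integral_sum//; last 2 first.
- move=> f; apply/measurable_EFinP.
  exact: (measurableT_comp mF (measurable_relabel _ _ _)).
- by move=> f W _; rewrite lee_fin.
rewrite (eq_bigr (fun=> C)) => [|f _]; last first.
  rewrite -FC (@integral_relabel R d S sg m (s f) (eta f) (fun W => (F W)%:E))//.
    exact/measurable_EFinP.
rewrite big_filter big_const.
have iterE (k : nat) (x : \bar R) : iter k (adde x) 0 = k%:R%:E * x.
  elim: k => [|k IH]; first by rewrite mul0e.
  by rewrite iterS IH -natr1 EFinD ge0_muleDl// mul1e addeC.
rewrite iterE; congr (_%:R%:E * _).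
by rewrite -[n in (n ^_ _)%N]card_ord -card_injective_fst; apply: eq_card => f;
  rewrite [RHS]inE.
Qed.

Local Notation p W := (fun k => (points sg W k).1).
Local Notation v W := (fun k => hom (points sg W k).1).
Local Notation z W := (fun k => (points sg W k).2).

Let facet_sum_le W : (facet_sum FIlt W <=
  \sum_f facet_wt (p W) f * (strictly_dual_feasible (v W) (z W) f)%:R)%R.
Proof.
rewrite /facet_sum big_mkcond; apply: ler_sum => f _.
case: ifPn => [rf|_]; last by rewrite mulr_ge0// facet_wt_ge0.
exact: (facet_indicator_le_strictly_dual_feasible _ (fE rf) sg_s0 (etar f)
  elt_below hlt_below).
Qed.

(** An irregular [f] uses one sample point twice. With equal signs its matrix is singular and the
    weight is 0; with different signs [degenerate] makes all heights linear in the points, against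
    the assumption on [W]. *)
Let le_facet_sum W :
  ~ (exists b, forall i, (tnth W i).2 = dotp (tnth W i).1 b) ->
  (\sum_f facet_wt (p W) f * (dual_feasible (v W) (z W) f)%:R <=
    facet_sum FIle W)%R.
Proof.
move=> gen; rewrite /facet_sum [leRHS]big_mkcond; apply: ler_sum => f _.
case: ifPn => [rf|/injectivePn[i [j ij fij]]].
  exact: (dual_feasible_le_facet_indicator _ (fE rf) sg_s0 (etar f)
    ele_below hle_below).
have [uf|] := boolP (basis_mx (v W) f \in unitmx); last first.
  by rewrite unitmxE unitfE negbK /facet_wt => /eqP ->; rewrite normr0 !mul0r.
have [/forallP df|_] := boolP (dual_feasible _ _ _); last by rewrite mulr0.
exfalso; apply: gen; exists (rV_tail (basis_dual (v W) (z W) f)) => k.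
have tight l := dotp_basis_dual (z W) l uf.
have := tight i; have := tight j.
rewrite /points -fij => tj ti.
apply: (@degenerate _ (tnth W (f i).1) (tnth W k) (f i).2 (f j).2 _
  (esym ti) (esym tj)) => [|t]; last exact: (df (k, t)).
apply: contra ij => /eqP e2; apply/eqP/(basis_inj uf).
by rewrite [LHS]surjective_pairing [RHS]surjective_pairing -fij -e2.
Qed.

Lemma expected_volume_of_perm dT (T : measurableType dT)
    (P : probability T R) (X : 'I_n -> T -> 'rV[R]_d) :
  (forall i, measurable_fun setT (X i)) ->
  (forall B : 'I_n -> set 'rV[R]_d, (forall i, measurable (B i)) ->
    P [set w | forall i, B i (X i w)] = \prod_(i < n) gauss_rV d (B i)) ->
  \int[P]_w lebesgue_rV R d
    (convex_hull (range (fun k : 'I_n * S => (sg k.2 *: X k.1 w)%R))) =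
  N`!%:R^-1%:E * ((n ^_ N * #|S| ^ N)%:R%:E * C).
Proof.
move=> mX PX.
pose V (Xs : n.-tuple 'rV[R]_d) := lebesgue_rV R d
  (convex_hull (range (fun k : 'I_n * S => (sg k.2 *: tnth Xs k.1)%R))).
have pE (Xs : n.-tuple 'rV[R]_d) (Zs : n.-tuple (measurableTypeR R)) : p [tuple
  (tnth Xs i, tnth Zs i) | i < n] =
    (fun k : 'I_n * S => (sg k.2 *: tnth Xs k.1)%R).
  by apply/funext => k; rewrite /points tnth_mktuple.
have F0 e h W : (0 <= facet_sum (@facet_indicator R d m e h) W)%R.
  by apply: sumr_ge0 => f _; exact: facet_indicator_ge0.
have integral_scaled_facet_sum e h (F := @facet_indicator R d m e h) :
    measurable_fun setT F -> \int[pow]_W (F W)%:E = C ->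
    \int[pow]_W (N`!%:R^-1%:E * (facet_sum F W)%:E) =
    N`!%:R^-1%:E * ((n ^_ N * #|S| ^ N)%:R%:E * C).
  move=> mF FC.
  have mS : measurable_fun setT (fun W => (facet_sum F W)%:E).
    by apply/measurable_EFinP; exact: measurable_facet_sum.
  have S0 W : setT W -> 0 <= (facet_sum F W)%:E by move=> _; rewrite lee_fin; exact: F0.
  rewrite ge0_integralZl//.
  congr (_ * _); apply: (integral_facet_sum mF _ FC) => W.
  exact: facet_indicator_ge0.
transitivity (\int[P]_w V [tuple X i w | i < n]).
  apply: eq_integral => w _; rewrite /V.
  suff -> : (fun k : 'I_n * S => (sg k.2 *: tnth [tuple X i w | i < n] k.1)%R) =
      (fun k => (sg k.2 *: X k.1 w)%R) by [].
  by apply/funext => k; rewrite tnth_mktuple.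
apply: (iid_sandwich (mu1 := gauss_rV d) (mu2 := nu)
  (lower := fun W => N`!%:R^-1%:E * (facet_sum FIlt W)%:E)
  (upper := fun W => N`!%:R^-1%:E * (facet_sum FIle W)%:E)) => //.
- by apply: emeasurable_funM => //; apply/measurable_EFinP; exact: measurable_facet_sum.
- by apply: emeasurable_funM => //; apply/measurable_EFinP; exact: measurable_facet_sum.
- by move=> W; rewrite mule_ge0// lee_fin.
- by move=> W; rewrite mule_ge0// lee_fin.
- move=> Xs Zs; rewrite /V -(pE Xs Zs).
  set W := [tuple _ | _ < _].
  have /andP[+ _] := volume_sandwich (p W) (z W).
  by rewrite lee_pdivrMl ?ltr0n ?fact_gt0//; apply: le_trans;
    rewrite lee_fin facet_sum_le.
- move=> Xs; have dn : (d < n)%N by rewrite leq_addr.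
  apply: (@filterS _ _ (ae_filter_ringOfSetsType _) _ _ _
    (ae_heights_not_linear Xs dn)) => Zs gen.
  rewrite /V -(pE Xs Zs); set W := [tuple _ | _ < _].
  have /andP[_] := volume_sandwich (p W) (z W).
  rewrite lee_pdivlMl ?ltr0n ?fact_gt0//.
  move/le_trans; apply; rewrite lee_fin le_facet_sum// => -[b Wb]; apply: gen.
  by exists b => i; have := Wb i; rewrite tnth_mktuple.
- exact: integral_scaled_facet_sum.
- exact: integral_scaled_facet_sum.
Qed.

End sums.

Lemma expected_volume dT (T : measurableType dT)
    (P : probability T R) (X : 'I_n -> T -> 'rV[R]_d) :
  (forall i, measurable_fun setT (X i)) ->
  (forall B : 'I_n -> set 'rV[R]_d, (forall i, measurable (B i)) ->
    P [set w | forall i, B i (X i w)] = \prod_(i < n) gauss_rV d (B i)) ->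
  \int[P]_w lebesgue_rV R d
    (convex_hull (range (fun k : 'I_n * S => (sg k.2 *: X k.1 w)%R))) =
  N`!%:R^-1%:E * ((n ^_ N * #|S| ^ N)%:R%:E * C).
Proof.
by move=> mX PX; have [s sE] := perm_of; exact: expected_volume_of_perm sE _ _ _ _ mX PX.
Qed.

End expected_hull_volume.

(** * The two polytopes *)

Section facet_rules.
Context {R : realType} {d : nat}.
Local Notation N := d.+1.
Local Notation nu := (@std_normal R).
Local Notation E := ('rV[R]_d * measurableTypeR R)%type.

Lemma integral_bool_natr dT (T : measurableType dT)
    (mu : {measure set T -> \bar R}) (b : T -> bool) :
  measurable [set t | b t] ->
  (\int[mu]_t ((b t)%:R : R)%:E = mu [set t | b t])%E.
Proof.
move=> mb; rewrite -[X in mu X]setIT -integral_indic//.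
apply: eq_integral => t _; rewrite indicE; congr ((nat_of_bool _)%:R%:E).
by apply/idP/idP; rewrite inE.
Qed.

(* A rule [A] compares the offset of a hyperplane with the residual height of a
   point above the parallel hyperplane through the origin. *)
Variable A : R -> R -> bool.
Hypothesis mA : measurable_fun setT (fun q : R * R => (A q.1 q.2)%:R : R).
Hypothesis A_scale : forall a t s, 0 < s -> A (a * s) (t * s) = A a t.

Definition facet_rule (c : 'rV[R]_N) (w : E) : bool :=
  A (c 0 ord0) (w.2 - dotp w.1 (rV_tail c)).

Lemma measurable_facet_rule : measurable_fun setT
  (fun q : 'rV[R]_N * E => (facet_rule q.1 q.2)%:R : R).
Proof.
apply: (measurableT_comp mA (_ : measurable_fun setT (fun q : 'rV[R]_N * E =>
  (q.1 0 ord0, q.2.2 - dotp q.2.1 (rV_tail q.1))))).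
have m2 : measurable_fun setT (fun q : 'rV[R]_N * E => q.2) := measurable_snd.
apply: measurable_fun_pair.
  by apply: measurable_rV_coord; exact: measurable_fst.
apply: measurable_funB; first exact: (measurableT_comp measurable_snd m2).
apply: measurable_dotp; first exact: (measurableT_comp measurable_fst m2).
apply: measurable_rVP => i; under eq_fun do rewrite mxE.
by apply: measurable_rV_coord; exact: measurable_fst.
Qed.

(** The residual height is [hnorm (rV_tail c)] times a standard normal variable, and scale
    invariance of [A] moves this factor into the offset, which becomes the height. *)
Lemma integral_facet_rule c :
  (\int[lifted_gauss]_w (facet_rule c w)%:R%:E =
   \int[nu]_t ((A (height c) t)%:R : R)%:E)%E.
Proof.
pose G (u : R) : \bar R := ((A (c 0 ord0) u)%:R : R)%:E.
have mG : measurable_fun setT G.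
  apply/measurable_EFinP.
  exact: (measurableT_comp mA (@pair1_measurable _ _ _ _ (c 0 ord0))).
have mh : measurable_fun setT (fun w : E => ((facet_rule c w)%:R : R)%:E).
  apply/measurable_EFinP.
  exact: (measurableT_comp measurable_facet_rule (@pair1_measurable _ _ _ _ c)).
transitivity (\int[gauss_rV d]_x \int[nu]_z G (z - dotp x (rV_tail c))%R)%E.
  by rewrite /lifted_gauss fubini_tonelli1.
rewrite gauss_affine_law//; last by move=> t; rewrite lee_fin.
apply: eq_integral => t _; rewrite /G.
have s0 := hnorm_gt0 (rV_tail c).
by rewrite -[in RHS](A_scale (height c) t s0) /height divfK// gt_eqF.
Qed.

End facet_rules.

Section half_line_rule.
Context {R : realType}.
Local Notation nu := (@std_normal R).

(** [b] selects the weak comparison. The half-line serves the plain hull; the interval expresses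
    that a point and its opposite both lie below the hyperplane. *)
Definition half_line_rule (b : bool) (a t : R) : bool := t < a ?<= if b.
Definition interval_rule (b : bool) (a t : R) : bool := `|t| < a ?<= if b.

Lemma measurable_lteif dT (T : measurableType dT) (b : bool) (f g : T -> R) :
  measurable_fun setT f -> measurable_fun setT g ->
  measurable_fun setT (fun x => (f x < g x ?<= if b)%:R : R).
Proof.
move=> mf mg; apply: measurable_bool_natr.
rewrite [X in measurable X](_ : _ = (fun x => f x < g x ?<= if b) @^-1` [set true]).
  rewrite -[X in measurable X]setTI.
  by case: b; [apply: measurable_fun_ler|apply: measurable_fun_ltr].
by apply/seteqP; split.
Qed.

Lemma measurable_half_line_rule b : measurable_fun setT
  (fun q : R * R => (half_line_rule b q.1 q.2)%:R : R).
Proof. exact: measurable_lteif. Qed.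

Lemma measurable_interval_rule b : measurable_fun setT
  (fun q : R * R => (interval_rule b q.1 q.2)%:R : R).
Proof.
apply: measurable_lteif => //; apply: measurableT_comp => //.
Qed.

Lemma half_line_rule_scale b a t s : 0 < s ->
  half_line_rule b (a * s) (t * s) = half_line_rule b a t.
Proof. by move=> s0; rewrite /half_line_rule lteif_pM2r. Qed.

Lemma interval_rule_scale b a t s : 0 < s ->
  interval_rule b (a * s) (t * s) = interval_rule b a t.
Proof.
by move=> s0; rewrite /interval_rule normrM (gtr0_norm s0) lteif_pM2r.
Qed.

Lemma integral_half_line_rule b a :
  (\int[nu]_t ((half_line_rule b a t)%:R : R)%:E = (Phi a)%:E)%E.
Proof.
have E : [set t | half_line_rule b a t] = [set` Interval -oo%O (BSide (~~ b) a)].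
  by apply/seteqP; split => t; rewrite /= in_itv /=; case: b.
rewrite integral_bool_natr E//.
by case: b {E}; [exact: std_normal_cdf|exact: std_normal_cdf_open].
Qed.

Lemma integral_interval_rule b a : 0 <= a ->
  (\int[nu]_t ((interval_rule b a t)%:R : R)%:E = (2 * Phi a - 1)%:E)%E.
Proof.
move=> a0.
have E : [set t | interval_rule b a t] =
    [set` Interval (BSide b (- a)) (BSide (~~ b) a)].
  by apply/seteqP; split => t; rewrite /= in_itv /= /interval_rule;
    case: b; rewrite /= ?ler_norml ?ltr_norml.
by rewrite integral_bool_natr E//; exact: std_normal_itv.
Qed.

End half_line_rule.

Section normal_cdf.
Context {R : realType}.
Local Notation nu := (@std_normal R).

(** An integral with a parameter, whose integrand is jointly measurable. *)
Lemma measurable_Phi : measurable_fun setT (@Phi R).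
Proof.
apply/measurable_EFinP.
rewrite (_ : EFin \o @Phi R =
    (fun a => \int[nu]_t ((half_line_rule true a t)%:R : R)%:E)%E); last first.
  by apply/funext => a; rewrite integral_half_line_rule.
apply: (@measurable_integral2 _ _ _ _ _ nu
  (fun a t : measurableTypeR R => ((half_line_rule true a t)%:R : R)%:E)).
  by apply/measurable_EFinP; exact: measurable_half_line_rule.
by move=> a t; rewrite lee_fin.
Qed.

Lemma Phi_ge0 (t : R) : 0 <= Phi t.
Proof. by rewrite -lee_fin -std_normal_cdf; exact: measure_ge0. Qed.

Lemma Phi_ge_half (t : R) : 0 <= t -> 0 <= 2 * Phi t - 1.
Proof.
by move=> t0; rewrite -lee_fin -(integral_interval_rule true)//; exact: integral_ge0.
Qed.

Lemma measurable_interval_density k l : measurable_fun setT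
  (fun t : R => ((2 * Phi t - 1) ^+ k * phi t ^+ l)%:E).
Proof.
apply/measurable_EFinP; apply: measurable_funM; apply: measurable_funX.
  apply: measurable_funB => //; apply: measurable_funM => //.
  exact: measurable_Phi.
exact: measurable_phi.
Qed.

End normal_cdf.

Section expected_hulls.
Context {R : realType} {d m : nat} {dT : measure_display} {T : measurableType dT}.
Variable P : probability T R.
Local Notation N := d.+1.
Local Notation n := (N + m)%N.
Local Notation E := ('rV[R]_d * measurableTypeR R)%type.
Variable X : 'I_n -> T -> 'rV[R]_d.
Hypothesis mX : forall i, measurable_fun setT (X i).
Hypothesis PX : forall B : 'I_n -> set 'rV[R]_d, (forall i, measurable (B i)) ->
  (P [set w | forall i, B i (X i w)] = \prod_(i < n) gauss_rV d (B i))%E.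

Lemma dotp_hom_signed (S : finType) (sg : S -> R) s (c : 'rV[R]_N) (w : E) :
  dotp (hom (signed sg s w).1) c = c 0 ord0 + sg s * dotp w.1 (rV_tail c).
Proof. by rewrite -[in LHS](cons_rV_tail c) dotp_hom dotpZl. Qed.

Local Open Scope ereal_scope.

Lemma expected_hull :
  \int[P]_w lebesgue_rV R d (convex_hull [set X i w | i in [set: 'I_n]]) =
  N`!%:R^-1%:E * ((n ^_ N)%:R%:E * ((N`!%:R * kappa R d / d`!%:R)%:E *
    \int[lebesgue_measure]_t (Phi t ^+ m * phi t ^+ N)%:E)).
Proof.
pose h b := facet_rule (d := d) (@half_line_rule R b).
have mh b := measurable_facet_rule (d := d) (@measurable_half_line_rule R b).
have me : measurable_fun setT (fun t : R => (true)%:R : R) by exact: measurable_cst.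
have ht b (c : 'rV[R]_N) : true -> \int[lifted_gauss]_w (h b c w)%:R%:E = (Phi
  (height c))%:E.
  move=> _; rewrite integral_facet_rule ?integral_half_line_rule//.
  - exact: measurable_half_line_rule.
  - by move=> a t s; exact: half_line_rule_scale.
have I b := integral_facet_indicator m me (mh b) measurable_Phi
  (fun t _ => Phi_ge0 t) (ht b).
have EV := @expected_volume R d m unit (cst 1%R) tt (fun=> or_introl erefl) erefl
  (h true) (h false) (fun=> true) (fun=> true) _
  (measurable_facet_indicator me (mh true)) (measurable_facet_indicator me (mh false))
  (I true) (I false).
have {EV} EV := EV _ _ _ _ _ _ T P X mX PX.
transitivity (\int[P]_w lebesgue_rV R d (convex_hull
    (range (fun k : 'I_n * unit => ((cst 1 k.2 : R) *: X k.1 w)%R)))).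
  apply: eq_integral => w _.
  suff -> : range (X^~ w) =
      range (fun k : 'I_n * unit => ((cst 1 k.2 : R) *: X k.1 w)%R) by [].
  apply/seteqP; split => _ [k _ <-]; last by exists k.1 => //; rewrite scale1r.
  by exists (k, tt) => //; rewrite scale1r.
rewrite EV.
- rewrite card_unit exp1n muln1; do 3 congr (_ * _).
  by apply: eq_integral => t _; rewrite mul1r.
- by [].
- move=> c w /(_ tt); rewrite dotp_hom_signed /signed/= !mul1r.
  by rewrite /h /facet_rule /half_line_rule/= lerBlDr.
- by move=> c w [] [].
- move=> c w s; rewrite dotp_hom_signed /signed/= !mul1r.
  by rewrite /h /facet_rule /half_line_rule/= ltrBlDr.
- by move=> c w w' [] [].
Qed.

Definition pm (b : bool) : R := (if b then -1 else 1)%R.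

Lemma positive_height (b : bool) (c : 'rV[R]_N) :
  (0 < height c ?<= if b)%R = (0 < c 0%R ord0 ?<= if b)%R.
Proof.
rewrite /height -[in LHS](mul0r (hnorm (rV_tail c))^-1%R) lteif_pM2r//.
by rewrite invr_gt0 hnorm_gt0.
Qed.

(** The weak and the strict sign condition differ only at 0, a null set. *)
Lemma integral_symmetric_density b :
  \int[@lebesgue_measure R]_t
    ((half_line_rule b t 0)%:R * (2 * Phi t - 1) ^+ m * phi t ^+ N)%R%:E =
  \int[@lebesgue_measure R]_(t in `[0%R, +oo[)
    ((2 * Phi t - 1) ^+ m * phi t ^+ N)%R%:E.
Proof.
have mf := @measurable_interval_density R m N.
transitivity (\int[@lebesgue_measure R]_(t in [set` Interval (BSide b 0%R) +oo%O])
    ((2 * Phi t - 1) ^+ m * phi t ^+ N)%R%:E); last first.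
  case: b => //; rewrite integral_itv_obnd_cbnd//.
  exact: measurable_funTS.
rewrite [RHS]integral_mkcond; apply: eq_integral => t _.
rewrite patchE mem_setE in_itv /= andbT /half_line_rule.
by case: b => /=; [case: (0 <= t)%R|case: (0 < t)%R]; rewrite /= ?mul1r ?mul0r.
Qed.

(** A hyperplane above a point and its opposite has nonnegative offset; the condition [e] records
    this and restricts the integral to the positive half-line. *)
Lemma expected_symmetric_hull :
  \int[P]_w lebesgue_rV R d (convex_hull ([set X i w | i in [set: 'I_n]] `|`
    [set (- X i w)%R | i in [set: 'I_n]])) =
  N`!%:R^-1%:E * ((n ^_ N * 2 ^ N)%:R%:E * ((N`!%:R * kappa R d / d`!%:R)%:E *
    \int[@lebesgue_measure R]_(t in `[0%R, +oo[)
      ((2 * Phi t - 1) ^+ m * phi t ^+ N)%:E)).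
Proof.
pose h b := facet_rule (d := d) (@interval_rule R b).
pose e (b : bool) (t : R) := half_line_rule b t 0.
have mh b := measurable_facet_rule (d := d) (@measurable_interval_rule R b).
have me b : measurable_fun setT (fun t : R => (e b t)%:R : R) by exact: measurable_lteif.
have e0 b t : e b t -> (0 <= t)%R by case: b => //; exact: ltW.
have ht b (c : 'rV[R]_N) : e b (height c) ->
    \int[lifted_gauss]_w (h b c w)%:R%:E = (2 * Phi (height c) - 1)%:E.
  move=> /e0 c0; rewrite integral_facet_rule ?integral_interval_rule//.
  - exact: measurable_interval_rule.
  - by move=> a t s; exact: interval_rule_scale.
have mp : measurable_fun setT (fun t : R => 2 * Phi t - 1)%R.
  apply: measurable_funB => //; apply: measurable_funM => //.
  exact: measurable_Phi.
have I b := integral_facet_indicator m (me b) (mh b) mp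
  (fun t et => Phi_ge_half (e0 b t et)) (ht b).
have {}I b := etrans (I b) (congr1 _ (integral_symmetric_density b)).
have pm1 b : pm b = 1%R \/ pm b = (-1)%R by case: b; [right|left].
have EV := @expected_volume R d m bool pm false pm1 erefl
  (h true) (h false) (e true) (e false) _
  (measurable_facet_indicator (me true) (mh true))
  (measurable_facet_indicator (me false) (mh false))
  (I true) (I false).
have {EV} EV := EV _ _ _ _ _ _ T P X mX PX.
transitivity (\int[P]_w lebesgue_rV R d (convex_hull
    (range (fun k : 'I_n * bool => (pm k.2 *: X k.1 w)%R)))).
  apply: eq_integral => w _.
  suff -> : [set X i w | i in [set: 'I_n]] `|` [set (- X i w)%R | i in [set: 'I_n]] =
      range (fun k : 'I_n * bool => (pm k.2 *: X k.1 w)%R) by [].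
  apply/seteqP; split => [_ [] [k _ <-]|_ [[k []] _ <-]] /=.
  - by exists (k, false) => //; rewrite scale1r.
  - by exists (k, true) => //; rewrite scaleN1r.
  - by right; exists k => //; rewrite scaleN1r.
  - by left; exists k => //; rewrite scale1r.
rewrite EV.
- by rewrite card_bool.
- move=> c w H; rewrite /e /half_line_rule positive_height/=.
  have := H true; have := H false; rewrite !dotp_hom_signed /signed/=.
  lra.
- move=> c w H; rewrite /h /facet_rule /interval_rule/= ler_norml.
  have := H true; have := H false; rewrite !dotp_hom_signed /signed/=.
  lra.
(* With a positive offset, if one of two opposite points lies on the hyperplane then the other is
   below it by twice the offset. *)
- move=> c w s s'; rewrite /e /half_line_rule positive_height !dotp_hom_signed /signed/=.
  by case: s; case: s' => // c0 _ /=; lra.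
- move=> c w s; rewrite /h /facet_rule /interval_rule/= ltr_norml.
  rewrite dotp_hom_signed /signed/=.
  by case: s => /=; lra.
(* Two opposite points on the hyperplane make the offset 0; the two inequalities for [w'] and its
   opposite then become an equality. *)
- move=> c w w' s s' ss' H1 H2 H.
  have := H true; have := H false; move: ss' H1 H2.
  rewrite !dotp_hom_signed /signed/=.
  by case: s; case: s' => // _ /=; lra.
Qed.

End expected_hulls.

Lemma iid_std_normal_vectors (R : realType) (n d : nat) (dT : measure_display)
    (T : measurableType dT) (P : probability T R)
    (X : 'I_n -> {RV P >-> 'rV[R]_d}) :
  independent_RVs X -> (forall i, std_normal_vector (X i)) ->
  forall B : 'I_n -> set 'rV[R]_d, (forall i, measurable (B i)) ->
  (P [set w | forall i, B i (X i w)] = \prod_(i < n) gauss_rV d (B i))%E.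
Proof.
move=> indep normal B mB.
have -> : [set w | forall i, B i (X i w)] =
    \bigcap_(i in [set` [set: 'I_n]%SET]) (X i @^-1` B i).
  apply/seteqP; split => w /= H i; first by move=> _; exact: H.
  by apply: H; rewrite /= inE.
rewrite indep//; apply: eq_big => [i|i _]; first by rewrite inE.
by rewrite gauss_rVE//; exact: (normal i _ (mB i)).
Qed.

Theorem theorem1p1 (R : realType) (n d : nat) (dT : measure_display)
    (T : measurableType dT) (P : probability T R)
    (X : 'I_n -> {RV P >-> 'rV[R]_d}) :
  (1 <= d)%N -> (d < n)%N ->
  independent_RVs X ->
  (forall i, std_normal_vector (X i)) ->
  (\int[P]_w lebesgue_rV R d (hull_points X w) =
    (kappa R d * n`!%:R / (d`!%:R * (n - d - 1)`!%:R))%:E *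
    \int[lebesgue_measure]_t (Phi t ^+ (n - d - 1) * phi t ^+ d.+1)%:E)%E /\
  (\int[P]_w lebesgue_rV R d (hull_sym_points X w) =
    (kappa R d * n`!%:R / (d`!%:R * (n - d - 1)`!%:R))%:E *
    \int[lebesgue_measure]_(t in `[0%R, +oo[)
      ((2 * Phi t - 1) ^+ (n - d - 1) * (2 * phi t) ^+ d.+1)%:E)%E.
Proof.
move=> _ dn; have [m nE] : exists m, n = (d.+1 + m)%N by exists (n - d.+1)%N;
  rewrite subnKC.
case: _ / (esym nE) X => X {dn nE} indep normal.
have -> : (d.+1 + m - d - 1 = m)%N by rewrite addSn subSn ?leq_addr// addKn subn1.
have mX i : measurable_fun setT (X i) by [].
have PX := iid_std_normal_vectors indep normal.
(* The falling factorial counts ordered choices of vertices and becomes [n!] when multiplied by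
   [m!]; the division by [(d.+1)!] forgets the order, and the other [(d.+1)!] is the mean squared
   determinant. *)
have cE : kappa R d * (d.+1 + m)`!%:R / (d`!%:R * m`!%:R) =
    (d.+1)`!%:R^-1 * (((d.+1 + m) ^_ d.+1)%:R * ((d.+1)`!%:R * kappa R d / d`!%:R)).
  have N0 k : k`!%:R != 0 :> R by rewrite pnatr_eq0 -lt0n fact_gt0.
  have -> : (d.+1 + m)`! = ((d.+1 + m) ^_ d.+1 * m`!)%N.
    by rewrite -[in m`!](addKn d.+1 m) ffact_fact// leq_addr.
  rewrite natrM; field.
  by rewrite !N0.
split.
  rewrite /hull_points (expected_hull mX PX) !muleA -!EFinM.
  by rewrite cE !mulrA.
rewrite /hull_sym_points (expected_symmetric_hull mX PX).
(* The sign choices at the [d.+1] vertices account for the factor 2 in front of [phi t]. *)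
rewrite [in RHS](eq_integral (fun t : measurableTypeR R => (2 ^+ d.+1)%:E *
  ((2 * Phi t - 1) ^+ m * phi t ^+ d.+1)%:E)%E); last first.
  by move=> t _; rewrite exprMn -EFinM mulrCA.
have mf := @measurable_interval_density R m d.+1.
have mf' : measurable_fun (`[0, +oo[%classic : set R)
    (fun t : R => ((2 * Phi t - 1) ^+ m * phi t ^+ d.+1)%:E).
  exact: measurable_funTS.
rewrite ge0_integralZl//; last first.
  move=> t /=; rewrite in_itv/= andbT => t0.
  by rewrite lee_fin mulr_ge0// exprn_ge0// ?Phi_ge_half// phi_ge0.
rewrite !muleA -!EFinM natrM natrX cE.
congr (_%:E * _)%E; ring.
Qed.
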